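(* Let $A$ be an $n\times n$ real expansive matrix. Suppose that there exists an orthonormal wavelet $\{\psi^1,\ldots,\psi^L\}\subset L^2(\mathbb{R}^n)$ (with respect to the dilation $A$ and the lattice $\mathbb{Z}^n$) such that each $\widehat{\psi^i}$ is a $C^\infty$ function with compact support and the space of negative dilates $$V_0=\overline{\operatorname{span}}\{D_{A^j}T_k\psi^l: j<0,\ k\in\mathbb{Z}^n,\ l=1,\ldots,L\}$$ is shift invariant. Then $A$ is a rational matrix, i.e., all entries of $A$ are rational.
   Context: A real $n\times n$ matrix $A$ is expansive if all its eigenvalues $\lambda$ satisfy $|\lambda|>1$. Let $T_yf(x)=f(x-y)$, $D_Pf(x)=|\det P|^{1/2}f(Px)$ for $P\in GL_n(\mathbb{R})$, and $\widehat f(\xi)=\int_{\mathbb{R}^n} f(x)e^{-2\pi i\langle x,\xi\rangle}dx$. A finite collection $\{\psi^1,\ldots,\psi^L\}\subset L^2(\mathbb{R}^n)$ is an orthonormal wavelet (for the dilation $A$ and lattice $\mathbb{Z}^n$) if $\{D_{A^j}T_k\psi^l: j\in\mathbb{Z},\ k\in\mathbb{Z}^n,\ l=1,\ldots,L\}$ is an orthonormal basis of $L^2(\mathbb{R}^n)$. A closed subspace $V\subset L^2(\mathbb{R}^n)$ is shift invariant if $T_k(V)\subset V$ for all $k\in\mathbb{Z}^n$. *)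

(* Defs.v *)
From HB Require Import structures.
From mathcomp Require Import all_boot all_order all_algebra.
From mathcomp Require Import complex.
From mathcomp Require Import all_classical all_reals all_analysis.

Set Implicit Arguments.
Unset Strict Implicit.
Unset Printing Implicit Defensive.

Import Order.TTheory GRing.Theory Num.Theory.
Import numFieldNormedType.Exports.

Local Open Scope classical_set_scope.
Local Open Scope ring_scope.
Local Open Scope complex_scope.

(* As for n.-tuple T in the library, matrices carry the sigma-algebra generated
   by their entries; for T = R this is the Borel sigma-algebra. *)
Definition measure_matrix_display : measure_display -> measure_display.
Proof. exact. Qed.

Section measurable_matrix.
Context {d : measure_display} {T : measurableType d}.
Variables m n : nat.

Definition matrix_measurable : set (set 'M[T]_(m, n)) :=
  <<s \bigcup_(ij in [set: 'I_m * 'I_n])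
        preimage_set_system setT (fun M : 'M[T]_(m, n) => M ij.1 ij.2)
          measurable >>.

Let matrix_measurable0 : matrix_measurable set0.
Proof. exact: sigma_algebra0. Qed.

Let matrix_measurableC A : matrix_measurable A -> matrix_measurable (~` A).
Proof. exact: sigma_algebraC. Qed.

Let matrix_measurable_bigcup (F : (set 'M[T]_(m, n))^nat) :
  (forall i, matrix_measurable (F i)) -> matrix_measurable (\bigcup_i (F i)).
Proof. exact: sigma_algebra_bigcup. Qed.

HB.instance Definition _ :=
  @isMeasurable.Build (measure_matrix_display d) 'M[T]_(m, n)
    matrix_measurable matrix_measurable0 matrix_measurableC
    matrix_measurable_bigcup.

End measurable_matrix.

Section matrix_measurable_fun.
Context {d d' : measure_display} {T : measurableType d} {S : measurableType d'}.
Variables m n : nat.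

Lemma measurable_mxentry (i : 'I_m) (j : 'I_n) :
  measurable_fun [set: 'M[T]_(m, n)] (fun M : 'M[T]_(m, n) => M i j).
Proof.
move=> _ Y mY; rewrite setTI; apply: sub_sigma_algebra.
by exists (i, j) => //; exists Y => //; rewrite setTI.
Qed.

Lemma measurable_fun_matrix (f : S -> 'M[T]_(m, n)) :
  (forall i j, measurable_fun [set: S] (fun x => f x i j)) ->
  measurable_fun [set: S] f.
Proof.
move=> mf _ Y; rewrite setTI => mY.
have H : @matrix_measurable d T m n `<=` [set A | measurable (f @^-1` A)].
  apply: smallest_sub.
    split => [|A|F] /=.
    - by rewrite preimage_set0.
    - by rewrite setTD preimage_setC => ?; exact: measurableC.
    - by rewrite preimage_bigcup => ?; exact: bigcupT_measurable.
  move=> A [[i j] _ [B mB <-]] /=; rewrite setTI.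
  by have := mf i j measurableT B mB; rewrite setTI.
exact: H.
Qed.

End matrix_measurable_fun.


Section lebesgue_measure_cV.
Variable R : realType.
Local Open Scope ereal_scope.

Definition cV_cons n (p : measurableTypeR R * 'cV[R]_n) : 'cV[R]_n.+1 :=
  \col_i (if unlift ord0 i is Some j then p.2 j 0%R else p.1).

Definition cV_uncons n (v : 'cV[R]_n.+1) : measurableTypeR R * 'cV[R]_n :=
  (v ord0 0%R, \col_j v (lift ord0 j) 0%R).

Lemma cV_consK n : cancel (@cV_cons n) (@cV_uncons n).
Proof.
move=> [a v]; rewrite /cV_uncons mxE unlift_none; congr pair.
by apply/matrixP => i j; rewrite !mxE liftK ord1.
Qed.

Lemma measurable_cV_cons n : measurable_fun [set: _] (@cV_cons n).
Proof.
apply: measurable_fun_matrix => i j.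
case: (unliftP ord0 i) => [k|] ->.
  under eq_fun do rewrite mxE liftK.
  apply: (measurableT_comp (measurable_mxentry k 0%R)).
  exact: measurable_snd.
under eq_fun do rewrite mxE unlift_none.
exact: measurable_fst.
Qed.

Lemma measurable_cV_uncons n : measurable_fun [set: _] (@cV_uncons n).
Proof.
apply: measurable_fun_pair; first exact: measurable_mxentry.
apply: measurable_fun_matrix => i j.
by under eq_fun do rewrite mxE; exact: measurable_mxentry.
Qed.

Section step.
Variables (n : nat) (mu : {sigma_finite_measure set 'cV[R]_n -> \bar R}).

Definition lebesgue_cV_step : set 'cV[R]_n.+1 -> \bar R :=
  pushforward (@lebesgue_measure R \x mu) (@cV_cons n).

Let step0 : lebesgue_cV_step set0 = 0.
Proof. by rewrite /lebesgue_cV_step /pushforward preimage_set0 measure0. Qed.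

Let step_ge0 A : 0 <= lebesgue_cV_step A.
Proof. by rewrite /lebesgue_cV_step /pushforward; exact: measure_ge0. Qed.

Let step_sigma_additive : semi_sigma_additive lebesgue_cV_step.
Proof.
have mf := @measurable_cV_cons n.
move=> F mF tF mUF; rewrite /lebesgue_cV_step /pushforward preimage_bigcup.
apply: measure_semi_sigma_additive.
- by move=> k; rewrite -[X in measurable X]setTI; exact: mf.
- apply/trivIsetP => /= i j _ _ ij; rewrite -preimage_setI.
  by move/trivIsetP : tF => /(_ _ _ _ _ ij) ->//; rewrite preimage_set0.
- by rewrite -preimage_bigcup -[X in measurable X]setTI; exact: mf.
Qed.

HB.instance Definition _ := isMeasure.Build _ _ _ lebesgue_cV_step
  step0 step_ge0 step_sigma_additive.

Let step_sigma_finite : sigma_finite setT lebesgue_cV_step.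
Proof.
have /sigma_finiteP[F [TF ndF Foo]] := sigma_finiteT (@lebesgue_measure R).
have /sigma_finiteP[G [TG ndG Goo]] := sigma_finiteT mu.
exists (fun k => @cV_uncons n @^-1` (F k `*` G k)).
  apply/esym; rewrite -subTset => v _.
  have [i _ Fi] : (\bigcup_i F i) (cV_uncons v).1 by rewrite -TF.
  have [j _ Gj] : (\bigcup_j G j) (cV_uncons v).2 by rewrite -TG.
  exists (maxn i j) => //; split.
    by move: Fi; exact/subsetPset/ndF/leq_maxl.
  by move: Gj; exact/subsetPset/ndG/leq_maxr.
move=> k; have [mF Fk] := Foo k; have [mG Gk] := Goo k; split.
  rewrite -[X in measurable X]setTI.
  by apply: measurable_cV_uncons => //; exact: measurableX.
rewrite /lebesgue_cV_step /pushforward -comp_preimage.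
rewrite (_ : _ \o _ = id) ?preimage_id; last first.
  by apply/funext => p; exact: cV_consK.
by rewrite product_measure1E// lte_mul_pinfty// ge0_fin_numE.
Qed.

HB.instance Definition _ := Measure_isSigmaFinite.Build _ _ _ lebesgue_cV_step
  step_sigma_finite.

End step.

(* Lebesgue measure on R^n (n >= 0), as the n-fold product of the Lebesgue
   measure on R, a column vector of length n.+1 being identified with the pair
   of its first entry and of the remaining ones. *)
Fixpoint lebesgue_cV (n : nat) :
    {sigma_finite_measure set 'cV[R]_n -> \bar R} :=
  match n with
  | 0 => \d_(0%R : 'cV[R]_0)
  | m.+1 => lebesgue_cV_step (lebesgue_cV m)
  end.

Lemma lebesgue_cV_box n (A : 'I_n -> set R) :
  (forall i, measurable (A i)) ->
  lebesgue_cV n [set x | forall i, A i (x i 0%R)] =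
  \prod_(i < n) @lebesgue_measure R (A i).
Proof.
elim: n A => [|n IHn] A mA.
  by rewrite big_ord0 /= diracE mem_set// => -[].
rewrite big_ord_recl -IHn /=; last by move=> i; exact: mA.
have mbox : measurable
    [set x : 'cV[R]_n | forall i, A (lift ord0 i) (x i 0%R)].
  rewrite (_ : mkset _ = \bigcap_(i in [set: 'I_n])
      ((fun x : 'cV[R]_n => x i 0%R) @^-1` A (lift ord0 i))); last first.
    by apply/seteqP; split => [x Ax i _|x Ax i]; exact: Ax.
  apply: fin_bigcap_measurable => // i _.
  rewrite -[X in measurable X]setTI.
  by apply: measurable_mxentry => //; exact: mA.
rewrite -product_measure1E/=.
- rewrite /lebesgue_cV_step /pushforward; congr (_ _).
  apply/seteqP; split => [[a v] /= Av|[a v] /= [Aa Av] i].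
    split; first by have := Av ord0; rewrite mxE unlift_none.
    by move=> i; have := Av (lift ord0 i); rewrite mxE liftK.
  case: (unliftP ord0 i) => [k|] ->.
    by rewrite mxE liftK; exact: Av.
  by rewrite mxE unlift_none.
- exact: mA.
- exact: mbox.
Qed.

End lebesgue_measure_cV.

Section complex_L2.
Variables (R : realType) (n : nat).

Local Notation C := R[i].
Local Notation Rn := 'cV[R]_n.
Local Notation mu := (lebesgue_cV R n).
Implicit Types (f g : Rn -> C) (S V : set (Rn -> C)).

Definition cmeasurable f : Prop :=
  measurable_fun [set: Rn] (fun x => complex.Re (f x)) /\
  measurable_fun [set: Rn] (fun x => complex.Im (f x)).

Definition cLnorm (p : \bar R) f : \bar R :=
  'N[mu]_p[(fun x => (ComplexField.Normc.normc (f x))%:E)]%E.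

(* Elements of L^p are represented by functions, not by a.e.-classes: each class
   has a Borel representative, and membership in a [closed_span] only depends on
   the class. *)
Definition cLp (p : \bar R) : set (Rn -> C) :=
  [set f : Rn -> C | cmeasurable f /\ (cLnorm p f < +oo)%E].

Definition cintegral f : C :=
  (\int[mu]_x complex.Re (f x)) +i* (\int[mu]_x complex.Im (f x)).

Definition L2inner f g : C := cintegral (fun x => f x * (g x)^*).

Definition lin_span S : set (Rn -> C) :=
  [set f : Rn -> C | exists (m : nat) (c : 'I_m -> C) (u : 'I_m -> Rn -> C),
     (forall i, S (u i)) /\ f = (fun x => \sum_(i < m) c i * u i x)].

Definition closed_span S : set (Rn -> C) :=
  [set f : Rn -> C | cLp 2%:E f /\
     forall e : R, 0 < e ->
       exists2 g, lin_span S g & (cLnorm 2%:E (fun x => (f x - g x)%R) < e%:E)%E].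

Definition orthonormal_basis (I : eqType) (e : I -> Rn -> C) : Prop :=
  [/\ forall i, cLp 2%:E (e i),
      forall i j, L2inner (e i) (e j) = (i == j)%:R &
      cLp 2%:E `<=` closed_span (range e)].

Definition dotp (x y : Rn) : R := \sum_(i < n) x i 0 * y i 0.

Definition cis (t : R) : C := cos t +i* sin t.

Definition fourier f (xi : Rn) : C :=
  cintegral (fun x => f x * cis (- (2 * pi * dotp x xi))).

(* [is_fourier_L2 f g]: g represents the Fourier transform of f in L^2, that is
   the extension by continuity of [fourier] from L^1 `&` L^2 to L^2. *)
Definition is_fourier_L2 f g : Prop :=
  [/\ cLp 2%:E f, cLp 2%:E g &
    exists u : nat -> Rn -> C,
      [/\ forall k, (cLp 1%:E `&` cLp 2%:E) (u k),
          cLnorm 2%:E (fun x => u k x - f x) @[k --> \oo] --> 0%E &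
          cLnorm 2%:E (fun xi => fourier (u k) xi - g xi) @[k --> \oo]
            --> 0%E]].

Fixpoint Ck (k : nat) (f : Rn -> R) : Prop :=
  continuous f /\
  match k with
  | 0 => True
  | k'.+1 => forall i : 'I_n,
      (forall x, derivable f x (delta_mx i 0)) /\
      Ck k' (fun x => 'D_(delta_mx i 0) f x)
  end.

Definition csmooth f : Prop :=
  forall k, Ck k (fun x => complex.Re (f x)) /\
            Ck k (fun x => complex.Im (f x)).

Definition compactly_supported f : Prop :=
  compact (closure [set x | f x != 0]).

Definition translation (y : Rn) f : Rn -> C := fun x => f (x - y).

Definition dilation (P : 'M[R]_n) f : Rn -> C :=
  fun x => (Num.sqrt `|\det P|)%:C * f (P *m x).

Definition shift_invariant V : Prop :=
  forall (k : 'cV[int]_n) f, V f -> V (translation (map_mx intr k) f).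

(* An eigenvalue is a complex one, hence the extension of scalars. *)
Definition expansive (A : 'M[R]_n) : Prop :=
  forall l : C, eigenvalue (map_mx (real_complex R) A) l -> 1 < `|l|.

Definition rational_mx (A : 'M[R]_n) : Prop :=
  forall i j, exists q : rat, A i j = ratr q.

End complex_L2.

Section wavelet.
Variables (R : realType) (n L : nat).

Definition wavelet_system (A : 'M[R]_n.+1) (psi : 'I_L -> 'cV[R]_n.+1 -> R[i])
    (t : int * 'cV[int]_n.+1 * 'I_L) : 'cV[R]_n.+1 -> R[i] :=
  let: (j, k, l) := t in
  dilation (A ^ j) (translation (map_mx intr k) (psi l)).

Definition orthonormal_wavelet (A : 'M[R]_n.+1)
    (psi : 'I_L -> 'cV[R]_n.+1 -> R[i]) : Prop :=
  (forall l, cLp 2%:E (psi l)) /\ orthonormal_basis (wavelet_system A psi).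

Definition negative_dilates (A : 'M[R]_n.+1)
    (psi : 'I_L -> 'cV[R]_n.+1 -> R[i]) : set ('cV[R]_n.+1 -> R[i]) :=
  closed_span [set wavelet_system A psi t | t in [set t | t.1.1 < 0]].

End wavelet.

(* Main.v *)
(**
Suppose that A has an irrational entry. By Dirichlet's theorem the group
A Z^n + Z^n contains arbitrarily small vectors v <> 0. Now V_0 is the image under
D_(A^-1) of the closed span of the dilates with j <= 0, which is invariant under
Z^n, and T_(A k) D_(A^-1) = D_(A^-1) T_k; so V_0 is invariant under A Z^n + Z^n,
in particular under T_v and T_(-v). Put theta(xi) = <v, xi>. On the frequency side V_0
is invariant under multiplication by 1 + sin(2 pi theta), and iterating this
multiplication concentrates a function near the top of the set S on which the
Fourier transforms of the elements of V_0 live; S is bounded since the Fourier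
transforms of the wavelets have compact support and A is expansive, so that
|theta| <= 1/4 on S when v is small. Where theta is close to its supremum on S,
every generator of V_0 is small: only finitely many scales reach that region, and
at each of them the Fourier transform of a wavelet is uniformly continuous and
vanishes outside S. By Bessel's
inequality for the exponentials, a function of V_0 concentrated there has
coefficients with sum of squares at most half of its squared norm, against
Parseval's identity in V_0.

Only two facts about the Fourier transform on L^2 are used: it is an isometry up
to a positive constant, and it turns translations into modulations and dilations
into (rescaled) dilations. The values of these constants do not matter.
*)

Require Import Defs.
From HB Require Import structures.
From mathcomp Require Import all_boot all_order all_algebra.
From mathcomp Require Import complex.
From mathcomp Require Import all_classical all_reals all_analysis.
From mathcomp Require Import measurable_realfun ring lra zify.

Set Implicit Arguments.
Unset Strict Implicit.
Unset Printing Implicit Defensive.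

Import Order.TTheory GRing.Theory Num.Theory.
Import numFieldNormedType.Exports.
Import HBSimple HBNNSimple.

Local Open Scope classical_set_scope.
Local Open Scope ring_scope.
Local Open Scope complex_scope.
Local Open Scope ring_scope.

(** * Lebesgue measure: translations and linear maps *)

(** If A is rational, the group A Z^n + Z^n is discrete; irrationality is what supplies short
    non-zero vectors. The bound 1/4 delimits the interval on which 1 + sin(2 pi t) increases, so
    that powers of this weight favour the largest values of theta. The obstacle is that the
    infinitely many scales of V_0 pile up at the origin of the frequency space. The supremum of
    theta on S therefore has to be positive: the region near it then stays away from 0 and meets
    finitely many scales. As S need not be symmetric, this may require replacing v by -v. The
    concentrated function keeps a small remainder far from the supremum; Bessel's inequality for the
    generators themselves, which stay orthogonal after Fourier transform, bounds its contribution,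
    and the exponentials handle the main part. Parseval's identity enters as a statement on best
    approximation by finite sums, so no infinite series of coefficients is formed. *)

Section lebesgue_translation.
Variable R : realType.
Local Open Scope ereal_scope.
Local Notation leb := (@lebesgue_measure R).

Lemma measurable_addl (a : R) :
  measurable_fun [set: measurableTypeR R] (fun x : measurableTypeR R => (a + x)%R : measurableTypeR R).
Proof. by apply: measurable_funD => //; exact: measurable_id. Qed.

Lemma lebesgue_measure_shift (a : R) (A : set (measurableTypeR R)) :
  measurable A -> pushforward leb (fun x => (a + x)%R : measurableTypeR R) A = leb A.
Proof.
move=> mA; apply/esym; apply: lebesgue_measure_unique => //=.
  exact: measurable_addl.
move=> _ _ [[b c] _ <-] /=; rewrite /pushforward.
rewrite (_ : _ @^-1` _ = `]b - a, c - a]%classic)%R; last first.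
  by apply/seteqP; split => x /=; rewrite !in_itv/= => /andP[h1 h2]; apply/andP; split; lra.
rewrite !lebesgue_measure_itv/= !lte_fin ltrBlDr subrK; case: ifP => // _.
by rewrite -!EFinB; congr EFin; lra.
Qed.

Lemma ge0_integral_lebesgue_shift (a : R) (f : measurableTypeR R -> \bar R) :
  measurable_fun setT f -> (forall x, 0 <= f x) ->
  \int[leb]_x f (a + x)%R = \int[leb]_x f x.
Proof.
move=> mf f0.
transitivity (\int[pushforward leb (fun x => (a + x)%R : measurableTypeR R)]_x f x).
  rewrite ge0_integral_pushforward//; exact: measurable_addl.
apply: eq_measure_integral => [|ma A mA _]; first exact: measurable_addl.
exact: lebesgue_measure_shift.
Qed.

End lebesgue_translation.

Section lebesgue_cV_theory.
Variable R : realType.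
Local Open Scope ereal_scope.
Local Notation leb := (@lebesgue_measure R).
Local Notation mu n := (lebesgue_cV R n).

(** The measure in dimension [n.+1] is the image of a product measure under [cV_cons], so this is
    Tonelli's theorem; it opens the inductions on the dimension. *)
Lemma ge0_integral_cVS n (f : 'cV[R]_n.+1 -> \bar R) :
  measurable_fun setT f -> (forall x, 0 <= f x) ->
  \int[mu n.+1]_x f x = \int[leb]_t \int[mu n]_v f (cV_cons (t, v)).
Proof.
move=> mf f0.
have mc := @measurable_cV_cons R n.
transitivity (\int[leb \x mu n]_z f (cV_cons z)).
  have -> := @ge0_integral_pushforward _ _ _ _ _ _ mc (leb \x mu n) setT f measurableT mf (fun x _ => f0 x).
  by [].
have mfc : measurable_fun setT (f \o @cV_cons R n) by exact: measurableT_comp.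
exact: (@fubini_tonelli1 _ _ _ _ _ leb (mu n) _ mfc (fun z => f0 _)).
Qed.

Lemma cV0_all (x : 'cV[R]_0) : x = 0%R.
Proof. by apply/matrixP => -[]. Qed.

Lemma integral_cV0 (f : 'cV[R]_0 -> \bar R) :
  measurable_fun setT f -> \int[mu 0]_x f x = f 0%R.
Proof. by move=> mf; rewrite integral_dirac// diracT mul1e. Qed.

Lemma cV_consD n (x y : measurableTypeR R * 'cV[R]_n) :
  cV_cons (x.1 + y.1, x.2 + y.2)%R = (cV_cons x + cV_cons y)%R.
Proof.
by apply/matrixP => i j; rewrite !mxE/=; case: (unlift ord0 i) => // k; rewrite !mxE.
Qed.

Lemma cV_unconsK n : cancel (@cV_uncons R n) (@cV_cons R n).
Proof.
move=> v; apply/matrixP => i j; rewrite !mxE ord1.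
by case: (unliftP ord0 i) => [k|] ->; rewrite /= ?mxE.
Qed.

Lemma measurable_cV_add n (a : 'cV[R]_n) :
  measurable_fun [set: 'cV[R]_n] (fun x : 'cV[R]_n => a + x)%R.
Proof.
apply: measurable_fun_matrix => i j.
under eq_fun do rewrite mxE.
by apply: measurable_funD => //; exact: measurable_mxentry.
Qed.

Lemma ge0_integral_cV_shift n (a : 'cV[R]_n) (f : 'cV[R]_n -> \bar R) :
  measurable_fun setT f -> (forall x, 0 <= f x) ->
  \int[mu n]_x f (a + x)%R = \int[mu n]_x f x.
Proof.
elim: n => [|n IH] in a f *.
  move=> mf f0; apply: eq_integral => x _.
  by rewrite (cV0_all a) add0r.
move=> mf f0.
have mc := @measurable_cV_cons R n.
rewrite !ge0_integral_cVS//; last first.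
  by apply: measurableT_comp => //; exact: measurable_cV_add.
rewrite -(cV_unconsK a); case: (cV_uncons a) => t0 v0.
transitivity (\int[leb]_t \int[mu n]_v f (cV_cons ((t0 + t)%R, v))).
  apply: eq_integral => t _.
  rewrite -(IH v0 (fun v => f (cV_cons ((t0 + t)%R, v))))//.
    by apply: eq_integral => v _; rewrite -cV_consD.
  apply: measurableT_comp => //; apply: measurableT_comp => //.
apply: (@ge0_integral_lebesgue_shift R t0 (fun t => \int[mu n]_v f (cV_cons (t, v)))).
  have mfc : measurable_fun setT (f \o @cV_cons R n) by exact: measurableT_comp.
  exact: (@measurable_fun_fubini_tonelli_F _ _ _ _ _ (mu n) _ mfc (fun z => f0 _)).
by move=> x; exact: integral_ge0.
Qed.

End lebesgue_cV_theory.

Section linear_change.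
Variable R : realType.
Local Open Scope ereal_scope.
Local Notation mu n := (lebesgue_cV R n).

Lemma measurable_mulmx_cV m n (P : 'M[R]_(m, n)) :
  measurable_fun [set: 'cV[R]_n] (fun x : 'cV[R]_n => P *m x).
Proof.
apply: measurable_fun_matrix => i j.
under eq_fun do rewrite mxE.
apply: measurable_sum => k; apply: measurable_funM => //.
exact: measurable_mxentry.
Qed.

Lemma measurable_cV_binop d (T : measurableType d) n (f g : T -> 'cV[R]_n) :
  measurable_fun setT f -> measurable_fun setT g ->
  measurable_fun setT (fun x => f x + g x)%R.
Proof.
move=> mf mg; apply: measurable_fun_matrix => i j; under eq_fun do rewrite mxE.
by apply: measurable_funD; apply: (measurableT_comp (measurable_mxentry _ _)).
Qed.

Lemma measurable_cV_opp n : measurable_fun [set: 'cV[R]_n] (fun x : 'cV[R]_n => - x)%R.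
Proof.
apply: measurable_fun_matrix => i j; under eq_fun do rewrite mxE.
by apply: measurableT_comp => //; exact: measurable_mxentry.
Qed.

(* Both sides are the integral of f(P x) h(P x + y) over (x, y); with h fixed this
   gives the uniqueness of the Haar measure, and so the behaviour of Lebesgue
   measure under P up to a constant. *)
Lemma haar_identity n (P : 'M[R]_n) (f h : 'cV[R]_n -> \bar R) : P \in unitmx ->
  measurable_fun setT f -> (forall x, 0 <= f x) ->
  measurable_fun setT h -> (forall x, 0 <= h x) ->
  (\int[mu n]_x f (P *m x)) * (\int[mu n]_x h x) =
  (\int[mu n]_x h (P *m x)) * (\int[mu n]_x f (- x)%R).
Proof.
move=> uP mf f0 mh h0.
have mP := measurable_mulmx_cV P.
have mN := @measurable_cV_opp n.
have mfP : measurable_fun setT (fun x => f (P *m x)) by apply: measurableT_comp.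
have mhP : measurable_fun setT (fun x => h (P *m x)) by apply: measurableT_comp.
have mfN : measurable_fun setT (fun x : 'cV[R]_n => f (- x)%R) by apply: measurableT_comp.
rewrite -!ge0_integralZr//; try (by move=> *; apply: integral_ge0 => *; exact: h0);
  last by apply: integral_ge0.
transitivity (\int[mu n]_x \int[mu n]_y (f (P *m x) * h (P *m x + y)%R)).
  apply: eq_integral => x _; rewrite ge0_integralZl//.
  - by rewrite ge0_integral_cV_shift.
  - by apply: measurableT_comp => //; exact: measurable_cV_add.
have m1 : measurable_fun setT
    (fun z : 'cV[R]_n * 'cV[R]_n => f (P *m z.1) * h (P *m z.1 + z.2)%R).
  apply: emeasurable_funM; apply: measurableT_comp => //.
    by apply: measurableT_comp.
  apply: measurable_cV_binop => //.
  by apply: measurableT_comp.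
rewrite (@fubini_tonelli _ _ _ _ _ (mu n) (mu n) _ m1 (fun z => mule_ge0 (f0 _) (h0 _)))/=.
have m2 : measurable_fun setT
    (fun z : 'cV[R]_n * 'cV[R]_n => f (P *m z.1 - z.2)%R * h (P *m z.1)).
  apply: emeasurable_funM; apply: measurableT_comp => //.
  - apply: measurable_cV_binop => //; first by apply: measurableT_comp.
    by apply: measurableT_comp.
  - by apply: measurableT_comp.
transitivity (\int[mu n]_y \int[mu n]_x (f (P *m x - y)%R * h (P *m x))).
  apply: eq_integral => y _.
  (* Translating x by [invmx P *m y] moves y from the argument of [h] to that of [f]. *)
  rewrite -(@ge0_integral_cV_shift R n (invmx P *m y))//.
  - apply: eq_integral => x _.
    by rewrite mulmxDr mulKVmx// addrAC addrN add0r [(y + _)%R]addrC.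
  - apply: emeasurable_funM => //; apply: measurableT_comp => //.
    exact: measurable_cV_binop.
  - by move=> x; rewrite mule_ge0.
rewrite -(@fubini_tonelli _ _ _ _ _ (mu n) (mu n) _ m2 (fun z => mule_ge0 (f0 _) (h0 _)))/=.
apply: eq_integral => x _; rewrite ge0_integralZr//.
- rewrite muleC; congr (_ * _).
  rewrite -(@ge0_integral_cV_shift R n (P *m x) (fun y => f (P *m x - y)%R))//.
    by apply: eq_integral => y _; rewrite opprD addNKr.
  apply: measurableT_comp => //.
  by apply: measurable_cV_binop.
- apply: measurableT_comp => //.
  by apply: measurable_cV_binop.
Qed.

Definition cV_box n (a b : R) : set 'cV[R]_n :=
  [set x | forall i, `]a, b]%classic (x i 0%R)].

Lemma measurable_cV_forall n (A : 'I_n -> set R) : (forall i, measurable (A i)) ->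
  measurable [set x : 'cV[R]_n | forall i, A i (x i 0%R)].
Proof.
move=> mA; rewrite (_ : mkset _ = \bigcap_(i in [set: 'I_n])
      ((fun x : 'cV[R]_n => x i 0%R) @^-1` A i)); last first.
  by apply/seteqP; split => [x Ax i _|x Ax i]; exact: Ax.
apply: fin_bigcap_measurable => // i _.
rewrite -[X in measurable X]setTI.
by apply: measurable_mxentry => //; exact: mA.
Qed.

Lemma measurable_cV_box n a b : measurable (@cV_box n a b).
Proof. apply: (@measurable_cV_forall n (fun=> `]a, b]%classic)) => i; exact: measurable_itv. Qed.

Lemma cV_boxE n (a b : R) : (a <= b)%R -> mu n (@cV_box n a b) = ((b - a) ^+ n)%:E.
Proof.
move=> ab.
rewrite (@lebesgue_cV_box R n (fun=> `]a, b]%classic)); last by move=> i; exact: measurable_itv.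
rewrite (eq_bigr (fun=> (b - a)%:E)); last first.
  move=> i _; rewrite lebesgue_measure_itv/= lte_fin; case: ltP => // ba.
  by congr EFin; apply/eqP; rewrite eq_sym subr_eq0 eq_le ba ab.
by rewrite prodEFin prodr_const card_ord.
Qed.

Lemma cV_box01 n : mu n (@cV_box n 0 1) = 1.
Proof. by rewrite cV_boxE// subr0 expr1n. Qed.

(** The case P = 1 of [haar_identity], with [h] the indicator of the unit box. It removes the
    reflection on the right-hand side of that identity. *)
Lemma ge0_integral_cV_opp n (f : 'cV[R]_n -> \bar R) :
  measurable_fun setT f -> (forall x, 0 <= f x) ->
  \int[mu n]_x f (- x)%R = \int[mu n]_x f x.
Proof.
move=> mf f0.
have mQ := @measurable_cV_box n 0 1.
pose h (x : 'cV[R]_n) : \bar R := (\1_(@cV_box n 0 1) x)%:E.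
have mh : measurable_fun setT h by apply/measurable_EFinP.
have h0 x : 0 <= h x by rewrite lee_fin.
have hI : \int[mu n]_x h x = 1.
  by rewrite integral_indic// setIT; exact: cV_box01.
have e1 g : (fun x : 'cV[R]_n => g (1%:M *m x)) = g :> (_ -> \bar R).
  by apply/funext => x; rewrite mul1mx.
have := haar_identity (unitmx1 _ _) mf f0 mh h0.
by rewrite !e1 hI mule1 mul1e.
Qed.

Lemma cV_bounded_mulmx m n (P : 'M[R]_(m, n)) : exists2 K : R, (0 < K)%R &
  forall (x : 'cV[R]_n) (r : R), (0 <= r)%R -> (forall i, `|x i 0| <= r)%R ->
  forall i, (`|(P *m x) i 0| <= K * r)%R.
Proof.
exists (1 + \sum_i \sum_j `|P i j|)%R.
  by rewrite ltr_pwDl// sumr_ge0// => i _; apply: sumr_ge0.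
move=> x r r0 xr i; rewrite mxE (le_trans (ler_norm_sum _ _ _))//.
apply: (@le_trans _ _ (\sum_j `|P i j| * r)%R).
  by apply: ler_sum => j _; rewrite normrM ler_wpM2l.
rewrite -mulr_suml ler_wpM2r// (bigD1 i)//= addrCA lerDl addr_ge0//.
by apply: sumr_ge0 => k _; apply: sumr_ge0.
Qed.

(** Fixing [h] as the indicator of the unit box in [haar_identity] shows that the constant is the
    measure of the preimage of that box under [P]. It is finite because the preimage is bounded. *)
Lemma cV_linear_change n (P : 'M[R]_n) : P \in unitmx ->
  exists2 c : R, (0 < c)%R & forall f : 'cV[R]_n -> \bar R,
    measurable_fun setT f -> (forall x, 0 <= f x) ->
    \int[mu n]_x f (P *m x) = c%:E * \int[mu n]_x f x.
Proof.
move=> uP; have mQ := @measurable_cV_box n 0 1.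
pose h (x : 'cV[R]_n) : \bar R := (\1_(@cV_box n 0 1) x)%:E.
have mh : measurable_fun setT h by apply/measurable_EFinP.
have h0 x : 0 <= h x by rewrite lee_fin.
have hI : \int[mu n]_x h x = 1.
  by rewrite integral_indic// setIT; exact: cV_box01.
have E f : measurable_fun setT f -> (forall x, 0 <= f x) ->
    \int[mu n]_x f (P *m x) = (\int[mu n]_x h (P *m x)) * \int[mu n]_x f x.
  move=> mf f0; rewrite -[LHS]mule1 -hI haar_identity// ge0_integral_cV_opp//.
have c0 : 0 <= \int[mu n]_x h (P *m x) by exact: integral_ge0.
have cfin : \int[mu n]_x h (P *m x) < +oo.
  have [K K0 KP] := cV_bounded_mulmx (invmx P).
  apply: (@le_lt_trans _ _ (\int[mu n]_x (\1_(@cV_box n (- (2 * K)) (2 * K)) x)%:E)).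
    apply: ge0_le_integral => //.
    - by apply: measurableT_comp => //; exact: measurable_mulmx_cV.
    - by apply/measurable_EFinP; apply: measurable_indic; exact: measurable_cV_box.
    - move=> x _; rewrite lee_fin.
      have [Px|nPx] := pselect (cV_box 0 1 (P *m x)); last first.
        by rewrite [X in (X <= _)%R]indicE memNset.
      rewrite !indicE !mem_set// => i /=.
      have := KP (P *m x) 1%R ler01; rewrite mulKmx// mulr1 => H.
      have /H/(_ i) : (forall i, `|(P *m x) i 0| <= 1)%R.
        by move=> j; have := Px j; rewrite /= in_itv/= ler_norml; lra.
      by rewrite in_itv/= ler_norml; lra.
  rewrite integral_indic ?setIT//; last exact: measurable_cV_box.
  suff : mu n (@cV_box n (- (2 * K)) (2 * K)) < +oo by [].
  by rewrite cV_boxE ?ltry//; lra.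
have cfn : \int[mu n]_x h (P *m x) \is a fin_num by rewrite ge0_fin_numE.
exists (fine (\int[mu n]_x h (P *m x))); last by move=> f mf f0; rewrite fineK// E.
rewrite fine_gt0// lt0e c0 cfin !andbT; apply/eqP => z.
(* Were the constant 0, the integral of 1 over the whole space would vanish. *)
have := E (cst 1) (@measurable_cst _ _ _ _ _ _) (fun=> lee01); rewrite z mul0e => /esym.
rewrite integral_cst// mul1e => /eqP; apply/negP.
rewrite lt_eqF// (@lt_le_trans _ _ (mu n (@cV_box n 0 1)))//.
  by rewrite cV_box01.
by apply: le_measure => //; rewrite inE.
Qed.

End linear_change.

(** * Complex-valued L^2 functions *)

Section complex_parts.
Variable R : realType.
Implicit Types z w : R[i].

Lemma complex_ext z w : complex.Re z = complex.Re w -> complex.Im z = complex.Im w -> z = w.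
Proof. by case: z => a b; case: w => c d /= -> ->. Qed.
Lemma ReD z w : complex.Re (z + w) = complex.Re z + complex.Re w.
Proof. by case: z; case: w. Qed.
Lemma ImD z w : complex.Im (z + w) = complex.Im z + complex.Im w.
Proof. by case: z; case: w. Qed.
Lemma ReN z : complex.Re (- z) = - complex.Re z.
Proof. by case: z. Qed.
Lemma ImN z : complex.Im (- z) = - complex.Im z.
Proof. by case: z. Qed.
Lemma ReM z w : complex.Re (z * w) =
  complex.Re z * complex.Re w - complex.Im z * complex.Im w.
Proof. by case: z; case: w. Qed.
Lemma ImM z w : complex.Im (z * w) =
  complex.Re z * complex.Im w + complex.Im z * complex.Re w.
Proof. by case: z => a b; case: w => c d /=; rewrite mulrC. Qed.
Lemma ReJ z : complex.Re z^* = complex.Re z. Proof. by case: z. Qed.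
Lemma ImJ z : complex.Im z^* = - complex.Im z. Proof. by case: z. Qed.

Lemma conjCM z w : (z * w)^* = z^* * w^*. Proof. exact: rmorphM. Qed.
Lemma conjCr (r : R) : (r%:C)^* = r%:C. Proof. by apply: complex_ext; rewrite ?ReJ ?ImJ /= ?oppr0. Qed.

Definition ReImE := (ReD, ImD, ReN, ImN, ReM, ImM, ReJ, ImJ).

(** Squared modulus with values in [R]: it avoids both square roots and the partial order of
    [R[i]]. *)
Definition sqn z : R := complex.Re z ^+ 2 + complex.Im z ^+ 2.

Lemma sqn_ge0 z : 0 <= sqn z. Proof. by rewrite addr_ge0// sqr_ge0. Qed.
Lemma sqnM z w : sqn (z * w) = sqn z * sqn w.
Proof. by rewrite /sqn !ReImE; ring. Qed.
Lemma sqnJ z : sqn z^* = sqn z.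
Proof. by rewrite /sqn !ReImE sqrrN. Qed.
Lemma sqnN z : sqn (- z) = sqn z.
Proof. by rewrite /sqn !ReImE !sqrrN. Qed.
Lemma sqnr (r : R) : sqn r%:C = r ^+ 2.
Proof. by rewrite /sqn/= expr0n/= addr0. Qed.
Lemma sqn0 : sqn 0 = 0 :> R.
Proof. by rewrite /sqn/= expr0n/= addr0. Qed.
Lemma sqn1 : sqn 1 = 1 :> R.
Proof. by rewrite /sqn/= expr0n/= addr0 expr1n. Qed.
Lemma sqnD_le z w : sqn (z + w) <= 2 * sqn z + 2 * sqn w.
Proof.
rewrite /sqn !ReImE -subr_ge0.
have := sqr_ge0 (complex.Re z - complex.Re w).
have := sqr_ge0 (complex.Im z - complex.Im w).
by nra.
Qed.
Lemma sqn_eq0 z : sqn z = 0 -> z = 0.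
Proof.
move/eqP; rewrite paddr_eq0 ?sqr_ge0// !sqrf_eq0 => /andP[/eqP h1 /eqP h2].
exact: complex_ext.
Qed.
Lemma normc_sqr z : ComplexField.Normc.normc z ^+ 2 = sqn z.
Proof. by case: z => a b; rewrite /= sqr_sqrtr// addr_ge0// sqr_ge0. Qed.
Lemma mulJ_sqn z : z * z^* = (sqn z)%:C.
Proof. by apply: complex_ext; rewrite !ReImE /sqn/=; ring. Qed.

Lemma sqn_cis (t : R) : sqn (cis t) = 1.
Proof. exact: cos2Dsin2. Qed.

End complex_parts.

Section L2_theory.
Variables (R : realType) (n : nat).
Local Notation C := R[i].
Local Notation Rn := 'cV[R]_n.
Local Notation mu := (lebesgue_cV R n).
Implicit Types (f g h : Rn -> C).

Local Notation rint f := (mu.-integrable setT (EFin \o f)).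

Definition N2 f : \bar R := (\int[mu]_x (sqn (f x))%:E)%E.
(** The squared norm as a real number. It takes the default value 0 when [N2 f] is infinite, whence
    the [L2] hypotheses in the estimates. *)
Definition n2 f : R := fine (N2 f).
Definition L2 f := cmeasurable f /\ (N2 f < +oo)%E.
Definition cintegrable f :=
  rint (fun x => complex.Re (f x)) /\ rint (fun x => complex.Im (f x)).

Lemma N2_ge0 f : (0 <= N2 f)%E.
Proof. by apply: integral_ge0 => x _; rewrite lee_fin sqn_ge0. Qed.

Lemma n2_ge0 f : 0 <= n2 f.
Proof. by rewrite fine_ge0// N2_ge0. Qed.

Lemma L2_fin f : L2 f -> (n2 f)%:E = N2 f.
Proof. by move=> [_ fo]; rewrite fineK// ge0_fin_numE// N2_ge0. Qed.

Lemma cLnorm2E f : cLnorm 2%:E f = (N2 f `^ 2^-1)%E.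
Proof.
rewrite /cLnorm unlock; congr (_ `^ _)%E; apply: eq_integral => x _.
by rewrite /= powR_mulrn ?normr_ge0// real_normK ?num_real// normc_sqr.
Qed.

Lemma cLnorm2_lt f (e : R) : 0 <= e -> (cLnorm 2%:E f < e%:E)%E = (N2 f < (e ^+ 2)%:E)%E.
Proof.
move=> e0; rewrite cLnorm2E; have := N2_ge0 f; case: (N2 f) => [r||] //= r0.
  rewrite powR12_sqrt// !lte_fin.
  by rewrite -[in RHS](sqr_sqrtr r0) ltr_pXn2r// nnegrE sqrtr_ge0.
by rewrite invr_eq0 pnatr_eq0.
Qed.

Lemma cLp2E f : cLp 2%:E f <-> L2 f.
Proof.
rewrite /cLp /L2 /=; split=> -[mf h]; split => //; move: h; rewrite cLnorm2E => h.
  by apply: lty_poweRy h; rewrite invr_eq0.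
exact: poweR_lty.
Qed.

Lemma cmeasurableD f g : cmeasurable f -> cmeasurable g -> cmeasurable (fun x => f x + g x).
Proof.
move=> [f1 f2] [g1 g2]; split.
  by under eq_fun do rewrite ReD; exact: measurable_funD.
by under eq_fun do rewrite ImD; exact: measurable_funD.
Qed.

Lemma cmeasurableM f g : cmeasurable f -> cmeasurable g -> cmeasurable (fun x => f x * g x).
Proof.
move=> [f1 f2] [g1 g2]; split.
  by under eq_fun do rewrite ReM; apply: measurable_funB; exact: measurable_funM.
by under eq_fun do rewrite ImM; apply: measurable_funD; exact: measurable_funM.
Qed.

Lemma cmeasurable_cst (z : C) : cmeasurable (fun _ : Rn => z).
Proof. by split; exact: measurable_cst. Qed.

Lemma cmeasurableZ (z : C) f : cmeasurable f -> cmeasurable (fun x => z * f x).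
Proof. by apply: cmeasurableM; exact: cmeasurable_cst. Qed.

Lemma cmeasurableN f : cmeasurable f -> cmeasurable (fun x => - f x).
Proof.
by move=> [f1 f2]; split; under eq_fun do rewrite ?ReN ?ImN; exact: measurableT_comp.
Qed.

Lemma cmeasurableJ f : cmeasurable f -> cmeasurable (fun x => (f x)^*).
Proof.
move=> [f1 f2]; split; first by under eq_fun do rewrite ReJ.
by under eq_fun do rewrite ImJ; exact: measurableT_comp.
Qed.

Lemma measurable_sqn f : cmeasurable f -> measurable_fun setT (fun x => (sqn (f x))%:E).
Proof.
by move=> [f1 f2]; apply/measurable_EFinP; apply: measurable_funD; exact: measurable_funX.
Qed.

Lemma le_N2 f g : cmeasurable f -> cmeasurable g ->
  (forall x, sqn (f x) <= sqn (g x)) -> (N2 f <= N2 g)%E.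
Proof.
move=> mf mg h; apply: ge0_le_integral => //; try exact: measurable_sqn;
  by move=> x _; rewrite lee_fin ?sqn_ge0.
Qed.

Lemma le_L2 f g : cmeasurable f -> L2 g -> (forall x, sqn (f x) <= sqn (g x)) -> L2 f.
Proof. by move=> mf [mg g2] h; split => //; exact: le_lt_trans (le_N2 _ _ h) g2. Qed.

Lemma le_n2 f g : cmeasurable f -> L2 g -> (forall x, sqn (f x) <= sqn (g x)) -> n2 f <= n2 g.
Proof.
move=> mf Lg h; rewrite -lee_fin !L2_fin//; first by apply: le_N2 => //; case: Lg.
exact: le_L2 h.
Qed.

Lemma N2Z (z : C) f : cmeasurable f -> N2 (fun x => z * f x) = ((sqn z)%:E * N2 f)%E.
Proof.
move=> mf; rewrite /N2 -ge0_integralZl//; last by rewrite lee_fin sqn_ge0.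
- by apply: eq_integral => x _; rewrite sqnM.
- exact: measurable_sqn.
- by move=> x _; rewrite lee_fin sqn_ge0.
Qed.

Lemma L2Z (z : C) f : L2 f -> L2 (fun x => z * f x).
Proof.
move=> Lf; split; first by apply: cmeasurableZ; case: Lf.
by rewrite N2Z -?L2_fin ?ltry//; case: Lf.
Qed.

Lemma n2Z (z : C) f : L2 f -> n2 (fun x => z * f x) = sqn z * n2 f.
Proof. by move=> Lf; rewrite {1}/n2 N2Z -?L2_fin//; case: Lf. Qed.

(** Integrates [sqnD_le]. This weak triangle inequality stands in for Minkowski's; its factors 2
    explain the choices of [e / 4] in the approximation arguments. *)
Lemma N2D_le f g : cmeasurable f -> cmeasurable g ->
  (N2 (fun x => (f x + g x)%R) <= 2%:E * N2 f + 2%:E * N2 g)%E.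
Proof.
move=> mf mg.
have h0 f' x : (0 <= (2 * sqn (f' x))%:E :> \bar R)%E by rewrite lee_fin mulr_ge0// sqn_ge0.
rewrite -!ge0_integralZl//; try exact: measurable_sqn;
  try (by move=> *; rewrite lee_fin sqn_ge0).
rewrite -ge0_integralD//; try (by move=> *; exact: h0);
  try (by apply: measurable_funeM; exact: measurable_sqn).
apply: ge0_le_integral => //.
- by move=> x _; rewrite lee_fin sqn_ge0.
- by apply: measurable_sqn; exact: cmeasurableD.
- by apply: emeasurable_funD; apply: measurable_funeM; exact: measurable_sqn.
- by move=> x _; rewrite -!EFinM -EFinD lee_fin sqnD_le.
Qed.

Lemma L2D f g : L2 f -> L2 g -> L2 (fun x => f x + g x).
Proof.
move=> Lf Lg; have [mf _] := Lf; have [mg _] := Lg.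
split; first exact: cmeasurableD.
apply: le_lt_trans (N2D_le mf mg) _.
by rewrite -!L2_fin// -!EFinM -EFinD ltry.
Qed.

Lemma n2D_le f g : L2 f -> L2 g -> n2 (fun x => f x + g x) <= 2 * n2 f + 2 * n2 g.
Proof.
move=> Lf Lg; have [mf _] := Lf; have [mg _] := Lg.
have := N2D_le mf mg.
by rewrite -!L2_fin// ?lee_fin//; exact: L2D.
Qed.

Lemma L2N f : L2 f -> L2 (fun x => - f x).
Proof. by move=> Lf; apply: (le_L2 _ Lf) => [|x]; [apply: cmeasurableN; case: Lf|rewrite sqnN]. Qed.

Lemma L2B f g : L2 f -> L2 g -> L2 (fun x => f x - g x).
Proof. by move=> Lf /L2N; exact: L2D. Qed.

Lemma n2N f : n2 (fun x => - f x) = n2 f.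
Proof. by rewrite /n2 /N2; under eq_integral do rewrite sqnN. Qed.

Lemma n2B_le f g : L2 f -> L2 g -> n2 (fun x => f x - g x) <= 2 * n2 f + 2 * n2 g.
Proof. by move=> Lf Lg; rewrite -(n2N g); apply: n2D_le => //; exact: L2N. Qed.

Lemma L2_0 : L2 (fun=> 0).
Proof.
split; first exact: cmeasurable_cst.
by rewrite /N2; under eq_integral do rewrite sqn0; rewrite integral0.
Qed.

Lemma n2_0 : n2 (fun=> 0 : C) = 0.
Proof. by rewrite /n2 /N2; under eq_integral do rewrite sqn0; rewrite integral0. Qed.

Lemma L2_sum (I : Type) (s : seq I) (F : I -> Rn -> C) :
  (forall i, L2 (F i)) -> L2 (fun x => \sum_(i <- s) F i x).
Proof.
move=> LF; elim: s => [|i s IH].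
  by under eq_fun do rewrite big_nil; exact: L2_0.
by under eq_fun do rewrite big_cons; exact: L2D.
Qed.

End L2_theory.

(** * Inner products, the Cauchy-Schwarz and Bessel inequalities *)

Section inner.
Variables (R : realType) (n : nat).
Local Notation C := R[i].
Local Notation Rn := 'cV[R]_n.
Local Notation mu := (lebesgue_cV R n).
Implicit Types (f g h : Rn -> C).
Local Notation rint f := (mu.-integrable setT (EFin \o f)).

Lemma rint_dom (u v : Rn -> R) : measurable_fun setT u ->
  (forall x, `|u x| <= v x) -> rint v -> rint u.
Proof.
move=> mu_ uv iv; apply: le_integrable iv => //; first exact/measurable_EFinP.
by move=> x _ /=; rewrite lee_fin (le_trans (uv x))// ler_norm.
Qed.

Lemma rint_sqn f : L2 f -> rint (fun x => sqn (f x)).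
Proof.
move=> [mf fo]; apply/integrableP; split; first exact: measurable_sqn.
rewrite (le_lt_trans _ fo)//; apply: ge0_le_integral => //.
- by apply: measurableT_comp => //; exact: measurable_sqn.
- exact: measurable_sqn.
- by move=> x _; rewrite /= ger0_norm// sqn_ge0.
Qed.

Lemma n2E f : n2 f = \int[mu]_x sqn (f x).
Proof. by []. Qed.

Lemma rintD (u v : Rn -> R) : rint u -> rint v -> rint (fun x => u x + v x).
Proof.
move=> iu iv; rewrite (_ : EFin \o _ = ((EFin \o u) \+ (EFin \o v))%E); last first.
  by apply/funext.
exact: integrableD.
Qed.

Lemma rintZ (r : R) (u : Rn -> R) : rint u -> rint (fun x => r * u x).
Proof. by move=> iu; exact: (integrableZl measurableT r iu). Qed.

Lemma rintB (u v : Rn -> R) : rint u -> rint v -> rint (fun x => u x - v x).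
Proof.
move=> iu /(rintZ (-1)) iv; under eq_fun do rewrite -mulN1r.
exact: rintD.
Qed.

(** Both parts of the product are dominated by [sqn (f x) + sqn (g x)]. *)
Lemma cintegrableM f g : L2 f -> L2 g -> cintegrable (fun x => f x * (g x)^*).
Proof.
move=> Lf Lg; have [mf _] := Lf; have [mg _] := Lg.
have [m1 m2] := cmeasurableM mf (cmeasurableJ mg).
have i12 := rintD (rint_sqn Lf) (rint_sqn Lg).
have K (a b c d : R) : `|a * c + b * d| <= a ^+ 2 + b ^+ 2 + (c ^+ 2 + d ^+ 2).
  have h1 := sqr_ge0 (a + c); have h2 := sqr_ge0 (a - c).
  have h3 := sqr_ge0 (b + d); have h4 := sqr_ge0 (b - d).
  have h5 := sqr_ge0 a; have h6 := sqr_ge0 b; have h7 := sqr_ge0 c; have h8 := sqr_ge0 d.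
  by rewrite ler_norml; apply/andP; split; lra.
split; apply: rint_dom i12 => // x; rewrite !ReImE.
  by rewrite mulrN opprK; exact: K.
have := K (- complex.Re (f x)) (complex.Im (f x)) (complex.Im (g x)) (complex.Re (g x)).
by rewrite mulNr mulrN sqrrN [X in _ + _ + X]addrC.
Qed.

Lemma cintegralD f g : cintegrable f -> cintegrable g ->
  cintegral (fun x => f x + g x) = cintegral f + cintegral g.
Proof.
move=> [f1 f2] [g1 g2]; apply: complex_ext; rewrite ?ReImE /=.
  by under eq_Rintegral do rewrite ReD; rewrite RintegralD.
by under eq_Rintegral do rewrite ImD; rewrite RintegralD.
Qed.

Lemma cintegralZ (z : C) f : cintegrable f -> cintegral (fun x => z * f x) = z * cintegral f.
Proof.
move=> [f1 f2]; apply: complex_ext; rewrite ?ReImE /=.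
  under eq_Rintegral do rewrite ReM.
  by rewrite RintegralB ?RintegralZl//; exact: rintZ.
under eq_Rintegral do rewrite ImM.
by rewrite RintegralD ?RintegralZl//; exact: rintZ.
Qed.

Lemma cintegralJ f : cintegrable f -> cintegral (fun x => (f x)^*) = (cintegral f)^*.
Proof.
move=> [f1 f2]; apply: complex_ext; rewrite ?ReImE /=.
  by under eq_Rintegral do rewrite ReJ.
under eq_Rintegral do rewrite ImJ -mulN1r.
by rewrite RintegralZl// mulN1r.
Qed.

Lemma L2innerDl f g h : L2 f -> L2 g -> L2 h ->
  L2inner (fun x => f x + g x) h = L2inner f h + L2inner g h.
Proof.
move=> Lf Lg Lh; rewrite -cintegralD; try exact: cintegrableM.
by congr cintegral; apply/funext => x; rewrite mulrDl.
Qed.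

Lemma L2innerZl (z : C) f h : L2 f -> L2 h ->
  L2inner (fun x => z * f x) h = z * L2inner f h.
Proof.
move=> Lf Lh; rewrite -cintegralZ; last exact: cintegrableM.
by congr cintegral; apply/funext => x; rewrite mulrA.
Qed.

Lemma L2innerC f h : L2 f -> L2 h -> L2inner h f = (L2inner f h)^*.
Proof.
move=> Lf Lh; rewrite -cintegralJ; last exact: cintegrableM.
by congr cintegral; apply/funext => x; rewrite rmorphM/= conjCK mulrC.
Qed.

Lemma L2innerDr f g h : L2 f -> L2 g -> L2 h ->
  L2inner h (fun x => f x + g x) = L2inner h f + L2inner h g.
Proof.
move=> Lf Lg Lh; rewrite L2innerC//; last exact: L2D.
by rewrite L2innerDl// rmorphD (L2innerC Lf Lh) (L2innerC Lg Lh).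
Qed.

Lemma L2innerZr (z : C) f h : L2 f -> L2 h ->
  L2inner h (fun x => z * f x) = z^* * L2inner h f.
Proof.
move=> Lf Lh; rewrite L2innerC//; last exact: L2Z.
by rewrite L2innerZl// rmorphM (L2innerC Lf Lh).
Qed.

Lemma L2inner_self f : L2 f -> L2inner f f = (n2 f)%:C.
Proof.
move=> Lf; apply: complex_ext => /=.
  by rewrite n2E; apply: eq_Rintegral => x _; rewrite mulJ_sqn.
rewrite (_ : (fun x => _) = cst 0) ?Rintegral_cst ?mul0r//.
by apply/funext => x; rewrite mulJ_sqn.
Qed.

Lemma n2D f g : L2 f -> L2 g ->
  n2 (fun x => f x + g x) = n2 f + n2 g + 2 * complex.Re (L2inner f g).
Proof.
move=> Lf Lg; have LD := L2D Lf Lg.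
have := L2inner_self LD; rewrite L2innerDl// !L2innerDr// !L2inner_self// (L2innerC Lf Lg).
move/(congr1 (@complex.Re R)); rewrite !ReImE/= => <-; ring.
Qed.

(** Polarization. With [Im_L2inner] it turns an identity between norms into one between inner
    products. *)
Lemma Re_L2inner f g : L2 f -> L2 g ->
  complex.Re (L2inner f g) = (n2 (fun x => f x + g x) - n2 f - n2 g) / 2.
Proof. by move=> Lf Lg; rewrite n2D//; field. Qed.

Lemma Im_L2inner f g : L2 f -> L2 g ->
  complex.Im (L2inner f g) = complex.Re (L2inner f (fun x => 'i%C * g x)).
Proof. by move=> Lf Lg; rewrite L2innerZr// !ReImE/=; ring. Qed.

Lemma n2_subZ (a : C) f g : L2 f -> L2 g ->
  n2 (fun x => f x - a * g x) =
  n2 f - 2 * complex.Re (a^* * L2inner f g) + sqn a * n2 g.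
Proof.
move=> Lf Lg; under [in LHS]eq_fun do rewrite -mulNr.
rewrite n2D//; last exact: L2Z.
by rewrite L2innerZr// n2Z// sqnN rmorphN/= mulNr ReN; ring.
Qed.

Lemma cauchy_schwarz f g : L2 f -> L2 g -> sqn (L2inner f g) <= n2 f * n2 g.
Proof.
move=> Lf Lg; set S := sqn _.
have S0 : 0 <= S by exact: sqn_ge0.
have f0 := n2_ge0 f; have g0 := n2_ge0 g.
(* The squared norm of f - t <f, g> g, with t real. *)
have K (t : R) : 0 <= n2 f - 2 * (t * S) + t ^+ 2 * S * n2 g.
  have := n2_ge0 (fun x => f x - (t%:C * L2inner f g) * g x).
  rewrite n2_subZ// sqnM sqnr conjCM conjCr -mulrA [_^* * _]mulrC mulJ_sqn.
  by rewrite ReM /= mul0r subr0.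
have [g00|gn0] := eqVneq (n2 g) 0; last first.
  have gp : 0 < n2 g by rewrite lt_neqAle eq_sym gn0.
  have := K (n2 g)^-1.
  rewrite (_ : _ + _ = n2 f - S / n2 g); last by field.
  by rewrite subr_ge0 ler_pdivrMr.
(* When [n2 g] is 0 the bound [K] is affine in t, and t = (n2 f + 1) / S violates it unless S =
   0. *)
rewrite g00 mulr0; have [->//|Sn0] := eqVneq S 0.
have Sp : 0 < S by rewrite lt_neqAle eq_sym Sn0.
have := K ((n2 f + 1) / S); rewrite g00 mulr0 addr0 divfK//; lra.
Qed.

Section bessel.
Variables (I : eqType) (e : I -> Rn -> C) (c : R).
Hypotheses (c0 : 0 < c) (Le : forall i, L2 (e i)).
Hypothesis oe : forall i j, L2inner (e i) (e j) = (c * (i == j)%:R)%:C.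

(** The common squared norm [c] is arbitrary so that the same expansion serves the wavelets (c = 1),
    their Fourier transforms and the exponentials on a cube. The induction removes one vector at a
    time: subtracting a multiple of [e i] leaves the inner products with the other vectors
    unchanged. *)
Lemma n2_sub_sum (s : seq I) (a : I -> C) f : uniq s -> L2 f ->
  n2 (fun x => f x - \sum_(i <- s) a i * e i x) =
  n2 f - \sum_(i <- s) (2 * complex.Re ((a i)^* * L2inner f (e i)) - c * sqn (a i)).
Proof.
elim: s f => [|i s IH] f /=.
  move=> _ _; rewrite big_nil subr0; congr n2.
  by apply/funext => x; rewrite big_nil subr0.
move=> /andP[nis us] Lf.
under [in LHS]eq_fun do rewrite big_cons opprD addrA.
have Lfi : L2 (fun x => f x - a i * e i x) by apply: L2B => //; exact: L2Z.
rewrite IH// n2_subZ// big_cons (_ : n2 (e i) = c); last first.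
  by have := L2inner_self (Le i); rewrite oe eqxx mulr1 => -[].
rewrite (_ : \sum_(j <- s) _ = \sum_(j <- s) (2 * complex.Re ((a j)^* * L2inner f (e j)) - c * sqn (a j))).
  by ring.
apply: eq_big_seq => j js; congr (2 * complex.Re (_ * _) - _).
under [X in L2inner X]eq_fun do rewrite -mulNr.
rewrite L2innerDl//; last exact: L2Z.
rewrite L2innerZl// oe (_ : i == j = false) ?mulr0 ?addr0//.
by apply/negbTE; apply: contra nis => /eqP ->.
Qed.

(** The expansion [n2_sub_sum] at the optimal coefficients <f, e i> / c has a non-negative value. *)
Lemma bessel (s : seq I) f : uniq s -> L2 f ->
  \sum_(i <- s) sqn (L2inner f (e i)) <= c * n2 f.
Proof.
move=> us Lf; have := n2_ge0 (fun x => f x - \sum_(i <- s) ((c^-1)%:C * L2inner f (e i)) * e i x).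
rewrite (n2_sub_sum _ us)// subr_ge0.
rewrite (eq_bigr (fun i => c^-1 * sqn (L2inner f (e i)))); last first.
  move=> i _; rewrite sqnM sqnr conjCM conjCr -mulrA [_^* * _]mulrC mulJ_sqn.
  rewrite ReM /= mul0r subr0; field; exact: lt0r_neq0.
by rewrite -mulr_sumr ler_pdivrMl.
Qed.

(** Completing the square: each index contributes an excess of |<f, e i> - c a_i|^2 / c. *)
Lemma best_approx (s : seq I) (a : I -> C) f : uniq s -> L2 f ->
  n2 f - c^-1 * \sum_(i <- s) sqn (L2inner f (e i)) <=
  n2 (fun x => f x - \sum_(i <- s) a i * e i x).
Proof.
move=> us Lf; rewrite (n2_sub_sum _ us)// lerD2l lerN2 mulr_sumr ler_sum// => i _.
have cn0 : c != 0 by exact: lt0r_neq0.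
rewrite -subr_ge0 (_ : _ - _ = c^-1 * sqn (L2inner f (e i) - c%:C * a i)).
  by rewrite mulr_ge0 ?sqn_ge0// invr_ge0 ltW.
by rewrite /sqn !ReImE/=; field.
Qed.

End bessel.

End inner.

(** * Continuity of translations in L^2 *)

Section generators.
Variables (R : realType) (n : nat).
Local Notation Rn := 'cV[R]_n.

Definition ocbox (A : 'I_n -> set R) : set Rn := [set x | forall i, A i (x i 0)].
Definition ocboxes : set (set Rn) :=
  [set E | exists2 A, (forall i, ocitv (A i)) & E = ocbox A].

Lemma ocitv_measurable (A : set R) : ocitv A -> measurable (A : set (measurableTypeR R)).
Proof. by move=> [[a b] _ <-]; exact: measurable_itv. Qed.

Lemma ocbox_measurable A : (forall i, ocitv (A i)) -> measurable (ocbox A).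
Proof. by move=> oA; apply: (@measurable_cV_forall _ _ A) => i; exact: ocitv_measurable. Qed.

Lemma ocboxI A B : ocbox A `&` ocbox B = ocbox (fun i => A i `&` B i).
Proof. by apply/seteqP; split => x /= => [[a b] i|ab]; [split|split=> i; have [] := ab i]. Qed.

Lemma ocboxes_setI : setI_closed ocboxes.
Proof.
move=> _ _ [A oA ->] [B oB ->]; exists (fun i => A i `&` B i); last exact: ocboxI.
by move=> i; exact: ocitvI.
Qed.

(** Boxes are bounded, so a condition on one coordinate is recovered as a countable union of boxes
    whose other sides are []-k, k]]. *)
Lemma ocboxes_measurable : @measurable _ Rn = <<s ocboxes >>.
Proof.
apply/seteqP; split; last first.
  apply: smallest_sub; first exact: sigma_algebra_measurable.
  by move=> _ [A oA ->]; exact: ocbox_measurable.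
apply: smallest_sub; first exact: smallest_sigma_algebra.
move=> _ [[i j] _ [B mB <-]] /=; rewrite setTI (ord1 j) {j}.
have : ([set B | <<s ocboxes >> ((fun M : Rn => M i 0) @^-1` B)]) B; last by [].
move: B mB; apply: smallest_sub.
  split => [|B|F] /=.
  - by rewrite preimage_set0; exact: sigma_algebra0.
  - by rewrite setTD preimage_setC => ?; exact: sigma_algebraC.
  - by rewrite preimage_bigcup => ?; exact: sigma_algebra_bigcup.
move=> B oB /=.
rewrite (_ : _ @^-1` _ = \bigcup_k ocbox (fun j => if j == i then B else `]- k%:R, k%:R]%classic)).
  apply: sigma_algebra_bigcup => k; apply: sub_sigma_algebra.
  exists (fun j => if j == i then B else `]- k%:R, k%:R]%classic) => // j.
  by case: ifP => // _; exists (- k%:R, k%:R).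
apply/seteqP; split => [x /= Bx|x [k _ H]]; last by have := H i; rewrite eqxx.
have [k kP] : exists k : nat, forall j, `|x j 0| < k%:R.
  exists (Num.truncn (\sum_j `|x j 0|)).+1 => j.
  apply: le_lt_trans (truncnS_gt _).
  by rewrite (bigD1 j)//= lerDl sumr_ge0.
exists k => // j /=; case: ifPn => [/eqP ->//|_].
by have := kP j; rewrite ltr_norml => /andP[h1 h2]; rewrite /= in_itv/= h1 ltW.
Qed.

End generators.

Section translation_continuity.
Variables (R : realType) (n : nat).
Local Notation C := R[i].
Local Notation Rn := 'cV[R]_n.
Local Notation mu := (lebesgue_cV R n).
Local Notation rint f := (mu.-integrable setT (EFin \o f)).
Implicit Types (f g h : Rn -> C).

Lemma cmeasurable_comp f (s : Rn -> Rn) : measurable_fun setT s -> cmeasurable f ->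
  cmeasurable (fun x => f (s x)).
Proof.
by move=> ms [f1 f2]; split; [exact: (measurableT_comp f1 ms)|exact: (measurableT_comp f2 ms)].
Qed.

Lemma cmeasurable_shift f y : cmeasurable f -> cmeasurable (fun x => f (y + x)).
Proof. by apply: cmeasurable_comp; exact: measurable_cV_add. Qed.

Lemma N2_shift f y : cmeasurable f -> N2 (fun x => f (y + x)) = N2 f.
Proof.
move=> mf; apply: (@ge0_integral_cV_shift R n y (fun x => (sqn (f x))%:E)).
  exact: measurable_sqn.
by move=> x; rewrite lee_fin sqn_ge0.
Qed.

Lemma n2_shift f y : cmeasurable f -> n2 (fun x => f (y + x)) = n2 f.
Proof. by move=> mf; rewrite /n2 N2_shift. Qed.

Lemma L2_shift f y : L2 f -> L2 (fun x => f (y + x)).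
Proof. by move=> [mf fo]; split; [exact: cmeasurable_shift|rewrite N2_shift]. Qed.

Definition L2_translation_continuous f := L2 f /\
  forall e : R, 0 < e -> exists2 d : R, 0 < d &
    forall y : Rn, (forall i, `|y i 0| <= d) -> n2 (fun x => f (y + x) - f x) < e.
Local Notation TC := L2_translation_continuous.

Lemma translation_continuousD f g : TC f -> TC g -> TC (fun x => f x + g x).
Proof.
move=> [Lf hf] [Lg hg]; split; first exact: L2D.
move=> e e0; have e4 : 0 < e / 4 by lra.
have [d1 d10 h1] := hf _ e4; have [d2 d20 h2] := hg _ e4.
exists (Num.min d1 d2); first by rewrite lt_min d10.
move=> y yd.
under eq_fun do rewrite opprD addrACA.
apply: le_lt_trans (n2D_le _ _) _; try (by apply: L2B => //; exact: L2_shift).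
have k1 : n2 (fun x => f (y + x) - f x) < e / 4.
  by apply: h1 => i; have := yd i; rewrite le_min => /andP[].
have k2 : n2 (fun x => g (y + x) - g x) < e / 4.
  by apply: h2 => i; have := yd i; rewrite le_min => /andP[].
lra.
Qed.

Lemma translation_continuousZ (z : C) f : TC f -> TC (fun x => z * f x).
Proof.
move=> [Lf hf]; split; first exact: L2Z.
move=> e e0; have s0 := sqn_ge0 z.
have [d d0 h] := hf (e / (sqn z + 1)) (divr_gt0 e0 (ltr_wpDl s0 ltr01)).
exists d => // y yd; under eq_fun do rewrite -mulrBr.
rewrite n2Z; last by apply: L2B => //; exact: L2_shift.
have := h y yd; rewrite ltr_pdivlMr ?(ltr_wpDl s0 ltr01)// => k.
apply: le_lt_trans k; rewrite mulrC ler_wpM2l ?n2_ge0//; lra.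
Qed.

Lemma translation_continuousB f g : TC f -> TC g -> TC (fun x => f x - g x).
Proof.
move=> tf /(translation_continuousZ (-1)) tg; under eq_fun do rewrite -mulN1r.
exact: translation_continuousD.
Qed.

(** Translations are isometries, so an approximation of f is equally good after translation. *)
Lemma translation_continuous_approx f : L2 f ->
  (forall e : R, 0 < e -> exists2 g, TC g & n2 (fun x => f x - g x) < e) -> TC f.
Proof.
(* The three differences of the decomposition below receive the weights 4, 4 and 2, of sum 10 <
   12. *)
move=> Lf H; split => // e e0; have e8 : 0 < e / 12 by lra.
have [g [Lg hg] fg] := H _ e8.
have [d d0 h] := hg _ e8; exists d => // y yd.
have Lfg := L2B Lf Lg.
have Lgy := L2B (L2_shift y Lg) Lg.
rewrite (_ : (fun x => _) = fun x => ((f (y + x) - g (y + x)) + (g (y + x) - g x)) - (f x - g x)); last first.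
  by apply/funext => x; rewrite addrA subrK opprB addrA subrK.
apply: le_lt_trans (n2B_le _ _) _ => //.
  by apply: L2D => //; exact: (L2_shift y Lfg).
have := n2D_le (L2_shift y Lfg) Lgy.
have := h y yd.
have := n2_shift y (proj1 Lfg).
by move=> -> /= h1 h2; lra.
Qed.

Lemma translation_continuous_lim (fk : nat -> Rn -> C) f (v : Rn -> R) : cmeasurable f ->
  (forall k, TC (fk k)) -> rint v ->
  (forall k x, sqn (f x - fk k x) <= v x) ->
  (forall x, sqn (f x - fk k x) @[k --> \oo] --> (0 : R)) -> TC f.
Proof.
move=> mf tk iv fkv fkf.
have mk k : cmeasurable (fun x => f x - fk k x).
  by apply: cmeasurableD => //; apply: cmeasurableN; have [[]] := tk k.
have Lk k : L2 (fun x => f x - fk k x).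
  split=> //; case/integrableP : iv => mv vo; apply: le_lt_trans vo.
  apply: ge0_le_integral => //.
  - by move=> x _; rewrite lee_fin sqn_ge0.
  - exact: measurable_sqn.
  - exact: measurableT_comp.
  - by move=> x _; rewrite lee_fin (le_trans (fkv k x))// ler_norm.
have Lf : L2 f.
  have := L2D (Lk 0%N) (proj1 (tk 0%N)).
  by under [X in L2 X]eq_fun do rewrite subrK.
apply: translation_continuous_approx => // e e0.
have cv : (N2 (fun x => (f x - fk k x)%R) @[k --> \oo] --> 0)%E.
  have -> : 0%E = (\int[mu]_x (0 : R)%:E)%E by rewrite integral0.
  apply: (@dominated_cvg _ _ _ _ _ _ (fun k x => (sqn (f x - fk k x)%R)%:E) (cst 0)%E (EFin \o v)) => //.
  - by move=> k; exact: measurable_sqn.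
  - by move=> x _; apply: cvg_EFin; [near=> k => //|exact: fkf].
  - by move=> k x _; rewrite /= lee_fin ger0_norm ?sqn_ge0.
have /fine_cvgP[_ cv'] : (N2 (fun x => (f x - fk k x)%R) @[k --> \oo] --> (0:R)%:E)%E by [].
have /cvgrPdist_lt/(_ _ e0)[k _ kP] := cv'.
exists (fk k) => //.
by have := kP k (leqnn k); rewrite /= sub0r normrN ger0_norm ?n2_ge0.
Unshelve. all: end_near. Qed.

End translation_continuity.

Section translation_continuity.
Variables (R : realType) (n : nat).
Local Notation C := R[i].
Local Notation Rn := 'cV[R]_n.
Local Notation mu := (lebesgue_cV R n).
Implicit Types (f g h : Rn -> C).
Local Notation TC := (@L2_translation_continuous R n).

Definition cindic (E : set Rn) (x : Rn) : C := (\1_E x : R)%:C.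

Lemma cindicE E x : cindic E x = if x \in E then 1 else 0.
Proof. by rewrite /cindic indicE; case: (x \in E). Qed.

Lemma sqn_cindic E x : sqn (cindic E x) = \1_E x.
Proof. by rewrite sqnr indicE; case: (x \in E); rewrite ?expr1n ?expr0n. Qed.

Lemma cmeasurable_cindic E : measurable E -> cmeasurable (cindic E).
Proof.
by move=> mE; split; [exact: measurable_indic|exact: measurable_cst].
Qed.

Lemma N2_cindic E : measurable E -> N2 (cindic E) = mu E.
Proof.
move=> mE; rewrite /N2; under eq_integral do rewrite sqn_cindic.
by rewrite integral_indic// setIT.
Qed.

Lemma L2_cindic E : measurable E -> (mu E < +oo)%E -> L2 (cindic E).
Proof. by move=> mE Eoo; split; [exact: cmeasurable_cindic|rewrite N2_cindic]. Qed.

Lemma lebesgue_box (a b : 'I_n -> R) :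
  mu (ocbox (fun i => `]a i, b i]%classic)) = (\prod_i Num.max 0 (b i - a i))%:E.
Proof.
rewrite (lebesgue_cV_box (A := fun i => `]a i, b i]%classic)).
  rewrite -prodEFin; apply: eq_bigr => i _.
  rewrite lebesgue_measure_itv/= lte_fin; case: ltP => ab.
    by rewrite -EFinB; congr EFin; rewrite max_r// subr_ge0 ltW.
  by rewrite max_l// subr_le0.
by move=> i; exact: measurable_itv.
Qed.

Lemma cvg_prodr (I : Type) (s : seq I) (F : I -> R -> R) (x : R) :
  (forall i, F i t @[t --> x] --> F i x) ->
  \prod_(i <- s) F i t @[t --> x] --> \prod_(i <- s) F i x.
Proof.
move=> cF; elim: s => [|i s IH].
  by under eq_fun do rewrite big_nil; rewrite big_nil; exact: cvg_cst.
under eq_fun do rewrite big_cons; rewrite big_cons.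
exact: cvgM.
Qed.

(** Shrinking the box by t on every side gives a box contained both in it and in its translates by
    vectors of sup norm at most t. Both indicators differ from that of the smaller box by the same
    small volume. *)
Lemma translation_continuous_box A : (forall i, ocitv (A i)) -> TC (cindic (ocbox A)).
Proof.
move=> /= oA.
have /choice[ab abP] : forall i, exists p : R * R, A i = `]p.1, p.2]%classic.
  by move=> i; have [p _ <-] := oA i; exists p.
have [a [b ->]] : exists a b : 'I_n -> R, A = (fun i => `]a i, b i]%classic).
  by exists (fun i => (ab i).1), (fun i => (ab i).2); apply/funext.
have om (a' b' : 'I_n -> R) : measurable (ocbox (fun i => `]a' i, b' i]%classic)).
  by apply: ocbox_measurable => i; exists (a' i, b' i).
set E := ocbox _.
have mE : measurable E by exact: om.
have LE : L2 (cindic E) by apply: L2_cindic => //; rewrite lebesgue_box ltry.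
split => // e e0.
(* Volume of the shrunken box; the maximum with 0 accounts for empty sides. *)
pose p (t : R) := \prod_(i < n) Num.max 0 (b i - a i - 2 * t).
have pc : p t @[t --> 0] --> p 0.
  apply: cvg_prodr => i.
  have cc : continuous (fun t : R => Num.max 0 (b i - a i - 2 * t)).
    move=> t; apply: (@continuous_max R R (cst 0) (fun t => b i - a i - 2 * t)).
      exact: cvg_cst.
    by apply: cvgB; [exact: cvg_cst|apply: cvgM; [exact: cvg_cst|exact: cvg_id]].
  exact: cc.
have e4 : 0 < e / 4 by lra.
have /cvgrPdist_lt/(_ _ e4)/nbhs_ballP[d /= d0 dP] := pc.
pose t := d / 2.
have t0 : 0 < t by rewrite /t; lra.
have pt : p 0 - p t < e / 4.
  have /dP : ball 0 d t by rewrite /ball/= sub0r normrN gtr0_norm// /t; lra.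
  by apply: le_lt_trans; exact: ler_norm.
exists t => // y yt.
pose F := ocbox (fun i => `]a i + t, b i - t]%classic).
have mF : measurable F by exact: om.
have muF : mu F = (p t)%:E.
  rewrite lebesgue_box; congr EFin; apply: eq_bigr => i _; congr Num.max; ring.
have muE : mu E = (p 0)%:E.
  by rewrite lebesgue_box; congr EFin; apply: eq_bigr => i _; rewrite mulr0 subr0.
have LF : L2 (cindic F) by apply: L2_cindic; rewrite // muF ltry.
have FE x : F x -> E x.
  move=> Fx i; have := Fx i; rewrite /= !in_itv/= => /andP[h1 h2].
  by apply/andP; split; lra.
have FEy x : F x -> E (y + x).
  move=> Fx i; have := Fx i; rewrite /= !in_itv/= !mxE => /andP[h1 h2].
  by have := yt i; rewrite ler_norml => /andP[h3 h4]; apply/andP; split; lra.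
have n2E' : n2 (cindic E) = p 0 by rewrite /n2 N2_cindic// muE.
have n2F : n2 (cindic F) = p t by rewrite /n2 N2_cindic// muF.
have n2d (G : Rn -> C) : L2 G -> (forall x, G x = 0 \/ G x = 1) -> (forall x, F x -> G x = 1) ->
    n2 (fun x => G x - cindic F x) = n2 G - p t.
  move=> LG G01 G1.
  have LGF := L2B LG LF.
  rewrite -n2F !n2E -RintegralB//; try exact: rint_sqn.
  apply: eq_Rintegral => x _; rewrite cindicE.
  case: ifPn => [/set_mem Fx|_]; first by rewrite G1// subrr sqn0 sqn1 subrr.
  by rewrite sqn0 !subr0.
rewrite (_ : (fun x => _) = fun x => (cindic E (y + x) - cindic F x) - (cindic E x - cindic F x)); last first.
  by apply/funext => x; rewrite opprB addrA subrK.
have i01 x : cindic E x = 0 \/ cindic E x = 1.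
  by rewrite cindicE; case: ifP; [right|left].
apply: le_lt_trans (n2B_le _ _) _; try (by apply: L2B => //; exact: L2_shift).
rewrite n2d//; first last.
- by move=> x /FEy Ex; rewrite cindicE mem_set.
- exact: L2_shift.
rewrite n2d//; last by move=> x /FE Ex; rewrite cindicE mem_set.
rewrite (n2_shift y (proj1 LE)) n2E'.
lra.
Qed.

(** A pi-lambda argument. Intersecting with the fixed box [Q] keeps all indicators in L^2, so that
    the good sets are closed under complement and disjoint union, and boxes generate the
    sigma-algebra. *)
Lemma translation_continuous_bounded_set (E : set Rn) (k : R) : measurable E -> 0 <= k ->
  TC (cindic (E `&` cV_box (- k) k)).
Proof.
move=> mE k0; set Q := cV_box _ _; have mQ : measurable Q by exact: measurable_cV_box.
have Qo : (mu Q < +oo)%E by rewrite cV_boxE ?ltry//; lra.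
have TQ : TC (cindic Q) by apply: (@translation_continuous_box (fun=> `]- k, k]%classic)) => i; exists (- k, k).
pose P := [set E : set Rn | TC (cindic (E `&` Q))].
suff : P E by [].
apply: (@dynkin_induction _ Rn (@ocboxes R n)).
- exact: ocboxes_measurable.
- exact: ocboxes_setI.
- by rewrite /P /= setTI.
- move=> _ [A oA ->]; rewrite /P /=.
  have -> : Q = ocbox (fun=> `]- k, k]%classic) by [].
  rewrite ocboxI; apply: translation_continuous_box => i; apply: ocitvI => //.
  by exists (- k, k).
- move=> S mS PS; rewrite /P /=.
  rewrite (_ : cindic _ = fun x => cindic Q x - cindic (S `&` Q) x); first exact: translation_continuousB.
  apply/funext => x; rewrite !cindicE !in_setI in_setC.
  by case: (x \in Q); case: (x \in S); rewrite ?subr0 ?subrr.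
- move=> F mF tF PF; rewrite /P /=.
  (* By disjointness the partial sums are themselves indicators, dominated by that of [Q]. *)
  pose fk m0 x : C := \sum_(i < m0) cindic (F i `&` Q) x.
  have Fx x i : (\bigcup_k F k) x -> F i x -> forall j, F j x -> i = j.
    move=> _ Fix j Fjx; apply/eqP/negP => /negP ij.
    by move/trivIsetP : tF => /(_ i j I I ij)/seteqP[/(_ x)] /(_ (conj Fix Fjx)).
  have fkE m0 x : fk m0 x = if [exists i : 'I_m0, x \in F i] && (x \in Q) then 1 else 0.
    rewrite /fk; case: ifPn => [/andP[/existsP[i xFi] xQ]|].
      rewrite (bigD1 i)//= big1 ?addr0; first by rewrite cindicE in_setI xFi xQ.
      move=> j ji; rewrite cindicE in_setI; case: ifP => // /andP[/set_mem xFj _].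
      exfalso; move/eqP : ji; apply; apply/val_inj; apply: (Fx x) => //; last exact/set_mem.
      by exists j.
    move=> nx; rewrite big1// => i _; rewrite cindicE in_setI; case: ifP => // /andP[xFi xQ].
    by move: nx; rewrite xQ andbT => /negP; case; apply/existsP; exists i.
  apply: (@translation_continuous_lim _ _ fk _ (fun x => \1_Q x)).
  + by apply: cmeasurable_cindic; apply: measurableI => //; exact: bigcupT_measurable.
  + move=> k1; rewrite /fk; elim: k1 => [|k1 IH].
      rewrite (_ : (fun x => _) = fun x => 0 * cindic Q x); first exact: translation_continuousZ.
      by apply/funext => x; rewrite big_ord0 mul0r.
    under eq_fun do rewrite big_ord_recr/=.
    by apply: translation_continuousD => //; exact: PF.
  + apply/integrableP; split; first by apply/measurable_EFinP; exact: measurable_indic.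
    under eq_integral do rewrite /= ger0_norm//.
    by rewrite integral_indic// setIT.
  + move=> k1 x; rewrite fkE cindicE in_setI indicE.
    case: (x \in Q); rewrite ?andbF ?andbT ?subr0 ?sqn0//.
    case: (boolP (x \in _)) => /= [h|h]; case: ifPn => h';
      rewrite ?subr0 ?subrr ?sub0r ?sqnN ?sqn0 ?sqn1//.
  + move=> x; have [[i _ Fix]|nx] := pselect ((\bigcup_k F k) x).
      apply: cvg_near_cst; exists i.+1 => // k1 /= ik1.
      rewrite fkE cindicE in_setI mem_set/=; last by exists i.
      have -> : [exists i0 : 'I_k1, x \in F i0].
        by apply/existsP; exists (Ordinal ik1); exact: mem_set.
      by rewrite subrr sqn0.
    apply: cvg_near_cst; exists 0%N => // k1 _.
    rewrite fkE cindicE in_setI memNset//=.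
    have -> : [exists i0 : 'I_k1, x \in F i0] = false.
      by apply/negbTE/existsPn => i; apply/negP => /set_mem Fix; apply: nx; exists i.
    by rewrite subrr sqn0.
- by rewrite -ocboxes_measurable.
Qed.

Lemma cV_box_nat (x : Rn) : exists k0 : nat, forall k, (k0 <= k)%N -> cV_box (- k%:R) k%:R x.
Proof.
exists (Num.truncn (\sum_j `|x j 0|)).+1 => k k0k j.
have : `|x j 0| < k%:R.
  apply: (@lt_le_trans _ _ (Num.truncn (\sum_j `|x j 0|)).+1%:R); last by rewrite ler_nat.
  apply: le_lt_trans (truncnS_gt _).
  by rewrite (bigD1 j)//= lerDl sumr_ge0.
by rewrite ltr_norml /= in_itv/= => /andP[-> /ltW].
Qed.

Lemma translation_continuous_nonneg (u : Rn -> R) : measurable_fun setT u -> (forall x, 0 <= u x) ->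
  L2 (fun x => (u x)%:C) -> TC (fun x => (u x)%:C).
Proof.
move=> mU u0 Lu.
have mEu : measurable_fun setT (EFin \o u) by exact/measurable_EFinP.
have u0' x : [set: Rn] x -> (0 <= (EFin \o u) x)%E by move=> _; rewrite lee_fin.
pose s k : {nnsfun Rn >-> R} := nnsfun_approx measurableT mEu k.
(* The growing boxes cut the level sets of the simple functions down to bounded sets, as the
   previous lemma requires. *)
pose fk (k : nat) x : C := (s k x * \1_(cV_box (- k%:R) k%:R) x)%:C.
have sle k x : 0 <= s k x <= u x.
  apply/andP; split; first by [].
  by rewrite /s nnsfun_approxE -lee_fin; exact: le_approx.
apply: (@translation_continuous_lim _ _ fk _ (fun x => sqn (u x)%:C)) => //.
- move=> k; rewrite /fk.
  rewrite (_ : (fun x => _) = fun x => \sum_(y <- finmap.enum_fset (fset_set (range (s k)))) y%:C *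
      cindic ((s k @^-1` [set y]) `&` cV_box (- k%:R) k%:R) x); last first.
    apply/funext => x; rewrite [in LHS]fimfunE fsbig_finite//= mulr_suml rmorph_sum/=.
    apply: eq_bigr => y _; rewrite /cindic -mulrA -rmorphM/= !indicE in_setI.
    by case: (x \in cV_box _ _); case: (x \in _); rewrite ?mulr0 ?mulr1.
  elim: (finmap.enum_fset _) => [|y S IH].
    rewrite (_ : (fun x => _) = fun x => 0 * cindic (setT `&` (cV_box 0 0)) x).
      rewrite -[X in cV_box X]oppr0; apply: translation_continuousZ; exact: translation_continuous_bounded_set.
    by apply/funext => x; rewrite big_nil mul0r.
  under eq_fun do rewrite big_cons.
  apply: translation_continuousD => //; apply: translation_continuousZ; apply: translation_continuous_bounded_set => //.
- exact: rint_sqn.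
- move=> k x; rewrite /fk -rmorphB/= !sqnr.
  have /andP[s0 su] := sle k x.
  rewrite ler_pXn2r// ?nnegrE//.
    by rewrite gerBl mulr_ge0.
  by rewrite subr_ge0 (le_trans _ su)// ler_piMr// indicE; case: (_ \in _).
- move=> x; have [k0 k0P] := cV_box_nat x.
  have cs : s k x @[k --> \oo] --> u x.
    have := @cvg_nnsfun_approx _ _ _ _ measurableT _ mEu u0' x I.
    by move/fine_cvgP => [_].
  have -> : (0 : R) = (u x - u x) ^+ 2 by rewrite subrr expr0n.
  have : (u x - s k x) ^+ 2 @[k --> \oo] --> (u x - u x) ^+ 2.
    by rewrite expr2; under eq_fun do rewrite expr2; apply: cvgM; (apply: cvgB => //; exact: cvg_cst).
  apply: cvg_trans; apply: near_eq_cvg; exists k0 => // k /= kk0.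
  by rewrite /fk -rmorphB/= sqnr indicE mem_set ?mulr1//; exact: k0P.
Qed.

(** Reduction to non-negative functions through real and imaginary, then positive and negative
    parts. The result is what makes autocorrelations continuous at 0. *)
Lemma L2_translation f : L2 f -> TC f.
Proof.
move=> Lf; have [[m1 m2] _] := Lf.
have TCr (u : Rn -> R) : measurable_fun setT u -> (forall x, u x ^+ 2 <= sqn (f x)) ->
    TC (fun x => (u x)%:C).
  move=> mU uf.
  have Lpos (v : Rn -> R) : measurable_fun setT v -> (forall x, v x ^+ 2 <= sqn (f x)) -> L2 (fun x => (v x)%:C).
    move=> mv vf; apply: le_L2 Lf _; first by split => //; exact: measurable_cst.
    by move=> x; rewrite sqnr.
  rewrite (_ : (fun x => (u x)%:C) = fun x => ((u^\+ x)%:C - (u^\- x)%:C)).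
    have mp := measurable_funrpos mU; have mn := measurable_funrneg mU.
    apply: translation_continuousB; apply: translation_continuous_nonneg => //; apply: Lpos => // x;
      (apply: le_trans (uf x); rewrite -[leRHS]real_normK ?num_real//;
       rewrite ler_pXn2r// ?nnegrE// /funrpos /funrneg ge_max normr_ge0 ?andbT ?ler_norm//).
    by rewrite -normrN ler_norm.
  apply/funext => x; rewrite -rmorphB/= /funrpos /funrneg; congr (_%:C).
  by case: (leP 0 (u x)) => h; [rewrite max_r ?oppr_le0// subr0
    |rewrite max_l ?oppr_ge0 ?ltW// sub0r opprK].
rewrite (_ : f = fun x => (complex.Re (f x))%:C + 'i%C * (complex.Im (f x))%:C).
  by apply: translation_continuousD; [|apply: translation_continuousZ];
    apply: TCr => // x; rewrite /sqn ?lerDl ?lerDr sqr_ge0.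
by apply/funext => x; rewrite -complexE.
Qed.

End translation_continuity.

(** * The Plancherel formula up to a constant *)

Section one_dim.
Variable R : realType.
Local Notation leb := (@lebesgue_measure R).

Lemma is_derive_affine (a s t : R) : is_derive t 1 (fun t : R => a * t + s) a.
Proof.
have h := is_deriveD (is_deriveM (is_derive_cst a t (1 : R)) (is_derive_id t (1 : R))) (is_derive_cst s t (1 : R)).
by apply: is_derive_eq h _; rewrite scaler0 !addr0 /GRing.scale/= mulr1.
Qed.

Lemma is_derive_sin_affine (a s t : R) :
  is_derive t 1 (fun t : R => sin (a * t + s)) (a * cos (a * t + s)).
Proof.
have h := is_derive_affine a s t.
rewrite mulrC; exact: (is_derive1_comp (is_derive_sin _) h).
Qed.

Lemma is_derive_cos_affine (a s t : R) :
  is_derive t 1 (fun t : R => cos (a * t + s)) (a * - sin (a * t + s)).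
Proof.
have h := is_derive_affine a s t.
rewrite mulrC; exact: (is_derive1_comp (is_derive_cos _) h).
Qed.

Lemma ftc2 (F f : R -> R) (a b : R) : a < b -> continuous f ->
  (forall t : R, is_derive t (1 : R) F (f t)) ->
  (\int[leb]_(t in `[a, b]) (f t)%:E)%E = (F b - F a)%:E.
Proof.
move=> ab cf dF.
have dF' (t : R) : derivable F t (1 : R) by have [] := dF t.
have cF : continuous F.
  by move=> t; apply: differentiable_continuous; exact/derivable1_diffP.
rewrite EFinB; apply: continuous_FTC2 => //.
- exact: continuous_subspaceT.
- by split => //; [apply: cvg_at_right_filter; exact: cF|apply: cvg_at_left_filter; exact: cF].
- by move=> t _; rewrite derive1E; have [_ ->] := dF t.
Qed.

Lemma continuous_cos_affine (a s : R) : continuous (fun t : R => cos (a * t + s)).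
Proof.
move=> t; apply: (@continuous_comp _ _ _ (fun t : R => a * t + s) (@cos R)); last exact: continuous_cos.
by apply: cvgD; [apply: cvgM; [exact: cvg_cst|exact: cvg_id]|exact: cvg_cst].
Qed.

(** The interval has integer length 2 M, hence consists of whole periods. This is the source of the
    orthogonality of the exponentials on a cube. *)
Lemma integral_cos_period (k : int) (M : nat) (s : R) : k != 0 -> (0 < M)%N ->
  (\int[leb]_(t in `[(- M%:R)%R, (M%:R)%R]) (cos (2 * pi * k%:~R * t + s))%:E)%E = 0%E.
Proof.
move=> k0 M0; set a := 2 * pi * k%:~R.
have a0 : a != 0 by rewrite !mulf_neq0 ?pnatr_eq0 ?intr_eq0// lt0r_neq0// pi_gt0.
have dF (t : R) : is_derive t (1 : R) (fun t => a^-1 * sin (a * t + s)) (cos (a * t + s)).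
  have h := is_deriveM (is_derive_cst a^-1 t (1 : R)) (is_derive_sin_affine a s t).
  by apply: is_derive_eq h _; rewrite scaler0 addr0 /GRing.scale/= mulrA mulVf// mul1r.
have M0' : - M%:R < M%:R :> R by have : 0 < M%:R :> R; [rewrite ltr0n|lra].
rewrite (ftc2 M0' (@continuous_cos_affine a s) dF).
have per (x : R) (m : int) : sin (x + (pi *+ 2) *~ m) = sin x.
  case: m => m; first by rewrite (periodicn (@sinD2pi R)).
  by rewrite NegzE mulrNz -[in RHS](subrK ((pi *+ 2) *~ m.+1) x) (periodicn (@sinD2pi R)).
rewrite (_ : a * M%:R + s = (a * - M%:R + s) + (pi *+ 2) *~ (k * (2 * M%:Z))).
  by rewrite per subrr.
by rewrite -mulrzr !intrM -[(M%:Z)%:~R]/(M%:R) mulr2n /a; ring.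
Qed.

(* Compactly supported, equal to 1 at 0, and with an integrable cosine transform
   ([bump_hat_le]), which makes Fubini available in [fourier_window]. *)
Definition bump (t : R) : R := Num.max 0 (1 - t ^+ 2).

Lemma bump_ge0 t : 0 <= bump t. Proof. by rewrite /bump le_max lexx. Qed.

Lemma bumpE : bump = (fun t : R => (1 - t ^+ 2 : R)) \_ `[-1, 1]%classic.
Proof.
apply/funext => t; rewrite patchE; case: ifPn => [/set_mem|/negP nt].
  rewrite /= in_itv/= => /andP[h1 h2]; rewrite /bump max_r// subr_ge0; nra.
rewrite /bump max_l//; rewrite subr_le0; apply: contrapT => h; apply: nt.
apply: mem_set; rewrite /= in_itv/=; move/negP : h; rewrite -ltNge => h.
by apply/andP; split; nra.
Qed.

Lemma measurable_bump : measurable_fun setT bump.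
Proof.
apply: measurable_maxr => //; apply: measurable_funB => //.
Qed.

Definition bump_hat (x : R) : R := fine (\int[leb]_t (cos (2 * pi * x * t) * bump t)%:E).

Lemma integral_cos_bump (a s : R) : a != 0 ->
  (\int[leb]_t (cos (a * t + s) * bump t)%:E)%E =
  (4 * cos s * (sin a / a ^+ 3 - cos a / a ^+ 2))%:E.
Proof.
move=> a0.
transitivity (\int[leb]_(t in `[(-1)%R, 1%R]) (cos (a * t + s) * (1 - t ^+ 2))%:E)%E.
  rewrite [RHS]integral_mkcond; apply: eq_integral => t _.
  by rewrite bumpE !patchE; case: ifP => //; rewrite mulr0.
(* The antiderivative produced by integrating by parts twice; its first term vanishes at both
   endpoints. *)
pose F (t : R) := (1 - t ^+ 2) * sin (a * t + s) / a - 2 * t * cos (a * t + s) / a ^+ 2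
   + 2 * sin (a * t + s) / a ^+ 3.
have dF (t : R) : is_derive t (1 : R) F (cos (a * t + s) * (1 - t ^+ 2)).
  have d1 := is_derive_sin_affine a s t; have d2 := is_derive_cos_affine a s t.
  have dt := is_derive_id t (1 : R).
  have dq := is_deriveB (is_derive_cst (1 : R) t (1 : R)) (is_deriveM dt dt).
  have h1 := is_deriveM (is_deriveM dq d1) (is_derive_cst a^-1 t (1 : R)).
  have h2 := is_deriveM (is_deriveM (is_deriveM (is_derive_cst (2 : R) t (1 : R)) dt) d2)
    (is_derive_cst ((a ^+ 2)^-1 : R) t (1 : R)).
  have h3 := is_deriveM (is_deriveM (is_derive_cst (2 : R) t (1 : R)) d1) (is_derive_cst ((a ^+ 3)^-1 : R) t (1 : R)).
  have h := is_deriveD (is_deriveB h1 h2) h3.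
  rewrite (_ : F = (fun t => F t)) //.
  have -> : F = ((cst 1 - id * id) * (fun t => sin (a * t + s)) * cst a^-1 -
     cst 2 * id * (fun t => cos (a * t + s)) * cst (a ^+ 2)^-1 +
     cst 2 * (fun t => sin (a * t + s)) * cst (a ^+ 3)^-1 : R -> R).
    by apply/funext => z; rewrite /F expr2.
  apply: is_derive_eq h _; rewrite /GRing.scale/= !fctE/=; field.
  by rewrite a0.
have cF : continuous (fun t : R => cos (a * t + s) * (1 - t ^+ 2)).
  move=> t; apply: cvgM; first exact: continuous_cos_affine.
  apply: cvgB; [exact: cvg_cst|under eq_fun do rewrite expr2; apply: cvgM; exact: cvg_id].
rewrite (ftc2 _ cF dF); last by lra.
congr EFin; rewrite /F !expr1n mulr1 mulrN1 sqrrN expr1n subrr !mul0r.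
rewrite !(cosD, sinD) cosN sinN; field.
by rewrite a0.
Qed.

Lemma integral_indic11 : (\int[leb]_t (\1_`[(-1)%R, 1%R]%classic t)%:E = 2%:E)%E.
Proof.
rewrite integral_indic// setIT.
have : (leb `[(-1)%R, 1%R]%classic = 2%:E)%E; last by [].
by rewrite lebesgue_measure_itv/= lte_fin ifT ?opprK//; lra.
Qed.

Lemma integrable_cos_bump (a s : R) : leb.-integrable setT (EFin \o (fun t => cos (a * t + s) * bump t)).
Proof.
have mc : measurable_fun setT (fun t : R => cos (a * t + s)).
  by apply: continuous_measurable_fun; exact: continuous_cos_affine.
have i1 : leb.-integrable setT (EFin \o (\1_`[-1, 1]%classic : R -> R)).
  apply/integrableP; split; first by apply/measurable_EFinP; exact: measurable_indic.
  under eq_integral do rewrite /= ger0_norm//.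
  by rewrite integral_indic11 ltry.
apply: le_integrable i1 => //.
- by apply/measurable_EFinP; apply: measurable_funM => //; exact: measurable_bump.
- move=> t _; rewrite /= lee_fin normrM bumpE patchE indicE.
  case: ifPn => [/set_mem|]; rewrite ?normr0 ?mulr0// normr1.
  rewrite /= in_itv/= => /andP[h1 h2]; rewrite mulr_ile1// ?ler_norml ?cos_geN1 ?cos_le1//.
  by apply/andP; split; nra.
Qed.

(** As [bump] is even, the phase only contributes the factor cos s. The phase is carried along
    because the induction on the dimension absorbs the other coordinates into it. *)
Lemma bump_hatE (x s : R) :
  (\int[leb]_t (cos (2 * pi * x * t + s) * bump t)%:E)%E = (cos s * bump_hat x)%:E.
Proof.
have [->|x0] := eqVneq x 0.
  rewrite /bump_hat mulr0.
  under eq_integral do rewrite mul0r add0r EFinM.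
  rewrite integralZl//; last first.
    have := integrable_cos_bump 0 0; congr (integrable _ _ _).
    by apply/funext => t /=; rewrite mul0r add0r cos0 mul1r.
  under [X in (_ * fine X)%:E]eq_integral do rewrite mul0r cos0 mul1r.
  rewrite EFinM fineK//; apply: integrable_fin_num => //.
  have := integrable_cos_bump 0 0; congr (integrable _ _ _).
  by apply/funext => t /=; rewrite mul0r add0r cos0 mul1r.
have a0 : 2 * pi * x != 0 by rewrite !mulf_neq0 ?pnatr_eq0// lt0r_neq0// pi_gt0.
rewrite /bump_hat integral_cos_bump//.
under [X in (_ * fine X)%:E]eq_integral do rewrite -[X in cos X]addr0.
by rewrite integral_cos_bump// cos0 /= mulr1; congr EFin; ring.
Qed.

(** With a = 2 pi x: for |a| >= 1 the explicit formula gives at most 8 / a^2, while 1 + x^2 <= 2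
    a^2, whence 16. For |a| < 1 the trivial bound 2 suffices, since x^2 <= 1. *)
Lemma bump_hat_le (x : R) : `|bump_hat x| <= 16 / (1 + x ^+ 2).
Proof.
have p2 := pi_ge2 R.
have x2 : 0 <= x ^+ 2 by exact: sqr_ge0.
rewrite ler_pdivlMr; last by lra.
have ax : x ^+ 2 <= (2 * pi * x) ^+ 2.
  rewrite exprMn ler_peMl// expr_ge1//; lra.
have [a1|a1] := leP 1 `|2 * pi * x|; last first.
  have : `|bump_hat x| <= 2.
    rewrite /bump_hat -fine_abse; last first.
      apply: integrable_fin_num => //.
      have := integrable_cos_bump (2 * pi * x) 0; congr (integrable _ _ _).
      by apply/funext => t /=; rewrite addr0.
    rewrite -lee_fin fineK; last first.
      rewrite abse_fin_num; apply: integrable_fin_num => //.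
      have := integrable_cos_bump (2 * pi * x) 0; congr (integrable _ _ _).
      by apply/funext => t /=; rewrite addr0.
    have ic := integrable_cos_bump (2 * pi * x) 0.
    rewrite -integral_indic11.
    apply: le_trans (le_abse_integral _ _ _) _ => //.
      move: ic => /integrableP[mc _]; move: mc; congr (measurable_fun _ _).
      by apply/funext => t /=; rewrite addr0.
    apply: ge0_le_integral => //.
    - apply: measurableT_comp => //.
      move: ic => /integrableP[mc _]; move: mc; congr (measurable_fun _ _).
      by apply/funext => t /=; rewrite addr0.
    - by apply/measurable_EFinP; exact: measurable_indic.
    - move=> t _; rewrite /= lee_fin normrM bumpE patchE indicE.
      case: ifPn => [/set_mem|]; rewrite ?normr0 ?mulr0//.
      rewrite /= in_itv/= => /andP[h1 h2]; rewrite mulr_ile1// ?ler_norml ?cos_geN1 ?cos_le1//.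
      by apply/andP; split; nra.
  have : x ^+ 2 <= 1.
    apply: le_trans ax _; rewrite -[leLHS]real_normK ?num_real// exprn_ile1//; exact: ltW.
  by have := normr_ge0 (bump_hat x); nra.
have a0 : 2 * pi * x != 0 by rewrite -normr_gt0; lra.
have := bump_hatE x 0; rewrite integral_cos_bump// cos0 mul1r mulr1 => -[<-].
set a := 2 * pi * x in a0 a1 ax *.
have a2 : 1 <= a ^+ 2 by rewrite -real_normK ?num_real// expr_ge1.
have K : `|sin a / a ^+ 3 - cos a / a ^+ 2| <= 2 / a ^+ 2.
  apply: le_trans (ler_normB _ _) _.
  rewrite !normrM !normfV !normrX.
  have n2 : `|a| ^+ 2 = a ^+ 2 by rewrite real_normK ?num_real.
  have i1 : `|a|^-1 <= 1 by rewrite invf_le1 //; lra.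
  have s1 : `|sin a| <= 1 by rewrite ler_norml sin_geN1 sin_le1.
  have c1 : `|cos a| <= 1 by rewrite ler_norml cos_geN1 cos_le1.
  rewrite exprS invfM n2 mulrA [2]/(1 + 1) mulrDl lerD// ?mul1r.
    rewrite ler_piMl ?invr_ge0 ?sqr_ge0//.
    by rewrite mulr_ile1// invr_ge0.
  by rewrite ler_piMl ?invr_ge0 ?sqr_ge0.
rewrite normrM ger0_norm//.
apply: le_trans (_ : 4 * (2 / a ^+ 2) * (1 + x ^+ 2) <= _).
  by rewrite ler_wpM2r ?ler_wpM2l//; lra.
rewrite (_ : _ * _ = (8 * (1 + x ^+ 2)) / a ^+ 2); last by ring.
by rewrite ler_pdivrMr; nra.
Qed.

End one_dim.

(** * Tensor products of one-variable functions and their cosine transforms *)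

Section products.
Variable R : realType.
Local Open Scope ereal_scope.
Local Notation leb := (@lebesgue_measure R).
Local Notation mu n := (lebesgue_cV R n).

Lemma integral_cVS n (f : 'cV[R]_n.+1 -> \bar R) :
  (mu n.+1).-integrable setT f ->
  \int[mu n.+1]_x f x = \int[leb]_t \int[mu n]_v f (cV_cons (t, v)).
Proof.
move=> fi; have [mf fo] := integrableP _ _ _ fi.
have mc := @measurable_cV_cons R n.
have ic : (leb \x mu n).-integrable setT (f \o @cV_cons R n).
  apply/integrableP; split; first exact: measurableT_comp.
  apply: le_lt_trans fo.
  have -> // := @ge0_integral_pushforward _ _ _ _ _ _ mc (leb \x mu n) setT (fun x => `|f x|) measurableT _ _.
  by apply: measurableT_comp.
transitivity (\int[leb \x mu n]_z f (cV_cons z)).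
  exact: (@integral_pushforward _ _ _ _ _ _ mc (leb \x mu n) setT f mf ic measurableT).
by rewrite -(integral12_prod_meas1 ic).
Qed.

Definition cV_prod (g : R -> R) n (x : 'cV[R]_n) : R := (\prod_i g (x i 0))%R.

Lemma cV_prod_cons g n t (v : 'cV[R]_n) :
  cV_prod g (cV_cons (t, v)) = (g t * cV_prod g v)%R.
Proof.
rewrite /cV_prod big_ord_recl mxE unlift_none/=; congr (_ * _)%R.
by apply: eq_bigr => i _; rewrite mxE liftK.
Qed.

Lemma measurable_cV_prod g n : measurable_fun setT (g : measurableTypeR R -> measurableTypeR R) ->
  measurable_fun setT (@cV_prod g n).
Proof.
move=> mg; apply: measurable_prod => i _.
by apply: (measurableT_comp mg); exact: measurable_mxentry.
Qed.

Lemma integral_cV_prod g n (K : R) : measurable_fun setT (g : measurableTypeR R -> measurableTypeR R) ->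
  (forall t, 0 <= g t)%R -> \int[leb]_t (g t)%:E = K%:E ->
  \int[mu n]_x (cV_prod g x)%:E = (K ^+ n)%:E.
Proof.
move=> mg g0 gK.
have mp k := @measurable_cV_prod g k mg.
have p0 k (x : 'cV[R]_k) : (0 <= cV_prod g x)%R by apply: prodr_ge0.
elim: n => [|n IH].
  rewrite integral_cV0 ?expr0 /cV_prod ?big_ord0//.
  by apply/measurable_EFinP; exact: mp.
rewrite ge0_integral_cVS; last 2 first.
- by apply/measurable_EFinP; exact: mp.
- by move=> x; rewrite lee_fin.
transitivity (\int[leb]_t ((g t)%:E * (K ^+ n)%:E)).
  apply: eq_integral => t _; under eq_integral do rewrite cV_prod_cons EFinM.
  rewrite ge0_integralZl//; last 3 first.
  - by apply/measurable_EFinP; exact: mp.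
  - by move=> x _; rewrite lee_fin.
  - by rewrite lee_fin.
  by rewrite IH.
have K0 : (0 <= K)%R by rewrite -lee_fin -gK; apply: integral_ge0 => t _; rewrite lee_fin.
rewrite ge0_integralZr//; last 3 first.
- exact/measurable_EFinP.
- by move=> t _; rewrite lee_fin.
- by rewrite lee_fin exprn_ge0.
by rewrite gK exprS.
Qed.

Lemma integrable_cV_prod g n (K : R) : measurable_fun setT (g : measurableTypeR R -> measurableTypeR R) ->
  (forall t, 0 <= g t)%R -> \int[leb]_t (g t)%:E = K%:E ->
  (mu n).-integrable setT (EFin \o @cV_prod g n).
Proof.
move=> mg g0 gK; apply/integrableP; split.
  by apply/measurable_EFinP; exact: measurable_cV_prod.
under eq_integral do rewrite /= ger0_norm ?prodr_ge0//.
by rewrite (@integral_cV_prod g n K)// ltry.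
Qed.

Lemma dotp_cons n (z : 'cV[R]_n.+1) t (v : 'cV[R]_n) :
  dotp z (cV_cons (t, v)) = (z ord0 0 * t + dotp (cV_uncons z).2 v)%R.
Proof.
rewrite /dotp big_ord_recl mxE unlift_none/=; congr (_ + _)%R.
by apply: eq_bigr => i _; rewrite !mxE liftK.
Qed.

Lemma measurable_dotp n (z : 'cV[R]_n) : measurable_fun setT (dotp z).
Proof.
by apply: measurable_sum => i; apply: measurable_funM => //; exact: measurable_mxentry.
Qed.

Lemma measurable_cosR : measurable_fun setT (@cos R : measurableTypeR R -> measurableTypeR R).
Proof. by apply: continuous_measurable_fun; exact: continuous_cos. Qed.

Lemma measurable_sinR : measurable_fun setT (@sin R : measurableTypeR R -> measurableTypeR R).
Proof. by apply: continuous_measurable_fun; exact: continuous_sin. Qed.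

Lemma integrable_cos_cV_prod g n (K : R) (z : 'cV[R]_n) s :
  measurable_fun setT (g : measurableTypeR R -> measurableTypeR R) ->
  (forall t, 0 <= g t)%R -> \int[leb]_t (g t)%:E = K%:E ->
  (mu n).-integrable setT (EFin \o fun x => cos (2 * pi * dotp z x + s) * cV_prod g x)%R.
Proof.
move=> mg g0 gK; apply: le_integrable (integrable_cV_prod n mg g0 gK) => //.
  apply/measurable_EFinP; apply: measurable_funM; last exact: measurable_cV_prod.
  apply: (measurableT_comp measurable_cosR); apply: measurable_funD => //.
  by apply: measurable_funM => //; exact: measurable_dotp.
move=> x _; rewrite /= lee_fin normrM ler_piMl// ler_norml cos_geN1 cos_le1//.
Qed.

(** A cosine of a sum does not factor, but a cosine with a free phase allows integration over one
    coordinate at a time. *)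
Lemma integral_cos_cV_prod g (h : R -> R) n (K : R) (z : 'cV[R]_n) s :
  measurable_fun setT (g : measurableTypeR R -> measurableTypeR R) ->
  (forall t, 0 <= g t)%R -> \int[leb]_t (g t)%:E = K%:E ->
  (forall i s, \int[leb]_t (cos (2 * pi * z i 0 * t + s) * g t)%:E = (cos s * h (z i 0)%R)%:E) ->
  \int[mu n]_x (cos (2 * pi * dotp z x + s) * cV_prod g x)%:E = (cos s * cV_prod h z)%:E.
Proof.
move=> mg g0 gK; elim: n z s => [|n IH] z s gh.
  rewrite integral_cV0; last by have [] := integrableP _ _ _ (integrable_cos_cV_prod z s mg g0 gK).
  by rewrite /dotp /cV_prod !big_ord0 mulr0 add0r mulr1.
rewrite integral_cVS; last exact: (integrable_cos_cV_prod z s mg g0 gK).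
set z' := (cV_uncons z).2.
have gh' i s' : \int[leb]_t (cos (2 * pi * z' i 0 * t + s') * g t)%:E = (cos s' * h (z' i 0)%R)%:E.
  by rewrite mxE; exact: gh.
transitivity (\int[leb]_t ((cV_prod h z')%:E * (cos (2 * pi * z ord0 0 * t + s) * g t)%:E)).
  apply: eq_integral => t _.
  (* For the inner integral, the first coordinate is part of the phase. *)
  transitivity (\int[mu n]_v ((g t)%:E *
      (cos (2 * pi * dotp z' v + (2 * pi * z ord0 0 * t + s)) * cV_prod g v)%:E)).
    apply: eq_integral => v _; rewrite cV_prod_cons dotp_cons -EFinM; congr EFin.
    by rewrite mulrCA; congr (_ * (cos _ * _))%R; rewrite /z'; ring.
  rewrite integralZl//; last exact: (integrable_cos_cV_prod z' _ mg g0 gK).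
  by rewrite IH// -!EFinM; congr EFin; ring.
have ig : leb.-integrable setT (EFin \o (fun t => cos (2 * pi * z ord0 0 * t + s) * g t)%R).
  have ig0 : leb.-integrable setT (EFin \o g).
    apply/integrableP; split; first exact/measurable_EFinP.
    by under eq_integral do rewrite /= ger0_norm//; rewrite gK ltry.
  apply: le_integrable ig0 => //.
    apply/measurable_EFinP; apply: measurable_funM => //.
    by apply: continuous_measurable_fun; exact: continuous_cos_affine.
  by move=> t _; rewrite /= lee_fin normrM ler_piMl// ler_norml cos_geN1 cos_le1.
rewrite integralZl// gh -EFinM; congr EFin.
rewrite mulrCA; congr (_ * _)%R; rewrite /cV_prod [RHS]big_ord_recl mulrC; congr (_ * _)%R.
by apply: eq_bigr => i _; rewrite mxE.
Qed.

Lemma integral_bump : exists K : R, \int[leb]_t (bump t)%:E = K%:E.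
Proof.
have := integrable_cos_bump (0:R) 0; under [X in integrable _ _ (_ \o X)]eq_fun do rewrite mul0r addr0 cos0 mul1r.
move=> ib; exists (fine (\int[leb]_t (bump t)%:E)); rewrite fineK//.
exact: integrable_fin_num.
Qed.

(** A multiple of the Cauchy density: the integrable majorant of [bump_hat] given by
    [bump_hat_le]. *)
Definition cauchy (t : R) : R := (16 / (1 + t ^+ 2))%R.

Lemma cauchy_ge0 t : (0 <= cauchy t)%R.
Proof. by rewrite divr_ge0// addr_ge0// sqr_ge0. Qed.

Lemma continuous_cauchy : continuous cauchy.
Proof. by move=> t; apply: cvgM; [exact: cvg_cst|exact: continuous_oneDsqrV]. Qed.

Lemma integral_cauchy : \int[leb]_t (cauchy t)%:E = (16 * pi)%:E.
Proof.
rewrite ge0_symfun_integralT//=.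
- rewrite (_ : [set x | _] = `[0%R, +oo[%classic); last first.
    by apply/seteqP; split => x/=; rewrite in_itv/= andbT.
  under eq_integral do rewrite EFinM.
  rewrite ge0_integralZl//; last 2 first.
  + apply/measurable_EFinP; apply: measurable_funTS.
    by apply: continuous_measurable_fun; exact: continuous_oneDsqrV.
  + by move=> t _; rewrite lee_fin invr_ge0 addr_ge0// sqr_ge0.
  by rewrite integral0y_oneDsqr -!EFinM; congr EFin; field.
- exact: cauchy_ge0.
- exact: continuous_cauchy.
- by move=> t /=; rewrite /cauchy sqrrN.
Qed.

(** Measurability in Tonelli's theorem concerns non-negative functions, hence the splitting into
    positive and negative parts. *)
Lemma measurable_param d (T : measurableType d) n (f : T * 'cV[R]_n -> R) :
  measurable_fun setT f ->
  measurable_fun setT (fun z : T => \int[mu n]_x (f (z, x))%:E).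
Proof.
move=> mf; have mEf : measurable_fun setT (EFin \o f) by exact/measurable_EFinP.
rewrite (_ : (fun z => _) = (fun z => \int[mu n]_x ((EFin \o f)^\+ (z, x))) \-
    (fun z => \int[mu n]_x ((EFin \o f)^\- (z, x)))); last first.
  apply/funext => z; rewrite [LHS]integralE; congr (_ - _); apply: eq_integral => x _;
    by rewrite ?(funeposE, funenegE).
apply: emeasurable_funB.
  exact: (@measurable_fun_fubini_tonelli_F _ _ _ _ _ (mu n) _ (measurable_funepos mEf) (fun=> funepos_ge0 _ _)).
exact: (@measurable_fun_fubini_tonelli_F _ _ _ _ _ (mu n) _ (measurable_funeneg mEf) (fun=> funeneg_ge0 _ _)).
Qed.

End products.

(** * Linear changes of variables and correlations *)

Section plancherel_prep.
Variables (R : realType) (n : nat).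
Local Notation C := R[i].
Local Notation Rn := 'cV[R]_n.
Local Notation mu := (lebesgue_cV R n).
Local Notation rint f := (mu.-integrable setT (EFin \o f)).
Local Notation "f '2rint'" := ((mu \x mu)%E.-integrable setT (EFin \o f)) (at level 10).
Implicit Types (f g h u : Rn -> C).

Lemma measurable_dotp2 d (T : measurableType d) (f g : T -> Rn) :
  measurable_fun setT f -> measurable_fun setT g ->
  measurable_fun setT (fun x => dotp (f x) (g x)).
Proof.
move=> mf mg; apply: measurable_sum => i.
by apply: measurable_funM; apply: (measurableT_comp (measurable_mxentry _ _)).
Qed.

Lemma integral_linear_change (P : 'M[R]_n) : P \in unitmx ->
  exists2 c : R, 0 < c & (forall f : Rn -> \bar R,
    measurable_fun setT f -> (forall x, 0 <= f x)%E ->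
    (\int[mu]_x f (P *m x) = c%:E * \int[mu]_x f x)%E) /\
   (forall f : Rn -> R, rint f -> rint (fun x => f (P *m x)) /\
    \int[mu]_x f (P *m x) = c * \int[mu]_x f x).
Proof.
move=> uP; have [c c0 cP] := cV_linear_change uP; exists c => //; split => // f fi.
have [mf fo] := integrableP _ _ _ fi.
have mP := measurable_mulmx_cV P.
have ip : rint (fun x => f (P *m x)).
  apply/integrableP; split; first by apply: (measurableT_comp mf).
  rewrite (cP (fun x => `|(f x)%:E|%E))//; last by apply: measurableT_comp.
  by rewrite lte_mul_pinfty// lee_fin ltW.
split => //; apply: EFin_inj; rewrite EFinM !fineK; try exact: integrable_fin_num.
rewrite [LHS]integralE [X in (_ * X)%E]integralE.
have fin1 := integrable_pos_fin_num measurableT fi.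
have fin2 := integrable_neg_fin_num measurableT fi.
rewrite muleBr//; last by rewrite ?fin_num_adde_defl ?fin_num_adde_defr ?fin_numN.
rewrite -(cP _ (measurable_funepos mf) (fun=> funepos_ge0 _ _)).
rewrite -(cP _ (measurable_funeneg mf) (fun=> funeneg_ge0 _ _)).
by congr (_ - _)%E; apply: eq_integral => x _; rewrite ?(funeposE, funenegE).
Qed.

Lemma conv_integrable (p q : Rn -> R) : rint p -> rint q ->
  (fun z : Rn * Rn => p (z.1 + z.2) * q z.2) 2rint.
Proof.
move=> ip iq; have [mp po] := integrableP _ _ _ ip; have [mq qo] := integrableP _ _ _ iq.
have mp' : measurable_fun setT p by exact/measurable_EFinP.
have mq' : measurable_fun setT q by exact/measurable_EFinP.
have madd : measurable_fun setT (fun z : Rn * Rn => z.1 + z.2).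
  by apply: measurable_cV_binop.
have m1 : measurable_fun setT (fun z : Rn * Rn => p (z.1 + z.2) * q z.2).
  by apply: measurable_funM; [exact: measurableT_comp|exact: (measurableT_comp mq')].
apply/integrableP; split; first exact/measurable_EFinP.
pose F (z : Rn * Rn) : R := p (z.1 + z.2) * q z.2.
have m2 : measurable_fun setT (fun z : Rn * Rn => `|(F z)%:E|%E).
  by apply: measurableT_comp => //; exact/measurable_EFinP.
rewrite (@fubini_tonelli2 _ _ _ _ _ mu mu _ m2 (fun=> abse_ge0 _)).
rewrite [ltLHS](_ : _ = (\int[mu]_y ((\int[mu]_x `|(p x)%:E|) * `|(q y)%:E|)))%E; last first.
  apply: eq_integral => y _; rewrite /fubini_G /F.
  under eq_integral do rewrite /= normrM EFinM.
  rewrite ge0_integralZr//; last first.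
    apply/measurable_EFinP; apply: measurableT_comp => //; apply: measurableT_comp => //.
    by under eq_fun do rewrite addrC; exact: measurable_cV_add.
  congr (_ * _)%E.
  rewrite -(@ge0_integral_cV_shift R n y (fun x => `|(p x)%:E|%E))//.
    by apply: eq_integral => x _; rewrite addrC.
  exact: measurableT_comp.
rewrite ge0_integralZl//.
- by rewrite lte_mul_pinfty// ?integral_ge0// ge0_fin_numE// integral_ge0.
- exact: measurableT_comp.
- exact: integral_ge0.
Qed.

(** After Fubini, the inner integral of p over a translate does not depend on the translation. *)
Lemma conv_integral (p q : Rn -> R) : rint p -> rint q ->
  (\int[mu]_z \int[mu]_y (p (z + y) * q y)%:E = ((\int[mu]_x p x) * (\int[mu]_x q x))%:E)%E.
Proof.
move=> ip iq; have := conv_integrable ip iq => i2.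
rewrite (@Fubini _ _ _ _ _ mu mu _ i2)/=.
have sh y : rint (fun z => p (z + y)) /\ (\int[mu]_z (p (z + y))%:E = \int[mu]_x (p x)%:E)%E.
  have [mp po] := integrableP _ _ _ ip.
  have msh : measurable_fun setT (fun x : Rn => x + y).
    by under eq_fun do rewrite addrC; exact: measurable_cV_add.
  have E (f : Rn -> \bar R) : measurable_fun setT f -> (forall x, 0 <= f x)%E ->
      (\int[mu]_z f (z + y)%R = \int[mu]_x f x)%E.
    move=> mf f0; rewrite -(ge0_integral_cV_shift y mf f0).
    by apply: eq_integral => z _; rewrite addrC.
  split.
    apply/integrableP; split; first exact: measurableT_comp mp msh.
    by rewrite (E (fun x => `|(p x)%:E|%E))//; exact: measurableT_comp.
  rewrite [LHS]integralE [RHS]integralE -[X in _ = (X - _)%E]E//; last exact: measurable_funepos.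
  rewrite -[X in _ = (_ - X)%E]E//; last exact: measurable_funeneg.
  by congr (_ - _)%E; apply: eq_integral => x _; rewrite ?(funeposE, funenegE).
set I := \int[mu]_x p x; set J := \int[mu]_x q x.
have IE : (I%:E = \int[mu]_x (p x)%:E)%E by rewrite fineK//; exact: integrable_fin_num.
have JE : (J%:E = \int[mu]_x (q x)%:E)%E by rewrite fineK//; exact: integrable_fin_num.
transitivity (\int[mu]_y (I%:E * (q y)%:E))%E.
  apply: eq_integral => y _; under eq_integral do rewrite EFinM.
  by rewrite integralZr; [rewrite IE (sh y).2|exact: measurableT|exact: (sh y).1].
by rewrite integralZl// -JE.
Qed.

End plancherel_prep.

Section plancherel.
Variables (R : realType) (n : nat).
Local Notation C := R[i].
Local Notation Rn := 'cV[R]_n.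
Local Notation mu := (lebesgue_cV R n).
Local Notation rint f := (mu.-integrable setT (EFin \o f)).
Local Notation rint2 f := ((mu \x mu)%E.-integrable setT (EFin \o f)).
Implicit Types (f g h u : Rn -> C).

Lemma cisD (a b : R) : cis (a + b) = cis a * cis b.
Proof. by apply: complex_ext; rewrite !ReImE /= ?cosD ?sinD ?[_ * cos b + _]addrC//; ring. Qed.

Lemma cisN (a : R) : cis (- a) = (cis a)^*.
Proof. by apply: complex_ext; rewrite !ReImE /= ?cosN ?sinN. Qed.

Lemma dotpDl (x y z : Rn) : dotp (x + y) z = dotp x z + dotp y z.
Proof. by rewrite /dotp -big_split; apply: eq_bigr => i _; rewrite mxE mulrDl. Qed.

Lemma dotpC (x y : Rn) : dotp x y = dotp y x.
Proof. by apply: eq_bigr => i _; rewrite mulrC. Qed.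

Lemma dotpZl (a : R) (x y : Rn) : dotp (a *: x) y = a * dotp x y.
Proof. by rewrite /dotp mulr_sumr; apply: eq_bigr => i _; rewrite mxE mulrA. Qed.

Lemma dotpDr (x y z : Rn) : dotp z (x + y) = dotp z x + dotp z y.
Proof. by rewrite dotpC dotpDl ![dotp _ z]dotpC. Qed.

Lemma dotpZr (a : R) (x y : Rn) : dotp x (a *: y) = a * dotp x y.
Proof. by rewrite dotpC dotpZl dotpC. Qed.

Lemma dotpNr (x y : Rn) : dotp x (- y) = - dotp x y.
Proof. by rewrite -scaleN1r dotpZr mulN1r. Qed.

Lemma cmeasurable_cis (v : Rn -> R) : measurable_fun setT v -> cmeasurable (fun x => cis (v x)).
Proof.
move=> mv; split.
  exact: (measurableT_comp (@measurable_cosR R)).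
exact: (measurableT_comp (@measurable_sinR R)).
Qed.

Lemma cintegrable_cmeasurable f : cintegrable f -> cmeasurable f.
Proof.
by move=> [/integrableP[/measurable_EFinP m1 _] /integrableP[/measurable_EFinP m2 _]].
Qed.

Lemma cintegrableM_unit f g : cintegrable f -> cmeasurable g -> (forall x, sqn (g x) <= 1) ->
  cintegrable (fun x => f x * g x).
Proof.
move=> fi mg g1; have mf := cintegrable_cmeasurable fi.
have [m1 m2] := cmeasurableM mf mg.
have [f1 f2] := fi.
have ab (u : Rn -> R) : rint u -> rint (fun x => `|u x|) by move=> /integrable_abse.
have iab := rintD (ab _ f1) (ab _ f2).
have gle x : `|complex.Re (g x)| <= 1 /\ `|complex.Im (g x)| <= 1.
  have := g1 x; rewrite /sqn => h.
  by split; rewrite -(@ler_pXn2r _ 2)// ?nnegrE// expr1n real_normK ?num_real//;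
    apply: le_trans h; rewrite ?lerDl ?lerDr sqr_ge0.
split; apply: (rint_dom _ _ iab) => // x; rewrite ?ReM ?ImM;
  [apply: le_trans (ler_normB _ _) _|apply: le_trans (ler_normD _ _) _ ];
  by rewrite !normrM lerD// ?ler_piMr// ?(gle x).1 ?(gle x).2.
Qed.

Definition modulate (xi : Rn) u x := u x * cis (- (2 * pi * dotp x xi)).

Lemma measurable_phase (xi : Rn) : measurable_fun setT (fun x : Rn => - (2 * pi * dotp x xi)).
Proof.
apply: measurableT_comp => //; apply: measurable_funM => //.
by under eq_fun do rewrite dotpC; exact: measurable_dotp.
Qed.

Lemma cintegrable_modulate xi u : cintegrable u -> cintegrable (modulate xi u).
Proof.
move=> ui; apply: cintegrableM_unit => //; last by move=> x; rewrite sqn_cis.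
by apply: cmeasurable_cis; exact: measurable_phase.
Qed.

Lemma L2_modulate xi u : L2 u -> L2 (modulate xi u).
Proof.
move=> Lu; apply: (le_L2 _ Lu); last by move=> x; rewrite sqnM sqn_cis mulr1.
apply: cmeasurableM; first by case: Lu.
by apply: cmeasurable_cis; exact: measurable_phase.
Qed.

Lemma cintegral_EFin f : cintegrable f ->
  ((complex.Re (cintegral f))%:E = \int[mu]_x (complex.Re (f x))%:E)%E /\
  ((complex.Im (cintegral f))%:E = \int[mu]_x (complex.Im (f x))%:E)%E.
Proof.
by move=> [f1 f2]; split; rewrite fineK//; exact: integrable_fin_num.
Qed.

(* The Fourier transform of [autoc u] is the squared modulus of that of [u]. *)
Definition autoc u (z : Rn) : C := L2inner (fun y => u (z + y)) u.

(** The phases at y cancel between the two factors; only the phase at z remains. *)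
Lemma autoc_modulate u xi z : L2 u ->
  L2inner (fun y => modulate xi u (z + y)) (modulate xi u) =
  autoc u z * cis (- (2 * pi * dotp z xi)).
Proof.
move=> Lu; rewrite mulrC -cintegralZ; last by apply: cintegrableM => //; exact: L2_shift.
congr cintegral; apply/funext => y; rewrite /modulate dotpDl mulrDr opprD cisD conjCM.
rewrite [cis (- (2 * pi * dotp y xi))]cisN conjCK.
have := sqn_cis (2 * pi * dotp y xi).
move: (u (z + y)) (u y)^* (cis (- (2 * pi * dotp z xi))) (cis (2 * pi * dotp y xi)) => p q r w sw.
rewrite (_ : _ * _ = (w * w^*) * (r * (p * q))); last by ring.
by rewrite mulJ_sqn sw mul1r.
Qed.

Lemma autoc_integrable2 u : cintegrable u ->
  rint2 (fun z => complex.Re (u (z.1 + z.2) * (u z.2)^*)) /\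
  rint2 (fun z => complex.Im (u (z.1 + z.2) * (u z.2)^*)).
Proof.
move=> [u1 u2]; split.
  have := integrableD measurableT (conv_integrable u1 u1) (conv_integrable u2 u2).
  by congr (_.-integrable _ _); apply/funext => z /=; rewrite !ReImE mulrN opprK.
have := integrableB measurableT (conv_integrable u2 u1) (conv_integrable u1 u2).
congr (_.-integrable _ _); apply/funext => z /=; rewrite !ReImE -EFinB.
by congr EFin; ring.
Qed.

Lemma autoc_integrable u : cintegrable u -> L2 u -> cintegrable (autoc u).
Proof.
move=> ui Lu; have [i1 i2] := autoc_integrable2 ui.
have E z := cintegral_EFin (cintegrableM (L2_shift z Lu) Lu).
split.
  have := integrable_fubini_F i1; congr (_.-integrable _ _).
  by apply/funext => z; rewrite /= (E z).1.
have := integrable_fubini_F i2; congr (_.-integrable _ _).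
by apply/funext => z; rewrite /= (E z).2.
Qed.

Lemma autoc_total u : cintegrable u -> L2 u ->
  ((sqn (cintegral u))%:E = \int[mu]_z (complex.Re (autoc u z))%:E)%E.
Proof.
move=> [u1 u2] Lu.
have c1 := conv_integrable u1 u1; have c2 := conv_integrable u2 u2.
transitivity (\int[mu]_z \int[mu]_y (complex.Re (u (z + y)%R * (u y)^*))%:E)%E; last first.
  apply: eq_integral => z _.
  by rewrite (cintegral_EFin (cintegrableM (L2_shift z Lu) Lu)).1.
have [i1 _] := autoc_integrable2 (conj u1 u2).
have -> := @integral12_prod_meas1 _ _ _ _ _ mu mu _ i1.
transitivity (\int[mu \x mu]_z ((EFin \o (fun z : Rn * Rn => (complex.Re (u (z.1 + z.2)) * complex.Re (u z.2))%R)) z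
   + (EFin \o (fun z : Rn * Rn => (complex.Im (u (z.1 + z.2)) * complex.Im (u z.2))%R)) z))%E; last first.
  by apply: eq_integral => z _; rewrite /= !ReImE mulrN opprK.
rewrite integralD//.
rewrite -(@integral12_prod_meas1 _ _ _ _ _ mu mu _ c1) -(@integral12_prod_meas1 _ _ _ _ _ mu mu _ c2).
rewrite [X in (X + _)%E](conv_integral u1 u1) [X in (_ + X)%E](conv_integral u2 u2).
by rewrite -EFinD /sqn !expr2.
Qed.

(** [fourier u xi] is the integral of [modulate xi u], so [autoc_total] applies to the modulated
    function, whose autocorrelation is given by [autoc_modulate]. *)
Lemma sqn_fourier u xi : cintegrable u -> L2 u ->
  ((sqn (fourier u xi))%:E =
   \int[mu]_z (complex.Re (autoc u z * cis (- (2 * pi * dotp z xi))))%:E)%E.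
Proof.
move=> ui Lu; rewrite (autoc_total (cintegrable_modulate xi ui) (L2_modulate xi Lu)).
by apply: eq_integral => z _; rewrite /autoc autoc_modulate.
Qed.

Lemma cmeasurable_fourier u : cintegrable u -> cmeasurable (fourier u).
Proof.
move=> ui; have [mu1 mu2] := cintegrable_cmeasurable ui.
have mph : measurable_fun setT (fun z : Rn * Rn => - (2 * pi * dotp z.2 z.1)).
  apply: measurableT_comp => //; apply: measurable_funM => //.
  exact: measurable_dotp2.
have mc := measurableT_comp (@measurable_cosR R) mph.
have ms := measurableT_comp (@measurable_sinR R) mph.
have k1 := measurableT_comp mu1 (@measurable_snd _ _ Rn Rn).
have k2 := measurableT_comp mu2 (@measurable_snd _ _ Rn Rn).
split.
  apply: (measurableT_comp (fine_measurable measurableT)).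
  apply: (@measurable_param _ _ _ n (fun z : Rn * Rn => complex.Re (u z.2 * cis (- (2 * pi * dotp z.2 z.1))))).
  by under eq_fun do rewrite ReM; apply: measurable_funB; apply: measurable_funM.
apply: (measurableT_comp (fine_measurable measurableT)).
apply: (@measurable_param _ _ _ n (fun z : Rn * Rn => complex.Im (u z.2 * cis (- (2 * pi * dotp z.2 z.1))))).
by under eq_fun do rewrite ImM; apply: measurable_funD; apply: measurable_funM.
Qed.

Lemma Re_sqn_le (z : C) : complex.Re z ^+ 2 <= sqn z.
Proof. by rewrite lerDl sqr_ge0. Qed.

Lemma autoc_le u z : L2 u -> `|complex.Re (autoc u z)| <= n2 u.
Proof.
move=> Lu; have u0 := n2_ge0 u.
rewrite -(@ler_pXn2r _ 2)// ?nnegrE// real_normK ?num_real//.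
apply: le_trans (Re_sqn_le _) _; apply: le_trans (cauchy_schwarz (L2_shift z Lu) Lu) _.
by rewrite n2_shift ?expr2//; case: Lu.
Qed.

Lemma autoc_continuous0 u (e : R) : L2 u -> 0 < e -> exists2 d : R, 0 < d &
  forall y : Rn, (forall i, `|y i 0| <= d) -> `|complex.Re (autoc u y) - n2 u| < e.
Proof.
move=> Lu e0; have u0 := n2_ge0 u; have u1 : 0 < n2 u + 1 by lra.
have [_ /(_ (e ^+ 2 / (n2 u + 1)))[|d d0 h]] := L2_translation Lu.
  by rewrite divr_gt0// exprn_gt0.
exists d => // y yd.
have Ly := L2_shift y Lu.
have : complex.Re (autoc u y) - n2 u = complex.Re (L2inner (fun x => u (y + x) - u x) u).
  under [X in L2inner X]eq_fun do rewrite -mulN1r.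
  by rewrite L2innerDl ?L2innerZl ?L2inner_self//; [rewrite !ReImE/=; ring|exact: L2Z].
move=> ->.
rewrite -(@ltr_pXn2r _ 2)// ?nnegrE ?ltW// real_normK ?num_real//.
apply: le_lt_trans (Re_sqn_le _) _.
apply: le_lt_trans (cauchy_schwarz (L2B Ly Lu) Lu) _.
have := h y yd; rewrite ltr_pdivlMr// => h2; apply: le_lt_trans h2.
by rewrite ler_wpM2l ?n2_ge0//; lra.
Qed.

End plancherel.

(** * The Plancherel identity for integrable functions in L^2 *)

Section plancherel.
Variables (R : realType) (n : nat).
Local Notation C := R[i].
Local Notation Rn := 'cV[R]_n.
Local Notation mu := (lebesgue_cV R n).
Local Notation rint f := (mu.-integrable setT (EFin \o f)).
Local Notation rint2 f := ((mu \x mu)%E.-integrable setT (EFin \o f)).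
Implicit Types (f g h u : Rn -> C).

Local Notation khat := (@cV_prod R (@bump_hat R) n).

Lemma prod_integrable2 (p q : Rn -> R) : rint p -> rint q ->
  rint2 (fun z => p z.1 * q z.2).
Proof.
move=> ip iq; have [mp po] := integrableP _ _ _ ip; have [mq qo] := integrableP _ _ _ iq.
have mp' : measurable_fun setT p by exact/measurable_EFinP.
have mq' : measurable_fun setT q by exact/measurable_EFinP.
pose F (z : Rn * Rn) : R := p z.1 * q z.2.
have m1 : measurable_fun setT F.
  by apply: measurable_funM; [exact: (measurableT_comp mp')|exact: (measurableT_comp mq')].
have m2 : measurable_fun setT (fun z : Rn * Rn => `|(F z)%:E|%E).
  by apply: measurableT_comp => //; exact/measurable_EFinP.
apply/integrableP; split; first exact/measurable_EFinP.
rewrite (@fubini_tonelli1 _ _ _ _ _ mu mu _ m2 (fun=> abse_ge0 _)).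
rewrite [ltLHS](_ : _ = (\int[mu]_x (`|(p x)%:E| * (\int[mu]_y `|(q y)%:E|))))%E; last first.
  apply: eq_integral => y _; rewrite /fubini_F /F.
  under eq_integral do rewrite /= normrM EFinM.
  by rewrite ge0_integralZl//; apply/measurable_EFinP; exact: measurableT_comp.
rewrite ge0_integralZr//.
- by rewrite lte_mul_pinfty// ?integral_ge0// ge0_fin_numE// integral_ge0.
- exact: measurableT_comp.
- exact: integral_ge0.
Qed.

Lemma integral_window (z : Rn) s :
  (\int[mu]_xi (cos (2 * pi * dotp z xi + s) * cV_prod (@bump R) xi)%:E)%E = (cos s * khat z)%:E.
Proof.
have [K KE] := integral_bump R.
apply: (integral_cos_cV_prod s (@measurable_bump R) (@bump_ge0 R) KE) => i s'.
exact: bump_hatE.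
Qed.

Lemma integrable_window : rint (@cV_prod R (@bump R) n).
Proof.
have [K KE] := integral_bump R.
exact: (integrable_cV_prod n (@measurable_bump R) (@bump_ge0 R) KE).
Qed.

Lemma khat_le (z : Rn) : `|khat z| <= cV_prod (@cauchy R) z.
Proof.
rewrite /cV_prod normr_prod; apply: ler_prod => i _.
by rewrite normr_ge0 bump_hat_le.
Qed.

Lemma measurable_cV_scale (r : R) : measurable_fun setT (fun x : Rn => r *: x).
Proof.
have := @measurable_mulmx_cV R n n r%:M.
by congr (measurable_fun _ _); apply/funext => x; rewrite mul_scalar_mx.
Qed.

Lemma measurable_khat : measurable_fun setT khat.
Proof.
have -> : khat = fine \o (fun z : Rn => (\int[mu]_xi (cos (2 * pi * dotp z xi + 0) * cV_prod (@bump R) xi)%:E)%E).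
  by apply/funext => z; rewrite /= integral_window cos0 mul1r.
apply: (measurableT_comp (fine_measurable measurableT)).
apply: (@measurable_param _ _ _ n (fun z : Rn * Rn => cos (2 * pi * dotp z.1 z.2 + 0) * cV_prod (@bump R) z.2)).
apply: measurable_funM.
  apply: (measurableT_comp (@measurable_cosR R)); apply: measurable_funD => //.
  by apply: measurable_funM => //; exact: measurable_dotp2.
exact: (measurableT_comp (@measurable_cV_prod _ _ n (@measurable_bump R)) (@measurable_snd _ _ Rn Rn)).
Qed.

Lemma integrable_cauchy : rint (@cV_prod R (@cauchy R) n).
Proof.
apply: (integrable_cV_prod n _ (@cauchy_ge0 R) (integral_cauchy R)).
by apply: continuous_measurable_fun; exact: continuous_cauchy.
Qed.

Lemma integrable_khat : rint khat.
Proof. exact: (rint_dom measurable_khat khat_le integrable_cauchy). Qed.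

Lemma khat_bound (z : Rn) : `|khat z| <= 16 ^+ n.
Proof.
apply: le_trans (khat_le z) _.
apply: le_trans (_ : \prod_(i < n) 16 <= _); last by rewrite prodr_const card_ord.
apply: ler_prod => i _; rewrite cauchy_ge0/= ler_pdivrMr.
  by rewrite ler_peMr// lerDl sqr_ge0.
by rewrite (@lt_le_trans _ _ 1)// lerDl sqr_ge0.
Qed.

Lemma scalar_unitmx (r : R) : r != 0 -> r%:M \in @unitmx R n.
Proof. by move=> r0; rewrite unitmxE det_scalar unitrX// unitfE. Qed.

(** The window makes the double integral of [sqn_fourier] absolutely convergent. Fubini replaces the
    window by its transform, concentrated at scale r as r tends to 0, and rescaling z by r moves
    that concentration into the argument of [autoc]. *)
Lemma fourier_window u (r : R) : r != 0 -> cintegrable u -> L2 u ->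
  (\int[mu]_xi (cV_prod (@bump R) (r *: xi) * sqn (fourier u xi))%:E)%E =
  (\int[mu]_z (complex.Re (autoc u (r *: z)) * khat z)%:E)%E.
Proof.
move=> r0 ui Lu; have [b1 b2] := autoc_integrable ui Lu.
have [c c0 [_ cP]] := integral_linear_change (scalar_unitmx r0).
have cP' (f : Rn -> R) : rint f -> rint (fun x => f (r *: x)) /\
    (\int[mu]_x (f (r *: x))%:E = c%:E * \int[mu]_x (f x)%:E)%E.
  move=> fi; have [i1 i2] := cP f fi; split.
    by move: i1; congr (_.-integrable _ _); apply/funext => x /=; rewrite mul_scalar_mx.
  rewrite -[X in (_ * X)%E]fineK; last exact: integrable_fin_num.
  rewrite -EFinM -i2 fineK; last exact: integrable_fin_num.
  by apply: eq_integral => x _; rewrite mul_scalar_mx.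
have [iW _] := cP' _ integrable_window.
pose F (p : Rn * Rn) : R := cV_prod (@bump R) (r *: p.1) *
   complex.Re (autoc u p.2 * cis (- (2 * pi * dotp p.2 p.1))).
have mF : measurable_fun setT F.
  have /measurable_EFinP mW := (integrableP _ _ _ iW).1.
  have [m1 m2] := cintegrable_cmeasurable (conj b1 b2).
  have mph : measurable_fun setT (fun z : Rn * Rn => - (2 * pi * dotp z.2 z.1)).
    apply: measurableT_comp => //; apply: measurable_funM => //.
    exact: measurable_dotp2.
  apply: measurable_funM; first exact: (measurableT_comp mW).
  under eq_fun do rewrite ReM.
  apply: measurable_funB; apply: measurable_funM.
  - exact: (measurableT_comp m1).
  - exact: (measurableT_comp (@measurable_cosR R) mph).
  - exact: (measurableT_comp m2).
  - exact: (measurableT_comp (@measurable_sinR R) mph).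
have ab (v : Rn -> R) : rint v -> rint (fun x => `|v x|) by move=> /integrable_abse.
have iF : rint2 F.
  have iP := prod_integrable2 iW (rintD (ab _ b1) (ab _ b2)).
  apply: le_integrable iP => //; first exact/measurable_EFinP.
  move=> p _; rewrite /= lee_fin /F !normrM ler_wpM2l//.
  rewrite ReM /= (ger0_norm (addr_ge0 (normr_ge0 _) (normr_ge0 _))).
  apply: le_trans (ler_normB _ _) _; rewrite !normrM.
  by rewrite lerD// ler_piMr// ler_norml ?cos_geN1 ?cos_le1 ?sin_geN1 ?sin_le1.
transitivity (\int[mu]_xi \int[mu]_z (F (xi, z))%:E)%E.
  apply: eq_integral => xi _; rewrite EFinM sqn_fourier// -integralZl//.
  have s1 z : sqn (cis (- (2 * pi * dotp z xi))) <= 1 by rewrite sqn_cis.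
  by have [] := cintegrableM_unit (conj b1 b2) (cmeasurable_cis (measurable_phase xi)) s1.
rewrite (@Fubini _ _ _ _ _ mu mu _ iF).
have K z s : (\int[mu]_xi (cV_prod (@bump R) (r *: xi) * cos (2 * pi * dotp z xi + s))%:E =
    (c * (cos s * khat (r^-1 *: z)))%:E)%E.
  have [K KE] := integral_bump R.
  have iw := integrable_cos_cV_prod (r^-1 *: z) s (@measurable_bump R) (@bump_ge0 R) KE.
  rewrite EFinM -integral_window -(cP' _ iw).2; apply: eq_integral => xi _.
  by rewrite dotpZl dotpZr mulKf// mulrC.
have iW' z s : rint (fun xi => cV_prod (@bump R) (r *: xi) * cos (2 * pi * dotp z xi + s)).
  have [K0 KE] := integral_bump R.
  have iw := integrable_cos_cV_prod (r^-1 *: z) s (@measurable_bump R) (@bump_ge0 R) KE.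
  have := (cP' _ iw).1; congr (_.-integrable _ _); apply/funext => xi /=.
  by rewrite dotpZl dotpZr mulKf// mulrC.
transitivity (\int[mu]_z (c%:E * (complex.Re (autoc u z) * khat (r^-1 *: z))%:E))%E.
  apply: eq_integral => z _.
  (* The imaginary part of [autoc] comes with a sine, written as a cosine of phase -pi/2; against
     the even window its integral is 0. *)
  transitivity (\int[mu]_xi ((complex.Re (autoc u z))%:E * (cV_prod (@bump R) (r *: xi) * cos (2 * pi * dotp z xi + 0))%:E
     + (complex.Im (autoc u z))%:E * (cV_prod (@bump R) (r *: xi) * cos (2 * pi * dotp z xi + - (pi / 2)))%:E))%E.
    apply: eq_integral => xi _; rewrite -!EFinM -EFinD; congr EFin.
    by rewrite /F cisN !ReImE /= addr0 cosBpihalf; ring.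
  have i1 := integrableZl measurableT (complex.Re (autoc u z)) (iW' z 0).
  have i2 := integrableZl measurableT (complex.Im (autoc u z)) (iW' z (- (pi / 2))).
  rewrite (integralD measurableT i1 i2).
  rewrite (integralZl measurableT (iW' z 0)) (integralZl measurableT (iW' z (- (pi / 2)))).
  rewrite /= !K cos0 cosN cos_pihalf -!EFinM -EFinD; congr EFin; ring.
have ik : rint (fun z => complex.Re (autoc u z) * khat (r^-1 *: z)).
  apply: (rint_dom _ _ (rintZ (16 ^+ n) (ab _ b1))).
    apply: measurable_funM; first by have /measurable_EFinP := (integrableP _ _ _ b1).1.
    exact: (measurableT_comp measurable_khat (measurable_cV_scale _)).
  by move=> z; rewrite normrM mulrC ler_wpM2r// khat_bound.
rewrite integralZl// -(cP' _ ik).2; apply: eq_integral => z _.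
by rewrite scalerA mulVf// scale1r.
Qed.

(** Dominated convergence: [autoc] is bounded by its value [n2 u] at 0 and continuous there. *)
Lemma autoc_khat_cvg u : cintegrable u -> L2 u ->
  ((\int[mu]_z (complex.Re (autoc u (k.+1%:R^-1 *: z)) * khat z)%:E) @[k --> \oo] -->
   ((\int[mu]_z khat z)%R * n2 u)%:E)%E.
Proof.
move=> ui Lu; have [b1 b2] := autoc_integrable ui Lu.
have ik := integrable_khat.
have mk := measurable_khat.
have /measurable_EFinP mb := (integrableP _ _ _ b1).1.
have -> : (((\int[mu]_z khat z)%R * n2 u)%:E = \int[mu]_z (n2 u * khat z)%:E)%E.
  under eq_integral do rewrite EFinM.
  rewrite integralZl// mulrC EFinM; congr (_ * _)%E; rewrite fineK//; exact: integrable_fin_num.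
have H := @dominated_cvg _ _ _ mu setT measurableT
  (fun k z => (complex.Re (autoc u (k.+1%:R^-1 *: z)) * khat z)%:E)
  (fun z => (n2 u * khat z)%:E) (fun z => (n2 u * `|khat z|)%:E).
apply: H => //.
- move=> k; apply/measurable_EFinP; apply: measurable_funM => //.
  exact: (measurableT_comp mb (measurable_cV_scale _)).
- move=> z _; apply: cvg_EFin; first by near=> k.
  apply: cvgM; last exact: cvg_cst.
  apply/cvgrPdist_lt => e e0; have [d d0 dP] := autoc_continuous0 Lu e0.
  have [k0 k0P] := cV_box_nat z.
  exists (Num.truncn (k0%:R / d)).+1 => // k /= kk0.
  rewrite distrC; apply: dP => i; rewrite mxE normrM normfV normr_nat.
  rewrite ler_pdivrMl ?ltr0n//.
  have zk : `|z i 0| <= k0%:R.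
    have := k0P k0 (leqnn _) i; rewrite /= in_itv/= => /andP[h1 h2].
    by rewrite ler_norml (ltW h1).
  apply: le_trans zk _; rewrite -ler_pdivrMr//.
  apply: ltW; apply: lt_trans (truncnS_gt _) _; rewrite ltr_nat ltnS.
  exact: kk0.
- apply: rintZ; exact: (integrable_abse ik).
- by move=> k z _; rewrite /= lee_fin normrM ler_wpM2r// autoc_le.
Unshelve. all: end_near. Qed.

Lemma window_nd (x : Rn) : {homo (fun k : nat => cV_prod (@bump R) (k.+1%:R^-1 *: x)) :
  k m / (k <= m)%N >-> k <= m}.
Proof.
move=> k m km; rewrite /cV_prod; apply: ler_prod => i _; rewrite bump_ge0/=.
rewrite /bump !mxE ge_max le_max lexx /= le_max; apply/orP; right.
rewrite lerD2l lerN2 !exprMn ler_wpM2r ?sqr_ge0//.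
by rewrite ler_pXn2r// ?nnegrE ?invr_ge0// lef_pV2 ?posrE ?ltr0n// ler_nat.
Qed.

Lemma window_cvg (x : Rn) : cV_prod (@bump R) (k.+1%:R^-1 *: x) @[k --> \oo] --> (1 : R).
Proof.
suff : cV_prod (@bump R) (k.+1%:R^-1 *: x) @[k --> \oo] --> \prod_(i < n) (1 : R).
  by rewrite [X in _ --> X]big1.
rewrite /cV_prod; elim: (index_enum _) => [|i s IH].
  by under eq_fun do rewrite big_nil; rewrite big_nil; exact: cvg_cst.
under eq_fun do rewrite big_cons; rewrite big_cons.
apply: cvgM => //.
have h : 1 - (k.+1%:R^-1 * x i 0) ^+ 2 @[k --> \oo] --> (1 : R).
  have : 1 - (k.+1%:R^-1 * x i 0) * (k.+1%:R^-1 * x i 0) @[k --> \oo] --> (1 - (0 * x i 0) * (0 * x i 0) : R).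
    by apply: cvgB; [exact: cvg_cst|apply: cvgM; apply: cvgM;
      [exact: cvg_harmonic|exact: cvg_cst|exact: cvg_harmonic|exact: cvg_cst]].
  by rewrite !mul0r subr0; apply: cvg_trans; apply: near_eq_cvg; near=> k; rewrite expr2.
have : Num.max (0 : R) (1 - (k.+1%:R^-1 * x i 0) ^+ 2) @[k --> \oo] --> (1 : R).
  have := cvgr_gt (1 : R) h; move=> /(_ _ 0 ltr01) hh.
  apply: cvg_trans h; apply: near_eq_cvg.
  by near=> k; rewrite max_r// ltW//; near: k.
by apply: cvg_trans; apply: near_eq_cvg; near=> k; rewrite /bump mxE.
Unshelve. all: end_near. Qed.

(* Monotone convergence on the left and dominated convergence on the right of
   [fourier_window], as r tends to 0. *)
Lemma plancherel_const u : cintegrable u -> L2 u ->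
  (N2 (fourier u) = ((\int[mu]_z khat z)%R * n2 u)%:E)%E.
Proof.
move=> ui Lu.
have mu1 := cmeasurable_fourier ui.
have [b1 b2] := autoc_integrable ui Lu.
pose g (k : nat) (xi : Rn) : \bar R := (cV_prod (@bump R) (k.+1%:R^-1 *: xi) * sqn (fourier u xi))%:E.
have g0 k xi : (0 <= g k xi)%E.
  by rewrite lee_fin mulr_ge0 ?sqn_ge0// prodr_ge0// => i _; exact: bump_ge0.
have mg k : measurable_fun setT (g k).
  apply/measurable_EFinP; apply: measurable_funM; last by apply/measurable_EFinP; exact: measurable_sqn.
  exact: (measurableT_comp (@measurable_cV_prod _ _ n (@measurable_bump R)) (measurable_cV_scale _)).
have ndg xi : setT xi -> {homo g^~ xi : k m / (k <= m)%N >-> (k <= m)%E}.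
  by move=> _ k m km; rewrite lee_fin ler_wpM2r ?sqn_ge0//; exact: window_nd.
have cv := @cvg_monotone_convergence _ _ _ mu _ measurableT g mg (fun k xi _ => g0 k xi) ndg.
have lg xi : limn (g^~ xi) = (sqn (fourier u xi))%:E.
  apply/cvg_lim => //; apply: cvg_EFin; first by near=> k.
  rewrite -[X in _ --> X]mul1r; apply: cvgM; last exact: cvg_cst.
  exact: window_cvg.
have cv' : ((\int[mu]_x g k x) @[k --> \oo] --> N2 (fourier u))%E.
  rewrite /N2; under eq_integral do rewrite -lg; exact: cv.
have cv2 := autoc_khat_cvg ui Lu.
apply: (cvg_unique _ cv') => //.
apply: cvg_trans cv2; apply: near_eq_cvg; near=> k.
by rewrite /g fourier_window// invr_eq0 pnatr_eq0.
Unshelve. all: end_near. Qed.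

End plancherel.

(** * Passage from integrable functions to Fourier pairs in L^2 *)

Section fourier_L2.
Variables (R : realType) (n : nat).
Local Notation C := R[i].
Local Notation Rn := 'cV[R]_n.
Local Notation mu := (lebesgue_cV R n).
Local Notation rint f := (mu.-integrable setT (EFin \o f)).
Implicit Types (f g h u : Rn -> C).

(** By Fourier inversion this is the value of the window at 0. Here it is known only through its
    positivity. *)
Definition plancherel_factor : R := \int[mu]_z @cV_prod R (@bump_hat R) n z.
Local Notation c := plancherel_factor.

Lemma n2_fourier u : cintegrable u -> L2 u -> L2 (fourier u) /\ n2 (fourier u) = c * n2 u.
Proof.
move=> ui Lu; have E := plancherel_const ui Lu.
by split; [split; [exact: cmeasurable_fourier|rewrite E ltry]|rewrite /n2 E].
Qed.

Lemma dotp_le (x y : Rn) (a b : R) : 0 <= a -> 0 <= b ->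
  (forall i, `|x i 0| <= a) -> (forall i, `|y i 0| <= b) -> `|dotp x y| <= n%:R * (a * b).
Proof.
move=> a0 b0 xa yb; apply: le_trans (ler_norm_sum _ _ _) _.
apply: le_trans (_ : \sum_(i < n) a * b <= _); last first.
  by rewrite sumr_const card_ord mulr_natl.
by apply: ler_sum => i _; rewrite normrM ler_pM.
Qed.

Lemma cos_gt_half : exists2 d : R, 0 < d & forall t : R, `|t| < d -> 1 / 2 < cos t.
Proof.
have /cvgrPdist_lt/(_ (1 / 2)) := @continuous_cos R 0; rewrite cos0.
case=> [|d /= d0 dP]; first by lra.
exists d => // t td; have /dP : ball (0 : R) d t by rewrite /ball/= sub0r normrN.
by rewrite ltr_norml => /andP[]; lra.
Qed.

(** One test function suffices: the transform of the indicator of the unit box has real part at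
    least 1/2 on a small box around 0, so its norm is positive. *)
Lemma plancherel_factor_gt0 : 0 < c.
Proof.
have mQ := @measurable_cV_box R n 0 1.
pose u : Rn -> C := cindic (cV_box 0 1).
have Lu : L2 u by apply: L2_cindic; rewrite // cV_box01 ltry.
have n2u : n2 u = 1 by rewrite /n2 N2_cindic// cV_box01.
have ui : cintegrable u.
  split; last first.
    have := @integrable0 _ _ R mu setT.
    by congr (_.-integrable _ _).
  have := rint_sqn Lu; congr (_.-integrable _ _); apply/funext => x /=.
  by rewrite sqn_cindic.
have E := plancherel_const ui Lu; rewrite n2u mulr1 -/c in E.
rewrite -lte_fin -E.
have [d d0 dP] := cos_gt_half.
have p0 := pi_gt0 R.
(* With [n.+1] in the denominator the phase stays strictly below d, and n = 0 is covered. *)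
pose b := d / (2 * pi * n.+1%:R).
have n0 : 0 < n.+1%:R :> R by rewrite ltr0n.
have b0 : 0 < b by rewrite divr_gt0// !mulr_gt0.
pose v : Rn -> C := fun x => (1 / 2)%:C * cindic (cV_box (- b) b) x.
have mB := @measurable_cV_box R n (- b) b.
have mv : cmeasurable v by apply: cmeasurableZ; exact: cmeasurable_cindic.
apply: (@lt_le_trans _ _ (N2 v)).
  rewrite N2Z; last exact: cmeasurable_cindic.
  rewrite N2_cindic// cV_boxE; last by lra.
  by rewrite -EFinM lte_fin mulr_gt0// ?exprn_gt0// ?sqnr ?exprn_gt0//; lra.
apply: le_N2 => //; first exact: cmeasurable_fourier.
move=> xi; rewrite sqnM sqn_cindic sqnr indicE.
case: (boolP (xi \in cV_box (- b) b)) => [/set_mem xiB|_]; rewrite ?mulr0 ?sqn_ge0// mulr1.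
apply: (le_trans _ (Re_sqn_le _)).
suff K : 1 / 2 <= complex.Re (fourier u xi).
  by rewrite ler_pXn2r ?nnegrE//; lra.
have [i1 _] := cintegrable_modulate xi ui.
have i2 := rintZ (1 / 2) (rint_sqn Lu).
rewrite (_ : 1 / 2 = \int[mu]_x (1 / 2 * sqn (u x))); last first.
  by rewrite RintegralZl// ?(rint_sqn Lu)// -n2E n2u mulr1.
apply: le_Rintegral => // x _; rewrite sqn_cindic indicE /u cindicE.
case: ifPn => [/set_mem xQ|_]; last by rewrite mul0r mulr0.
rewrite mulr1 ReM /= mul0r subr0 cosN [X in _ <= X]mul1r; apply/ltW/dP.
have h1 i : `|x i 0| <= 1.
  by have := xQ i; rewrite /= in_itv/= => /andP[? ?]; rewrite ler_norml; apply/andP; split; lra.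
have h2 i : `|xi i 0| <= b.
  by have := xiB i; rewrite /= in_itv/= => /andP[? ?]; rewrite ler_norml; apply/andP; split; lra.
have h3 := dotp_le ler01 (ltW b0) h1 h2.
rewrite !normrM (ger0_norm (ltW p0)) normr_nat.
apply: le_lt_trans (_ : 2 * pi * (n%:R * (1 * b)) < _).
  by rewrite ler_wpM2l// mulr_ge0// ltW.
rewrite mul1r (_ : _ * _ = d * (n%:R / n.+1%:R)); last first.
  rewrite /b; have := lt0r_neq0 p0; have := lt0r_neq0 n0.
  by move: (pi : R) (n.+1%:R : R) => p m m0 p0'; field; rewrite m0 p0'.
by rewrite gtr_pMr// ltr_pdivrMr// mul1r ltr_nat.
Qed.

(* [is_fourier_L2] with an approximation up to [e] instead of a sequence. *)
Definition fourier_pair f F := [/\ L2 f, L2 F & forall e : R, 0 < e -> exists u,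
  [/\ cintegrable u, L2 u, n2 (fun x => u x - f x) < e & n2 (fun xi => fourier u xi - F xi) < e]].

Lemma cLp1_cintegrable u : cLp 1%:E u -> cintegrable u.
Proof.
move=> [[m1 m2]]; rewrite /cLnorm Lnorm1 => uo.
have m12 : measurable_fun setT (fun x => ComplexField.Normc.normc (u x)).
  have -> : (fun x => ComplexField.Normc.normc (u x)) = (fun x => Num.sqrt (sqn (u x))).
    by apply/funext => x; rewrite -normc_sqr sqrtr_sqr ger0_norm//; case: (u x) => a b; exact: sqrtr_ge0.
  apply: (measurableT_comp (f := @Num.sqrt R)).
    by apply: continuous_measurable_fun; exact: sqrt_continuous.
  by apply/measurable_EFinP; exact: measurable_sqn.
have i12 : rint (fun x => ComplexField.Normc.normc (u x)).
  by apply/integrableP; split; first exact/measurable_EFinP.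
split; apply: (rint_dom _ _ i12) => // x; case: (u x) => a b /=;
  by rewrite -sqrtr_sqr ler_wsqrtr// ?lerDl ?lerDr sqr_ge0.
Qed.

Lemma cLnorm2_cvg0 (F : nat -> Rn -> C) : (cLnorm 2%:E (F k) @[k --> \oo] --> 0)%E ->
  forall e : R, 0 < e -> exists k0, forall k, (k0 <= k)%N -> (N2 (F k) < e%:E)%E.
Proof.
move=> cF e e0.
have /fine_cvgP[ffin cF'] : (cLnorm 2%:E (F k) @[k --> \oo] --> (0:R)%:E)%E by [].
have s0 : 0 < Num.sqrt e by rewrite sqrtr_gt0.
have /cvgrPdist_lt/(_ _ s0) H := cF'.
have [k0 _ k0P] : \forall k \near \oo, (cLnorm 2%:E (F k) < (Num.sqrt e)%:E)%E.
  near=> k; have ff : cLnorm 2%:E (F k) \is a fin_num by near: k.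
  rewrite -(fineK ff) lte_fin; apply: le_lt_trans (ler_norm _) _.
  by rewrite -normrN -[X in `|X|]sub0r; near: k.
exists k0 => k kk0; have := k0P k kk0; rewrite /= cLnorm2_lt ?sqrtr_ge0//.
by rewrite sqr_sqrtr// ltW.
Unshelve. all: end_near. Qed.

Lemma is_fourier_pair f F : is_fourier_L2 f F -> fourier_pair f F.
Proof.
move=> [/cLp2E Lf /cLp2E LF [u [uL uf uF]]]; split => // e e0.
have [k1 k1P] := cLnorm2_cvg0 uf e0; have [k2 k2P] := cLnorm2_cvg0 uF e0.
pose k := maxn k1 k2; exists (u k).
have [/cLp1_cintegrable ui /cLp2E Lu] := uL k.
have [LFu _] := n2_fourier ui Lu.
split => //.
  by rewrite -lte_fin (L2_fin (L2B Lu Lf)); apply: k1P; exact: leq_maxl.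
by rewrite -lte_fin (L2_fin (L2B LFu LF)); apply: k2P; exact: leq_maxr.
Qed.

Lemma n2_close f g (e : R) : 0 < e -> L2 f -> exists2 d : R, 0 < d &
  forall g, L2 g -> n2 (fun x => g x - f x) < d -> `|n2 g - n2 f| < e.
Proof.
move=> e0 Lf; have f0 := n2_ge0 f.
have f1 : 0 < n2 f + 1 by lra.
pose d := Num.min (e / 2) (e ^+ 2 / 16 / (n2 f + 1)).
exists d; first by rewrite lt_min !divr_gt0// exprn_gt0.
move=> h Lh; rewrite lt_min => /andP[h1 h2].
have Ld := L2B Lh Lf.
have -> : n2 h - n2 f = n2 (fun x => h x - f x) + 2 * complex.Re (L2inner f (fun x => h x - f x)).
  have := n2D Lf Ld; rewrite (_ : (fun x => f x + (h x - f x)) = h); last first.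
    by apply/funext => x; rewrite addrC subrK.
  by move=> ->; ring.
have d0 := n2_ge0 (fun x => h x - f x).
have K : `|complex.Re (L2inner f (fun x => h x - f x))| < e / 4.
  rewrite -(@ltr_pXn2r _ 2)// ?nnegrE//; last by lra.
  rewrite real_normK ?num_real//; apply: le_lt_trans (Re_sqn_le _) _.
  apply: le_lt_trans (cauchy_schwarz Lf Ld) _.
  move: h2; rewrite ltr_pdivlMr// => h2.
  rewrite exprMn exprVn (_ : 4 ^+ 2 = 16); last by ring.
  apply: le_lt_trans h2; rewrite mulrC ler_wpM2l//; lra.
by move: K; rewrite !ltr_norml => /andP[? ?]; apply/andP; split; lra.
Qed.

Lemma n2_fourier_pair f F : fourier_pair f F -> n2 F = c * n2 f.
Proof.
move=> [Lf LF H]; apply/eqP; rewrite -subr_eq0 -normr_le0 leNgt; apply/negP => e0.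
have c0 := plancherel_factor_gt0.
set e := `|_| in e0.
have e20 : 0 < e / 2 by lra.
have e3 : 0 < e / 2 / c by rewrite divr_gt0.
have [d1 d10 d1P] := n2_close f e3 Lf; have [d2 d20 d2P] := n2_close F e20 LF.
have [|u [ui Lu uf uF]] := H (Num.min d1 d2); first by rewrite lt_min d10.
have [LFu nFu] := n2_fourier ui Lu.
have k1 : `|n2 u - n2 f| < e / 2 / c by apply: d1P => //; apply: lt_le_trans uf _; rewrite ge_min lexx.
have k2 : `|n2 (fourier u) - n2 F| < e / 2 by apply: d2P => //; apply: lt_le_trans uF _; rewrite ge_min lexx orbT.
have : e <= `|n2 (fourier u) - n2 F| + c * `|n2 u - n2 f|.
  rewrite -[X in X * _](gtr0_norm c0) -normrM nFu -normrN.
  by apply: le_trans (ler_normD _ _); rewrite /e le_eqVlt; apply/orP; left; apply/eqP; congr (`|_|); ring.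
apply/negP; rewrite -ltNge.
move: k1; rewrite ltr_pdivlMr// mulrC => k1; lra.
Qed.

End fourier_L2.

(** * The Fourier transform, translations and dilations *)

Section fourier_closure.
Variables (R : realType) (n : nat).
Local Notation C := R[i].
Local Notation Rn := 'cV[R]_n.
Local Notation mu := (lebesgue_cV R n).
Local Notation rint f := (mu.-integrable setT (EFin \o f)).
Local Notation fourier_pair := (@fourier_pair R n).
Local Notation c := (plancherel_factor R n).
Implicit Types (f g h u F G : Rn -> C).

Lemma Rintegral_cV_shift (y : Rn) (p : Rn -> R) : rint p ->
  rint (fun x => p (y + x)) /\ \int[mu]_x p (y + x) = \int[mu]_x p x.
Proof.
move=> ip; have [mp po] := integrableP _ _ _ ip.
have msh := @measurable_cV_add R n y.
have E (f : Rn -> \bar R) : measurable_fun setT f -> (forall x, 0 <= f x)%E ->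
    (\int[mu]_z f (y + z)%R = \int[mu]_x f x)%E.
  exact: ge0_integral_cV_shift.
have i2 : rint (fun x => p (y + x)).
  apply/integrableP; split; first exact: measurableT_comp mp msh.
  by rewrite (E (fun x => `|(p x)%:E|%E))//; exact: measurableT_comp.
split => //; congr fine.
rewrite [LHS]integralE [RHS]integralE -[X in _ = (X - _)%E]E//; last exact: measurable_funepos.
rewrite -[X in _ = (_ - X)%E]E//; last exact: measurable_funeneg.
by congr (_ - _)%E; apply: eq_integral => x _; rewrite ?(funeposE, funenegE).
Qed.

Lemma cintegral_shift (y : Rn) f : cintegrable f ->
  cintegrable (fun x => f (y + x)) /\ cintegral (fun x => f (y + x)) = cintegral f.
Proof.
move=> [f1 f2]; have [i1 e1] := Rintegral_cV_shift y f1; have [i2 e2] := Rintegral_cV_shift y f2.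
by split => //; apply: complex_ext.
Qed.

Lemma cintegral_linear_change (P : 'M[R]_n) : P \in unitmx -> exists2 d : R, 0 < d &
  (forall f, cintegrable f -> cintegrable (fun x => f (P *m x)) /\
     cintegral (fun x => f (P *m x)) = d%:C * cintegral f) /\
  (forall f, cmeasurable f -> N2 (fun x => f (P *m x)) = (d%:E * N2 f)%E).
Proof.
move=> uP; have [d d0 [dP dI]] := integral_linear_change uP; exists d => //; split.
  move=> f [f1 f2]; have [i1 e1] := dI _ f1; have [i2 e2] := dI _ f2.
  by split => //; apply: complex_ext; rewrite ?ReImE /= ?mul0r ?subr0 ?addr0.
move=> f mf; apply: (dP (fun x => (sqn (f x))%:E)); first exact: measurable_sqn.
by move=> x; rewrite lee_fin sqn_ge0.
Qed.

Lemma cmeasurable_linear (P : 'M[R]_n) f : cmeasurable f -> cmeasurable (fun x => f (P *m x)).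
Proof. by apply: cmeasurable_comp; exact: measurable_mulmx_cV. Qed.

Lemma cintegrableD f g : cintegrable f -> cintegrable g -> cintegrable (fun x => f x + g x).
Proof.
move=> [f1 f2] [g1 g2]; split.
  by under [X in EFin \o X]eq_fun do rewrite ReD; exact: rintD.
by under [X in EFin \o X]eq_fun do rewrite ImD; exact: rintD.
Qed.

Lemma cintegrableZ (z : C) f : cintegrable f -> cintegrable (fun x => z * f x).
Proof.
move=> [f1 f2]; split.
  by under [X in EFin \o X]eq_fun do rewrite ReM; apply: rintB; exact: rintZ.
by under [X in EFin \o X]eq_fun do rewrite ImM; apply: rintD; exact: rintZ.
Qed.

Lemma fourierD f g xi : cintegrable f -> cintegrable g ->
  fourier (fun x => f x + g x) xi = fourier f xi + fourier g xi.
Proof.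
move=> fi gi; rewrite /fourier -cintegralD; try exact: cintegrable_modulate.
by congr cintegral; apply/funext => x; rewrite mulrDl.
Qed.

Lemma fourierZ (z : C) f xi : cintegrable f ->
  fourier (fun x => z * f x) xi = z * fourier f xi.
Proof.
move=> fi; rewrite /fourier -cintegralZ; last exact: cintegrable_modulate.
by congr cintegral; apply/funext => x; rewrite mulrA.
Qed.

Lemma fourier_pairD f g F G : fourier_pair f F -> fourier_pair g G ->
  fourier_pair (fun x => f x + g x) (fun x => F x + G x).
Proof.
move=> [Lf LF hf] [Lg LG hg]; split; [exact: L2D|exact: L2D|move=> e e0].
have e4 : 0 < e / 4 by lra.
have [u [ui Lu uf uF]] := hf _ e4; have [v [vi Lv vg vG]] := hg _ e4.
have [LFu _] := n2_fourier ui Lu; have [LFv _] := n2_fourier vi Lv.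
exists (fun x => u x + v x); split; [exact: cintegrableD|exact: L2D| |].
  under eq_fun do rewrite opprD addrACA.
  by apply: le_lt_trans (n2D_le (L2B Lu Lf) (L2B Lv Lg)) _; lra.
under eq_fun do rewrite fourierD// opprD addrACA.
by apply: le_lt_trans (n2D_le (L2B LFu LF) (L2B LFv LG)) _; lra.
Qed.

Lemma fourier_pairZ (z : C) f F : fourier_pair f F -> fourier_pair (fun x => z * f x) (fun x => z * F x).
Proof.
move=> [Lf LF hf]; split; [exact: L2Z|exact: L2Z|move=> e e0].
have s0 : 0 < sqn z + 1 by have := sqn_ge0 z; lra.
have [u [ui Lu uf uF]] := hf _ (divr_gt0 e0 s0).
have [LFu _] := n2_fourier ui Lu.
have K w : w < e / (sqn z + 1) -> 0 <= w -> sqn z * w < e.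
  rewrite ltr_pdivlMr// => h w0; apply: le_lt_trans h.
  by rewrite mulrC ler_wpM2l//; lra.
exists (fun x => z * u x); split; [exact: cintegrableZ|exact: L2Z| |].
  under eq_fun do rewrite -mulrBr.
  by rewrite n2Z ?K ?n2_ge0//; exact: L2B.
under eq_fun do rewrite fourierZ// -mulrBr.
by rewrite n2Z ?K ?n2_ge0//; exact: L2B.
Qed.

Lemma dotpNl (x y : Rn) : dotp (- x) y = - dotp x y.
Proof. by rewrite dotpC dotpNr dotpC. Qed.

Lemma fourier_translation y u xi : cintegrable u ->
  fourier (translation y u) xi = cis (- (2 * pi * dotp y xi)) * fourier u xi.
Proof.
move=> ui; rewrite /fourier.
have [_ <-] := cintegral_shift (- y) (cintegrable_modulate xi ui).
rewrite -cintegralZ; last by have [] := cintegral_shift (- y) (cintegrable_modulate xi ui).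
congr cintegral; apply/funext => x; rewrite /modulate /translation mulrCA [- y + x]addrC; congr (_ * _).
by rewrite -cisD; congr cis; rewrite dotpDl dotpNl; ring.
Qed.

Lemma translationE y f : translation y f = (fun x => f (- y + x)).
Proof. by apply/funext => x; rewrite /translation addrC. Qed.

Lemma n2_phase F (v : Rn -> R) : n2 (fun x => cis (v x) * F x) = n2 F.
Proof. by rewrite /n2 /N2; under eq_integral do rewrite sqnM sqn_cis mul1r. Qed.

Lemma L2_phase F (v : Rn -> R) : measurable_fun setT v -> L2 F -> L2 (fun x => cis (v x) * F x).
Proof.
move=> mv LF; apply: (le_L2 _ LF) => [|x]; last by rewrite sqnM sqn_cis mul1r.
by apply: cmeasurableM; [exact: cmeasurable_cis|case: LF].
Qed.

Lemma fourier_pair_translation y f F : fourier_pair f F ->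
  fourier_pair (translation y f) (fun xi => cis (- (2 * pi * dotp y xi)) * F xi).
Proof.
have mph : measurable_fun setT (fun xi : Rn => - (2 * pi * dotp y xi)).
  apply: measurableT_comp => //; apply: measurable_funM => //.
  exact: measurable_dotp.
move=> [Lf LF hf]; split; [by rewrite translationE; exact: L2_shift|exact: L2_phase|move=> e e0].
have [u [ui Lu uf uF]] := hf _ e0.
have [LFu _] := n2_fourier ui Lu.
exists (translation y u); rewrite !translationE; split.
- by have [] := cintegral_shift (- y) ui.
- exact: L2_shift.
- by rewrite (n2_shift (- y) (proj1 (L2B Lu Lf))).
- rewrite -translationE; under eq_fun do rewrite fourier_translation// -mulrBr.
  by rewrite n2_phase.
Qed.

Lemma dotp_mulmx (M : 'M[R]_n) (x y : Rn) : dotp (M *m x) y = dotp x (M^T *m y).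
Proof.
rewrite /dotp.
transitivity (\sum_i \sum_j M i j * x j 0 * y i 0).
  by apply: eq_bigr => i _; rewrite mxE mulr_suml.
rewrite exchange_big; apply: eq_bigr => j _ /=; rewrite mxE mulr_sumr.
by apply: eq_bigr => i _; rewrite mxE; ring.
Qed.

(** The pairing of x and xi equals that of P x and the transposed inverse of P applied to xi, which
    gives the matrix on the frequency side. *)
Lemma fourier_pair_dilation (P : 'M[R]_n) : P \in unitmx -> exists2 k : R, 0 < k &
  forall f F, fourier_pair f F -> fourier_pair (dilation P f) (fun xi => k%:C * F ((invmx P)^T *m xi)).
Proof.
move=> uP; have [d d0 [dI dN]] := cintegral_linear_change uP.
have uQ : (invmx P)^T \in unitmx by rewrite unitmx_tr unitmx_inv.
have [d' d'0 [_ dN']] := cintegral_linear_change uQ.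
pose s := Num.sqrt `|\det P|.
have s0 : 0 < s.
  by rewrite sqrtr_gt0 normr_gt0 -unitfE -unitmxE.
have FP u xi : cintegrable u -> fourier (dilation P u) xi = (s * d)%:C * fourier u ((invmx P)^T *m xi).
  move=> ui; rewrite /fourier /dilation.
  have iu := cintegrable_modulate ((invmx P)^T *m xi) ui.
  rewrite rmorphM/= -mulrA; have [i1 <-] := dI _ iu.
  rewrite -cintegralZ//; congr cintegral; apply/funext => x.
  by rewrite /modulate -dotp_mulmx mulKmx// [RHS]mulrA.
have n2P f : L2 f -> L2 (fun x => f (P *m x)) /\ n2 (fun x => f (P *m x)) = d * n2 f.
  move=> Lf; have [mf _] := Lf.
  rewrite /n2 /L2 dN// -L2_fin//; split => //; split; first exact: cmeasurable_linear.
  by rewrite ltry.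
have n2Q f : L2 f -> L2 (fun x => f ((invmx P)^T *m x)) /\ n2 (fun x => f ((invmx P)^T *m x)) = d' * n2 f.
  move=> Lf; have [mf _] := Lf.
  rewrite /n2 /L2 dN'// -L2_fin//; split => //; split; first exact: cmeasurable_linear.
  by rewrite ltry.
have k0 : 0 < s * d by rewrite mulr_gt0.
exists (s * d) => // f F [Lf LF hf]; split.
- by apply: L2Z; have [] := n2P _ Lf.
- by apply: L2Z; have [] := n2Q _ LF.
move=> e e0.
(* The factors by which the dilation multiplies the squared errors in space and in frequency. *)
pose M1 := s ^+ 2 * d; pose M2 := (s * d) ^+ 2 * d'.
have M10 : 0 < M1 by rewrite mulr_gt0// exprn_gt0.
have M20 : 0 < M2 by rewrite mulr_gt0// exprn_gt0.
have M0 : 0 < M1 + M2 by rewrite addr_gt0.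
have [u [ui Lu uf uF]] := hf _ (divr_gt0 e0 M0).
have [LFu _] := n2_fourier ui Lu.
have K1 w : w < e / (M1 + M2) -> 0 <= w -> M1 * w < e.
  rewrite ltr_pdivlMr// => h w0; apply: le_lt_trans h; rewrite mulrC ler_wpM2l//; lra.
have K2 w : w < e / (M1 + M2) -> 0 <= w -> M2 * w < e.
  rewrite ltr_pdivlMr// => h w0; apply: le_lt_trans h; rewrite mulrC ler_wpM2l//; lra.
exists (dilation P u); split.
- by apply: cintegrableZ; have [] := dI _ ui.
- by apply: L2Z; have [] := n2P _ Lu.
- rewrite /dilation; under eq_fun do rewrite -mulrBr.
  have [L1 e1] := n2P _ (L2B Lu Lf).
  by rewrite n2Z// e1 sqnr mulrA K1// n2_ge0.
- under eq_fun do rewrite FP// -mulrBr.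
  have [L1 e1] := n2Q _ (L2B LFu LF).
  by rewrite n2Z// e1 sqnr mulrA K2// n2_ge0.
Qed.

(** Polarization of [n2_fourier_pair]; the imaginary part follows from the real one applied to i
    g. *)
Lemma L2inner_fourier_pair f g F G : fourier_pair f F -> fourier_pair g G -> L2inner F G = c%:C * L2inner f g.
Proof.
move=> hf hg; have [Lf LF _] := hf; have [Lg LG _] := hg.
have KR f' g' F' G' : fourier_pair f' F' -> fourier_pair g' G' ->
    complex.Re (L2inner F' G') = c * complex.Re (L2inner f' g').
  move=> hf' hg'; have [Lf' LF' _] := hf'; have [Lg' LG' _] := hg'.
  rewrite !Re_L2inner// (n2_fourier_pair hf') (n2_fourier_pair hg') (n2_fourier_pair (fourier_pairD hf' hg')); ring.
apply: complex_ext.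
  by rewrite ReM (KR _ _ _ _ hf hg) /= mul0r subr0.
by rewrite ImM Im_L2inner// (KR _ _ _ _ hf (fourier_pairZ 'i%C hg)) -Im_L2inner//= mul0r addr0.
Qed.

End fourier_closure.

(** * Bessel's inequality at one scale *)

Section exponentials.
Variables (R : realType) (n : nat).
Local Notation C := R[i].
Local Notation Rn := 'cV[R]_n.
Local Notation mu := (lebesgue_cV R n).
Local Notation leb := (@lebesgue_measure R).
Implicit Types (f g h u F G : Rn -> C).
Variable M : nat.
Hypothesis M0 : (0 < M)%N.

Definition segment (t : R) : R := \1_(`[- M%:R, M%:R]%classic) t.

Definition cube : set Rn := [set x | forall i, - M%:R <= x i 0 <= M%:R].

Lemma measurable_segment : measurable_fun setT (segment : measurableTypeR R -> measurableTypeR R).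
Proof. by apply: measurable_indic; exact: measurable_itv. Qed.

Lemma segment_ge0 t : 0 <= segment t. Proof. by []. Qed.

Lemma integral_segment : (\int[leb]_t (segment t)%:E = (2 * M%:R)%:E)%E.
Proof.
rewrite /segment integral_indic// setIT.
have : (leb `[(- M%:R)%R, (M%:R)%R]%classic = (2 * M%:R)%:E)%E; last by [].
have M0' : 0 < M%:R :> R by rewrite ltr0n.
rewrite lebesgue_measure_itv/= lte_fin ifT; last by lra.
by rewrite -EFinB; congr EFin; ring.
Qed.

Lemma integrable_segment : leb.-integrable setT (EFin \o segment).
Proof.
apply/integrableP; split; first by apply/measurable_EFinP; exact: measurable_segment.
by under eq_integral do rewrite /= ger0_norm//; rewrite integral_segment ltry.
Qed.

Lemma cV_prod_segment (x : Rn) : cV_prod segment x = \1_cube x.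
Proof.
rewrite indicE; case: (boolP (x \in cube)) => [/set_mem xQ|xQ].
  rewrite /cV_prod big1// => i _; rewrite /segment indicE mem_set//=.
  by rewrite in_itv/=; exact: xQ.
have [i xi] : exists i, ~~ (- M%:R <= x i 0 <= M%:R).
  apply: contrapT => h; move/negP: xQ; apply; apply: mem_set => i.
  by apply: contrapT => /negP hi; apply: h; exists i.
rewrite /cV_prod (bigD1 i)//= /segment indicE memNset ?mul0r//=.
by rewrite in_itv/=; exact/negP.
Qed.

Lemma measurable_cube : measurable cube.
Proof.
rewrite (_ : cube = [set x : Rn | forall i, `[- M%:R, M%:R]%classic (x i 0)]).
  by apply: (@measurable_cV_forall _ _ (fun=> `[- M%:R, M%:R]%classic)) => i; exact: measurable_itv.
by apply/seteqP; split => x h i; have := h i; rewrite /= in_itv.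
Qed.

Definition int_cV (k : 'cV[int]_n) : Rn := map_mx intr k.

Lemma integral_cube_cos (k : 'cV[int]_n) s :
  (\int[mu]_x (cos (2 * pi * dotp (int_cV k) x + s) * \1_cube x)%:E)%E =
  (cos s * ((2 * M%:R) ^+ n * (k == 0)%:R))%:E.
Proof.
pose h (x : R) := if x == 0 then 2 * M%:R else 0 : R.
under eq_integral do rewrite -cV_prod_segment.
rewrite (@integral_cos_cV_prod R segment h n (2 * M%:R) _ _ measurable_segment segment_ge0 integral_segment).
  congr (_ * _)%:E; rewrite /cV_prod; have [->|k0] := eqVneq k 0.
    rewrite mulr1 -[in RHS](card_ord n) -prodr_const; apply: eq_bigr => i _.
    by rewrite !mxE /h eqxx.
  have [i ki] : exists i, k i 0 != 0.
    apply: contrapT => H; move/eqP: k0; apply; apply/matrixP => i j; rewrite (ord1 j) mxE.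
    by apply: contrapT => /eqP ki; apply: H; exists i.
  by rewrite mulr0 (bigD1 i)//= /h mxE intr_eq0 (negbTE ki) mul0r.
move=> i s'; rewrite mxE /h intr_eq0.
have [->|ki] := eqVneq (k i 0) 0.
  under eq_integral do rewrite mulr0 mul0r add0r EFinM.
  rewrite integralZl// ?integral_segment// ?EFinM//; last exact: integrable_segment.
rewrite mulr0 -[RHS](@integral_cos_period R (k i 0) M s')// [RHS]integral_mkcond.
apply: eq_integral => t _; rewrite patchE /segment indicE.
by case: ifP => _; rewrite ?mulr1 ?mulr0.
Qed.

(** Integer frequencies on a cube of integer side 2 M: orthogonal, which is all that Bessel's
    inequality asks of them. *)
Definition wave (k : 'cV[int]_n) (x : Rn) : C :=
  cis (- (2 * pi * dotp (int_cV k) x)) * cindic cube x.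

Lemma cube_fin : (mu cube < +oo)%E.
Proof.
have := integral_cV_prod n measurable_segment segment_ge0 integral_segment.
under eq_integral do rewrite cV_prod_segment.
by rewrite integral_indic ?setIT; [move=> ->; rewrite ltry|exact: measurableT|exact: measurable_cube].
Qed.

Lemma L2_wave k : L2 (wave k).
Proof.
apply: L2_phase; last exact: (L2_cindic measurable_cube cube_fin).
apply: measurableT_comp => //; apply: measurable_funM => //; exact: measurable_dotp.
Qed.

Lemma int_cVB k k' : int_cV (k - k') = int_cV k - int_cV k'.
Proof. by apply/matrixP => i j; rewrite !mxE rmorphB. Qed.

Lemma L2inner_wave k k' : L2inner (wave k) (wave k') = (((2 * M%:R) ^+ n) * (k == k')%:R)%:C.
Proof.
have W x : wave k x * (wave k' x)^* = cis (- (2 * pi * dotp (int_cV (k - k')) x)) * (\1_cube x : R)%:C.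
  rewrite /wave conjCM (_ : (cindic cube x)^* = cindic cube x); last by rewrite /cindic conjCr.
  rewrite (_ : (\1_cube x : R)%:C = cindic cube x * cindic cube x); last first.
    by rewrite cindicE indicE; case: ifP; rewrite ?mulr1 ?mulr0.
  rewrite -cisN mulrACA -cisD; congr (cis _ * _); rewrite opprK int_cVB dotpDl dotpNl; ring.
have [e1 e2] := cintegral_EFin (cintegrableM (L2_wave k) (L2_wave k')).
apply: complex_ext; apply: EFin_inj; rewrite /L2inner ?e1 ?e2.
  transitivity ((cos 0 * ((2 * M%:R) ^+ n * (k - k' == 0)%:R))%:E : \bar R).
    rewrite -integral_cube_cos; apply: eq_integral => x _.
    by rewrite W ReM /= addr0 cosN mulr0 subr0.
  by rewrite cos0 mul1r subr_eq0.
(* The imaginary part is a cosine integral of phase pi/2. *)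
transitivity ((cos (pi / 2) * ((2 * M%:R) ^+ n * (k - k' == 0)%:R))%:E : \bar R).
  rewrite -integral_cube_cos; apply: eq_integral => x _.
  by rewrite W ImM /= sinN cosDpihalf mulr0 add0r.
by rewrite cos_pihalf mul0r.
Qed.

Lemma wave_bessel (s : seq 'cV[int]_n) f : uniq s -> L2 f ->
  \sum_(k <- s) sqn (L2inner f (wave k)) <= (2 * M%:R) ^+ n * n2 f.
Proof.
apply: (bessel _ L2_wave L2inner_wave).
by rewrite exprn_gt0// mulr_gt0// ltr0n.
Qed.

(** Substituting x = T xi turns the coefficients of one scale into those of h(x) = F(T^-1 x) g(x)^*
    against the exponentials on the cube that carries g. The smallness of g where F lives passes to
    the norm of h, uniformly in the number of coefficients. *)
Lemma level_bessel (T : 'M[R]_n) (k0 : R) g : T \in unitmx -> cmeasurable g ->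
  (forall x, ~ cube x -> g x = 0) ->
  exists2 K : R, 0 < K & forall F (d : R), L2 F -> 0 <= d ->
    (forall xi, F xi != 0 -> sqn (g (T *m xi)) <= d) ->
    forall s : seq 'cV[int]_n, uniq s ->
    \sum_(k <- s) sqn (L2inner F (fun xi => k0%:C *
       (cis (- (2 * pi * dotp (int_cV k) (T *m xi))) * g (T *m xi)))) <= K * (d * n2 F).
Proof.
move=> uT mg gc.
have [a a0 [aI aN]] := cintegral_linear_change uT.
have uT' : invmx T \in unitmx by rewrite unitmx_inv.
have [b b0 [_ bN]] := cintegral_linear_change uT'.
pose K := (k0 ^+ 2 + 1) * a ^+ 2 * (2 * M%:R) ^+ n * b.
have m0 : 0 < (2 * M%:R) ^+ n :> R by rewrite exprn_gt0// mulr_gt0// ltr0n.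
have k1 : 0 < k0 ^+ 2 + 1 by have := sqr_ge0 k0; lra.
exists K; first by rewrite !mulr_gt0// exprn_gt0.
move=> F d LF d0 Fd s us; have [mF _] := LF.
pose h x : C := F (invmx T *m x) * (g x)^*.
have mh : cmeasurable h.
  by apply: cmeasurableM; [exact: cmeasurable_linear|exact: cmeasurableJ].
have LFT : L2 (fun x => F (invmx T *m x)).
  by split; [exact: cmeasurable_linear|rewrite bN// -L2_fin// ltry].
have nFT : n2 (fun x => F (invmx T *m x)) = b * n2 F by rewrite /n2 bN// -L2_fin.
have hle x : sqn (h x) <= sqn ((Num.sqrt d)%:C * F (invmx T *m x)).
  rewrite /h !sqnM sqnJ sqnr sqr_sqrtr// mulrC.
  have [->|F0] := eqVneq (F (invmx T *m x)) 0; first by rewrite sqn0 !mulr0.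
  rewrite ler_wpM2r ?sqn_ge0//.
  by have := Fd _ F0; rewrite mulKVmx.
have Ld : L2 (fun x => (Num.sqrt d)%:C * F (invmx T *m x)) by exact: L2Z.
have Lh : L2 h by exact: le_L2 hle.
have nh : n2 h <= d * (b * n2 F).
  by apply: le_trans (le_n2 mh Ld hle) _; rewrite n2Z// sqnr sqr_sqrtr// nFT.
have E k : L2inner F (fun xi => k0%:C * (cis (- (2 * pi * dotp (int_cV k) (T *m xi))) * g (T *m xi)))
   = (k0 * a)%:C * L2inner h (wave k).
  have [i1 e1] := aI _ (cintegrableM Lh (L2_wave k)).
  rewrite rmorphM/= -mulrA -e1 -cintegralZ//; congr cintegral; apply/funext => xi.
  rewrite /h mulKmx// /wave !conjCM conjCr (_ : (cindic _ _)^* = cindic cube (T *m xi)); last by rewrite /cindic conjCr.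
  rewrite cindicE; case: ifPn => [_|/negP nc]; first by ring.
  by rewrite gc ?conjC0 ?mulr0 ?mul0r ?mulr0// => cx; apply: nc; exact: mem_set.
under eq_bigr do rewrite E sqnM sqnr.
rewrite -mulr_sumr; apply: le_trans (_ : (k0 * a) ^+ 2 * ((2 * M%:R) ^+ n * n2 h) <= _).
  by rewrite ler_wpM2l ?sqr_ge0// wave_bessel.
apply: le_trans (_ : (k0 * a) ^+ 2 * ((2 * M%:R) ^+ n * (d * (b * n2 F))) <= _).
  by rewrite ler_wpM2l ?sqr_ge0// ler_wpM2l// ltW.
rewrite (_ : K * _ = (k0 * a) ^+ 2 * ((2 * M%:R) ^+ n * (d * (b * n2 F))) +
    a ^+ 2 * ((2 * M%:R) ^+ n * (d * (b * n2 F)))); last by rewrite /K; ring.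
by rewrite lerDl !mulr_ge0// ?n2_ge0// ltW.
Qed.

End exponentials.

(** * Powers of expansive matrices and Diophantine approximation *)

Section matrix_powers.
Variable R : realType.
Local Notation C := R[i].

Definition cabs (z : C) : R := Num.sqrt (sqn z).

Lemma cabsE z : `|z| = (cabs z)%:C.
Proof. exact: normc_def. Qed.

Lemma cabs_ge0 z : 0 <= cabs z. Proof. exact: sqrtr_ge0. Qed.

Lemma cabsM z w : cabs (z * w) = cabs z * cabs w.
Proof. by rewrite /cabs sqnM sqrtrM// sqn_ge0. Qed.

Lemma cabsD z w : cabs (z + w) <= cabs z + cabs w.
Proof. by have := ler_normD z w; rewrite !cabsE -rmorphD lecR. Qed.

Lemma cabs_real (r : R) : cabs r%:C = `|r|.
Proof. by rewrite /cabs sqnr sqrtr_sqr. Qed.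

(** Convergence to 0 for non-negative sequences, hence the one-sided bound. *)
Definition vanishing (u : nat -> R) := forall e : R, 0 < e ->
  exists N, forall i, (N <= i)%N -> u i <= e.

Lemma vanishing_recurrence (q : R) (a b : nat -> R) : 0 <= q < 1 ->
  (forall i, 0 <= a i) -> (forall i, a i.+1 <= q * a i + b i) -> vanishing b -> vanishing a.
Proof.
move=> /andP[q0 q1] a0 ab vb e e0.
(* Chosen so that e / 2 is the fixed point of the recurrence x -> q x + e (1 - q) / 2. *)
have e2 : 0 < e * (1 - q) / 2 by rewrite divr_gt0// mulr_gt0// subr_gt0.
have [N NP] := vb _ e2.
have step m : a (N + m)%N <= q ^+ m * a N + e / 2.
  elim: m => [|m IH]; first by rewrite addn0 expr0; lra.
  rewrite addnS; apply: le_trans (ab _) _.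
  have := NP (N + m)%N (leq_addr _ _).
  have := ler_wpM2l q0 IH.
  rewrite exprS -mulrA mulrDr; lra.
have qa : `|q| < 1 by rewrite ger0_norm.
have a1 : 0 < a N + 1 by have := a0 N; lra.
have e4 : 0 < e / 2 / (a N + 1) by rewrite !divr_gt0.
have /cvgrPdist_lt/(_ _ e4)[M _ MP] := cvg_expr qa.
exists (N + M)%N => i Mi.
have -> : i = (N + (i - N))%N by rewrite subnKC// (leq_trans _ Mi)// leq_addr.
apply: le_trans (step _) _.
have := MP (i - N)%N; rewrite /= sub0r normrN leq_subRL ?(leq_trans (leq_addr _ _) Mi)// => /(_ Mi).
rewrite ger0_norm ?exprn_ge0// ltr_pdivlMr// => h.
have : q ^+ (i - N) * a N <= q ^+ (i - N) * (a N + 1) by rewrite ler_wpM2l ?exprn_ge0//; lra.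
lra.
Qed.

(* Peeling the factors off a split annihilating polynomial replaces the Jordan
   form: each factor gives a linear recurrence with ratio r, |r| < 1. *)
Lemma vanishing_powers n (D : 'M[C]_n.+1) (rs : seq C) (X : 'M[C]_n.+1) :
  (forall r, r \in rs -> cabs r < 1) ->
  horner_mx D (\prod_(r <- rs) ('X - r%:P)) *m X = 0 ->
  forall i j, vanishing (fun k => cabs ((D ^+ k *m X) i j)).
Proof.
elim: rs X => [|r rs IH] X rs1.
  rewrite big_nil rmorph1 mul1mx => -> i j e e0; exists 0%N => k _.
  by rewrite mulmx0 mxE /cabs sqn0 sqrtr0 ltW.
rewrite big_cons mulrC rmorphM/= -mulmxA => H i j.
have r1 : 0 <= cabs r < 1 by rewrite cabs_ge0 rs1// inE eqxx.
have rs1' z : z \in rs -> cabs z < 1 by move=> zr; apply: rs1; rewrite inE zr orbT.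
have vY := IH _ rs1' H i j.
apply: (vanishing_recurrence r1 _ _ vY) => [k|k]; first exact: cabs_ge0.
have hX : horner_mx D ('X - r%:P) = D - r%:M by rewrite rmorphB/= horner_mx_X horner_mx_C.
have -> : D ^+ k.+1 *m X = r *: (D ^+ k *m X) + D ^+ k *m (horner_mx D ('X - r%:P) *m X).
  rewrite hX mulmxBl mulmxBr mul_scalar_mx -scalemxAr [RHS]addrC subrK.
  by rewrite exprSr -mulmxA.
by rewrite !mxE -cabsM; exact: cabsD.
Qed.

Lemma expansive_unitmx n (A : 'M[R]_n.+1) : expansive A -> A \in unitmx.
Proof.
move=> eA; rewrite unitmxE unitfE; apply/negP => /eqP dA.
have /eA : eigenvalue (map_mx (real_complex R) A) 0.
  by rewrite eigenvalue_root_char rootE horner_coef0 char_poly_det det_map_mx dA rmorph0 mulr0.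
by rewrite normr0 ltr10.
Qed.

(** The complex eigenvalues of the inverse are the inverses of those of [A], hence of modulus < 1;
    Cayley-Hamilton supplies the split annihilating polynomial. *)
Lemma expansive_powers n (A : 'M[R]_n.+1) : expansive A ->
  forall i j, vanishing (fun k => `|(invmx A ^+ k) i j|).
Proof.
move=> eA i j; have uA := expansive_unitmx eA.
pose D : 'M[C]_n.+1 := map_mx (real_complex R) (invmx A).
have [rs rsE] := closed_field_poly_normal (char_poly D).
have rs1 r : r \in rs -> cabs r < 1.
  move=> rrs; have rr : root (char_poly D) r.
    rewrite rsE (monicP (char_poly_monic D)) scale1r.
    by rewrite root_prod_XsubC.
  have /eigenvalueP[v vD v0] : eigenvalue D r by rewrite eigenvalue_root_char.
  have uA' : map_mx (real_complex R) A \in unitmx by rewrite map_unitmx.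
  have vE : v = r *: (v *m map_mx (real_complex R) A).
    by rewrite scalemxAl -vD -mulmxA /D map_invmx mulVmx// mulmx1.
  have r0 : r != 0 by apply: contraNneq v0 => r0; rewrite vE r0 scale0r.
  have /eA : eigenvalue (map_mx (real_complex R) A) r^-1.
    by apply/eigenvalueP; exists v => //; rewrite [in RHS]vE scalerA mulVf// scale1r.
  rewrite normfV invf_gt1 ?normr_gt0// cabsE.
  by rewrite (_ : 1 = (1 : R)%:C)// ltcR.
have := vanishing_powers (D := D) (X := 1%:M) rs1.
have <- : char_poly D = \prod_(r <- rs) ('X - r%:P).
  by rewrite [LHS]rsE (monicP (char_poly_monic D)) scale1r.
rewrite Cayley_Hamilton mul0mx.
move=> /(_ erefl i j) H e e0; have [N NP] := H e e0; exists N => k Nk.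
have := NP k Nk; rewrite mulmx1 (_ : D ^+ k = map_mx (real_complex R) (invmx A ^+ k)); last by rewrite rmorphXn.
by rewrite mxE cabs_real.
Qed.

End matrix_powers.

Section dirichlet.
Variable R : realType.

Lemma irrational_col n (A : 'M[R]_n) : ~ rational_mx A ->
  exists j i, forall q : rat, A i j != ratr q.
Proof.
move=> nA; apply: contrapT => H; apply: nA => i j; apply: contrapT => Hij.
by apply: H; exists j, i => q; apply/eqP => E; apply: Hij; exists q.
Qed.

(** Pigeonhole: among K^n + 1 multiples of [a], two have fractional parts in the same cell of side 1
    / K. Their difference is not an integer vector because the coordinate [i0] is irrational. *)
Lemma dirichlet n (a : 'cV[R]_n) (i0 : 'I_n) (K : nat) : (0 < K)%N ->
  (forall q : rat, a i0 0 != ratr q) ->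
  exists (k : int) (m : 'cV[int]_n),
    let v := k%:~R *: a - map_mx intr m in
    v != 0 /\ forall i, `|v i 0| <= K%:R^-1.
Proof.
case: K => // K _ airr.
pose fr (x : R) := x - (Num.floor x)%:~R.
have fr01 x : 0 <= fr x < 1.
  have := floor_itv x; rewrite intrD /fr => /andP[h1 h2].
  by rewrite subr_ge0 h1/= ltrBlDl.
have K0 : 0 < K.+1%:R :> R by rewrite ltr0n.
pose f (t : 'I_(K.+1 ^ n).+1) : {ffun 'I_n -> 'I_K.+1} :=
  [ffun i => inord (Num.truncn (K.+1%:R * fr ((t : nat)%:R * a i 0)))].
have ninj : ~ injective f.
  move=> /leq_card; rewrite card_ffun !card_ord ltnn//.
have [t [t' [ft tt']]] : exists t t' : 'I_(K.+1 ^ n).+1, f t = f t' /\ (t < t')%N.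
  apply: contrapT => H; apply: ninj => t t' ft; apply/val_inj/eqP.
  apply: contrapT => /negP; rewrite neq_ltn => /orP[tt'|tt'].
    by apply: H; exists t, t'.
  by apply: H; exists t', t.
pose k : int := (t'%:Z - t%:Z).
have k0 : k != 0 by rewrite subr_eq0 eqz_nat neq_ltn tt' orbT.
exists k, (\col_i (Num.floor (t'%:R * a i 0) - Num.floor (t%:R * a i 0))); split.
  apply/negP => /eqP /matrixP /(_ i0 0); rewrite !mxE => /eqP.
  rewrite subr_eq0 => /eqP E.
  have := airr ((Num.floor (t'%:R * a i0 0) - Num.floor (t%:R * a i0 0))%:~R / k%:~R).
  rewrite fmorph_div/= !ratr_int -E mulrAC divff ?mul1r ?eqxx//.
  by rewrite intr_eq0.
move=> i; rewrite !mxE.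
have -> : k%:~R * a i 0 - (Num.floor (t'%:R * a i 0) - Num.floor (t%:R * a i 0))%:~R =
    fr (t'%:R * a i 0) - fr (t%:R * a i 0).
  by rewrite /fr /k !intrD !mulrNz -!pmulrn; ring.
have := congr1 (fun g : {ffun 'I_n -> 'I_K.+1} => (g i : nat)) ft; rewrite !ffunE.
have tr x : K.+1%:R * fr x < K.+1%:R /\ 0 <= K.+1%:R * fr x.
  by have /andP[h1 h2] := fr01 x; rewrite gtr_pMr// h2 mulr_ge0// ltW.
have trK x : (Num.truncn (K.+1%:R * fr x) < K.+1)%N.
  have [h1 h2] := tr x; by rewrite truncn_lt_nat.
rewrite !inordK// => E.
have /andP[p1] := truncn_itv (tr (t%:R * a i 0)).2; rewrite -[X in _ < X]natr1 => p2.
have /andP[q1] := truncn_itv (tr (t'%:R * a i 0)).2; rewrite -[X in _ < X]natr1 => q2.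
rewrite -E in q1 q2.
rewrite -(ler_pM2r K0) mulVf ?lt0r_neq0// -[in leLHS](gtr0_norm K0) -normrM ler_norml.
by apply/andP; split; lra.
Qed.

End dirichlet.

(** * The space of negative dilates *)

Section closed_span.
Variables (R : realType) (n : nat).
Local Notation C := R[i].
Local Notation Rn := 'cV[R]_n.
Implicit Types (f g h : Rn -> C) (S : set (Rn -> C)).

Lemma lin_span_gen S f : S f -> lin_span S f.
Proof.
move=> Sf; exists 1%N, (fun=> 1), (fun=> f); split => //.
by apply/funext => x; rewrite big_ord1 mul1r.
Qed.

Lemma lin_span0 S : lin_span S (fun=> 0).
Proof.
exists 0%N, (fun=> 1), (fun=> fun=> 0); split; first by case.
by apply/funext => x; rewrite big_ord0.
Qed.

Lemma lin_spanD S f g : lin_span S f -> lin_span S g -> lin_span S (fun x => f x + g x).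
Proof.
move=> [m [a [u [Su ->]]]] [p [b [v [Sv ->]]]].
exists (m + p)%N, (fun i => match fintype.split i with inl i => a i | inr i => b i end),
  (fun i => match fintype.split i with inl i => u i | inr i => v i end).
split; first by move=> i; case: (fintype.split i).
apply/funext => x; rewrite big_split_ord/=; congr (_ + _); apply: eq_bigr => i _.
  by rewrite -/(unsplit (inl i)) unsplitK.
by rewrite -/(unsplit (inr i)) unsplitK.
Qed.

Lemma lin_spanZ S (z : C) f : lin_span S f -> lin_span S (fun x => z * f x).
Proof.
move=> [m [a [u [Su ->]]]]; exists m, (fun i => z * a i), u; split => //.
by apply/funext => x; rewrite mulr_sumr; apply: eq_bigr => i _; rewrite mulrA.
Qed.

Lemma lin_span_L2 S f : S `<=` @L2 R n -> lin_span S f -> L2 f.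
Proof.
move=> SL [m [a [u [Su ->]]]]; apply: (@L2_sum R n _ _ (fun i x => a i * u i x)) => i.
by apply: L2Z; exact: SL.
Qed.

Lemma closed_spanP S f : S `<=` @L2 R n -> closed_span S f <->
  L2 f /\ forall e : R, 0 < e -> exists2 g, lin_span S g & n2 (fun x => f x - g x) < e.
Proof.
move=> SL; split.
  move=> [/cLp2E Lf H]; split => // e e0.
  have [|g Sg] := H (Num.sqrt e); first by rewrite sqrtr_gt0.
  rewrite cLnorm2_lt ?sqrtr_ge0// sqr_sqrtr ?ltW// => fg; exists g => //.
  by rewrite -lte_fin L2_fin//; apply: L2B => //; exact: lin_span_L2 Sg.
move=> [Lf H]; split; first exact/cLp2E.
move=> e e0; have [|g Sg fg] := H (e ^+ 2); first by rewrite exprn_gt0.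
exists g => //; rewrite cLnorm2_lt ?ltW// -L2_fin ?lte_fin//.
by apply: L2B => //; exact: lin_span_L2 Sg.
Qed.

Lemma closed_span_gen S f : S `<=` @L2 R n -> S f -> closed_span S f.
Proof.
move=> SL Sf; apply/closed_spanP => //; split; first exact: SL.
move=> e e0; exists f; first exact: lin_span_gen.
by under eq_fun do rewrite subrr; rewrite n2_0.
Qed.

Lemma closed_spanD S f g : S `<=` @L2 R n -> closed_span S f -> closed_span S g ->
  closed_span S (fun x => f x + g x).
Proof.
move=> SL /(closed_spanP _ SL)[Lf hf] /(closed_spanP _ SL)[Lg hg].
apply/closed_spanP => //; split; [exact: L2D|move=> e e0].
have e4 : 0 < e / 4 by lra.
have [u Su fu] := hf _ e4; have [v Sv gv] := hg _ e4.
exists (fun x => u x + v x); first exact: lin_spanD.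
under eq_fun do rewrite opprD addrACA.
have Lu := lin_span_L2 SL Su; have Lv := lin_span_L2 SL Sv.
by apply: le_lt_trans (n2D_le (L2B Lf Lu) (L2B Lg Lv)) _; lra.
Qed.

Lemma closed_spanZ S (z : C) f : S `<=` @L2 R n -> closed_span S f ->
  closed_span S (fun x => z * f x).
Proof.
move=> SL /(closed_spanP _ SL)[Lf hf]; apply/closed_spanP => //; split; [exact: L2Z|move=> e e0].
have s0 : 0 < sqn z + 1 by have := sqn_ge0 z; lra.
have [u Su fu] := hf _ (divr_gt0 e0 s0).
exists (fun x => z * u x); first exact: lin_spanZ.
under eq_fun do rewrite -mulrBr.
have Lfu := L2B Lf (lin_span_L2 SL Su).
rewrite n2Z//; move: fu; rewrite ltr_pdivlMr// => fu; apply: le_lt_trans fu.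
by rewrite mulrC ler_wpM2l ?n2_ge0//; lra.
Qed.

Lemma closed_span_closed S f : S `<=` @L2 R n -> L2 f ->
  (forall e : R, 0 < e -> exists2 g, closed_span S g & n2 (fun x => f x - g x) < e) ->
  closed_span S f.
Proof.
move=> SL Lf H; apply/closed_spanP => //; split => // e e0.
have e4 : 0 < e / 4 by lra.
have [g cg fg] := H _ e4; have /(closed_spanP _ SL)[Lg hg] := cg.
have [u Su gu] := hg _ e4; exists u => //.
have Lu := lin_span_L2 SL Su.
rewrite (_ : (fun x => _) = fun x => (f x - g x) + (g x - u x)); last first.
  by apply/funext => x; rewrite addrA subrK.
by apply: le_lt_trans (n2D_le (L2B Lf Lg) (L2B Lg Lu)) _; lra.
Qed.

(** An operator that scales norms by a constant can be checked on generators alone. The form x -> a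
    f(s x) covers dilations and translations at once. *)
Lemma closed_span_image (a : C) (K : R) (s : Rn -> Rn) S S' : 0 < K ->
  S `<=` @L2 R n -> S' `<=` @L2 R n ->
  (forall f, L2 f -> L2 (fun x => a * f (s x)) /\ n2 (fun x => a * f (s x)) = K * n2 f) ->
  (forall f, S f -> closed_span S' (fun x => a * f (s x))) ->
  forall f, closed_span S f -> closed_span S' (fun x => a * f (s x)).
Proof.
move=> K0 SL SL' HU gen f /(closed_spanP _ SL)[Lf hf].
apply: closed_span_closed => //; first by have [] := HU _ Lf.
move=> e e0; have [g Sg fg] := hf _ (divr_gt0 e0 K0).
have Lg := lin_span_L2 SL Sg.
exists (fun x => a * g (s x)).
  case: Sg => m [b [u [Su ->]]] {fg Lg}.
  under eq_fun do rewrite mulr_sumr.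
  elim: m b u Su => [|m IH] b u Su.
    under eq_fun do rewrite big_ord0 -(mul0r 0).
    apply/closed_spanP => //; split; first by apply: L2Z; exact: L2_0.
    move=> e' e'0; exists (fun=> 0); first exact: lin_span0.
    by under eq_fun do rewrite mul0r subrr; rewrite n2_0.
  under eq_fun do rewrite big_ord_recr/= mulrCA.
  apply: closed_spanD => //; first exact: (IH (fun i => b (widen_ord (leqnSn m) i))
    (fun i => u (widen_ord (leqnSn m) i))).
  by apply: closed_spanZ => //; exact: gen.
under eq_fun do rewrite -mulrBr.
have [_ ->] := HU _ (L2B Lf Lg).
by rewrite -ltr_pdivlMl// mulrC.
Qed.

End closed_span.

Section wavelet_space.
Variables (R : realType) (n L : nat) (A : 'M[R]_n.+1) (psi : 'I_L -> 'cV[R]_n.+1 -> R[i]).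
Local Notation C := R[i].
Local Notation Rn := 'cV[R]_n.+1.
Implicit Types (f g h : Rn -> C).
Hypothesis uA : A \in unitmx.
Hypothesis Lpsi : forall l, L2 (psi l).

Local Notation e := (wavelet_system A psi).
Local Notation V0 := (negative_dilates A psi).
Local Notation S := [set wavelet_system A psi t | t in [set t | t.1.1 < 0]].

Lemma unit_exprz (j : int) : A ^ j \in unitmx.
Proof. by rewrite -[_ \in _]/(A ^ j \is a GRing.unit) unitrXz. Qed.

Lemma L2_dilation (P : 'M[R]_n.+1) : P \in unitmx -> exists2 K : R, 0 < K &
  forall f, L2 f -> L2 (dilation P f) /\ n2 (dilation P f) = K * n2 f.
Proof.
move=> uP; have [d d0 [_ dN]] := cintegral_linear_change uP.
have s0 : 0 < Num.sqrt `|\det P| by rewrite sqrtr_gt0 normr_gt0 -unitfE -unitmxE.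
exists (Num.sqrt `|\det P| ^+ 2 * d); first by rewrite mulr_gt0// exprn_gt0.
move=> f Lf; have [mf _] := Lf.
have L1 : L2 (fun x => f (P *m x)).
  by split; [exact: cmeasurable_linear|rewrite dN// -L2_fin// ltry].
split; first exact: L2Z.
by rewrite n2Z// sqnr /n2 dN// -L2_fin// mulrA.
Qed.

Lemma L2_system t : L2 (e t).
Proof.
case: t => -[j k] l /=; have [K _ H] := L2_dilation (unit_exprz j).
by have [] := H (translation (map_mx intr k) (psi l)); rewrite ?translationE//; exact: L2_shift.
Qed.

Lemma negative_system_L2 : S `<=` @L2 R n.+1.
Proof. by move=> _ [t _ <-]; exact: L2_system. Qed.

Lemma dilationM (P Q : 'M[R]_n.+1) f : dilation P (dilation Q f) = dilation (Q *m P) f.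
Proof.
apply/funext => x; rewrite /dilation mulrA -rmorphM/= mulmxA -sqrtrM//.
by rewrite det_mulmx normrM [X in Num.sqrt X]mulrC.
Qed.

Lemma dilation_exprz (j : int) f : dilation (invmx A) (dilation (A ^ j) f) = dilation (A ^ (j - 1)) f.
Proof.
rewrite dilationM; congr dilation.
by rewrite exprzDr.
Qed.

Lemma dilation_translation (y : Rn) f :
  translation (A *m y) (dilation (invmx A) f) = dilation (invmx A) (translation y f).
Proof.
by apply/funext => x; rewrite /translation /dilation mulmxBr mulKmx.
Qed.

Lemma dilation1 f : dilation 1 f = f.
Proof. by apply/funext => x; rewrite /dilation det1 normr1 sqrtr1 mul1mx mul1r. Qed.

Lemma negative_dilates_gen t : t.1.1 < 0 -> V0 (e t).
Proof. by move=> t0; apply: closed_span_gen; [exact: negative_system_L2|exists t]. Qed.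

Lemma negative_dilates_dilation f : V0 f -> V0 (dilation (invmx A) f).
Proof.
have uA' : invmx A \in unitmx by rewrite unitmx_inv.
have [K K0 KP] := L2_dilation uA'.
apply: (closed_span_image K0 negative_system_L2 negative_system_L2 KP) => _ [[[j k] l] /= j0 <-].
have -> : (fun x => (Num.sqrt `|\det (invmx A)|)%:C * dilation (A ^ j) (translation (map_mx intr k) (psi l)) (invmx A *m x))
  = e (j - 1, k, l) by rewrite /= -dilation_exprz.
by apply: negative_dilates_gen => /=; lia.
Qed.

Hypothesis SI : shift_invariant V0.

Lemma negative_dilates_translationA (k : 'cV[int]_n.+1) f : V0 f -> V0 (translation (A *m map_mx intr k) f).
Proof.
pose y : Rn := A *m map_mx intr k.
have -> g : translation y g = (fun x => 1 * g (- y + x)).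
  by rewrite translationE; apply/funext => x; rewrite mul1r.
apply: (closed_span_image ltr01 negative_system_L2 negative_system_L2) => [g Lg|_ [[[j k'] l] /= j0 <-]].
  under eq_fun do rewrite mul1r.
  by rewrite mul1r n2_shift; [split=> //; exact: L2_shift|case: Lg].
have -> : (fun x => 1 * dilation (A ^ j) (translation (map_mx intr k') (psi l)) (- y + x)) =
    dilation (invmx A) (translation (map_mx intr k) (e (j + 1, k', l))).
  rewrite -dilation_translation /= dilation_exprz addrK.
  by apply/funext => x; rewrite mul1r [- y + x]addrC.
have [j1|j1] := ltP (j + 1) 0.
  by apply: negative_dilates_dilation; apply: SI; exact: negative_dilates_gen.
(* Level j is reached from level j + 1. For j = -1 that is level 0, outside the reach of the
   hypothesis on V_0, but there T_k merely adds k to the translation index of a generator. *)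
have -> : j = - 1 by lia.
rewrite addNr /= expr0z dilation1.
have -> : translation (map_mx intr k) (translation (map_mx intr k') (psi l)) =
    dilation (A ^ 0) (translation (map_mx intr (k' + k)) (psi l)).
  rewrite expr0z dilation1; apply/funext => x; rewrite /translation; congr psi.
  by rewrite map_mxD opprD addrA addrAC.
rewrite dilation_exprz; exact: (@negative_dilates_gen (0 - 1, k' + k, l)).
Qed.

Lemma negative_dilatesD f g : V0 f -> V0 g -> V0 (fun x => f x + g x).
Proof. exact: closed_spanD negative_system_L2. Qed.

Lemma negative_dilatesZ (z : C) f : V0 f -> V0 (fun x => z * f x).
Proof. exact: closed_spanZ negative_system_L2. Qed.

End wavelet_space.

Section few_coefficients.
Variables (R : realType) (n : nat) (I : choiceType) (e : I -> 'cV[R]_n -> R[i]) (P : set I).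
Local Notation C := R[i].
Hypothesis Le : forall i, L2 (e i).
Hypothesis oe : forall i j, L2inner (e i) (e j) = (i == j)%:R.

(** A finite combination may repeat generators, whereas [best_approx] works with distinct
    indices. *)
Lemma collapse_sum m (a : 'I_m -> C) (t : 'I_m -> I) (x : 'cV[R]_n) :
  \sum_(i < m) a i * e (t i) x =
  \sum_(j <- undup [seq t i | i : 'I_m]) (\sum_(i < m | t i == j) a i) * e j x.
Proof.
under [RHS]eq_bigr do rewrite mulr_suml big_mkcond/=.
rewrite exchange_big/=; apply: eq_bigr => i _.
have ti : t i \in undup [seq t i | i : 'I_m].
  by rewrite mem_undup; apply/mapP; exists i; rewrite ?mem_enum.
rewrite (bigD1_seq (t i)) ?undup_uniq//= eqxx big1 ?addr0//.
by move=> j; rewrite eq_sym => /negPf ->.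
Qed.

(* A finite combination of the e i approximating f is no better than the
   orthogonal projection, whose error is at least (1 - q) n2 f. *)
Lemma few_coefficients f (q : R) : closed_span [set e i | i in P] f -> q < 1 ->
  (forall s : seq I, uniq s -> (forall i, i \in s -> P i) ->
     \sum_(i <- s) sqn (L2inner f (e i)) <= q * n2 f) ->
  n2 f = 0.
Proof.
have SL : [set e i | i in P] `<=` @L2 R n by move=> _ [i _ <-].
move=> /(closed_spanP _ SL)[Lf hf] q1 H.
apply/eqP; rewrite eq_le n2_ge0 andbT leNgt; apply/negP => f0.
have q0 : 0 < (1 - q) * n2 f by rewrite mulr_gt0// subr_gt0.
have [g [m [a [u [Su ->]]]] fg] := hf _ q0.
have /choice[t tP] : forall i, exists t, P t /\ e t = u i.
  by move=> i; have [t Pt <-] := Su i; exists t.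
pose s := undup [seq t i | i : 'I_m].
have us : uniq s by exact: undup_uniq.
have sP i : i \in s -> P i.
  by rewrite mem_undup => /mapP[j _ ->]; have [] := tP j.
have oe' i j : L2inner (e i) (e j) = ((1 : R) * (i == j)%:R)%:C.
  by rewrite oe mul1r rmorph_nat.
have := best_approx ltr01 Le oe' (fun j => \sum_(i < m | t i == j) a i) us Lf.
rewrite invr1 mul1r.
under [X in _ <= n2 X]eq_fun do rewrite -collapse_sum.
under [X in _ <= n2 X]eq_fun do under eq_bigr do rewrite (tP _).2.
have := H s us sP; lra.
Qed.

End few_coefficients.

(** * Concentration near the boundary of the spectrum *)

Section compact_support.
Variables (R : realType) (n : nat).
Local Notation C := R[i].
Local Notation Rn := 'cV[R]_n.+1.
Implicit Types g : Rn -> C.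

Lemma nbhs_cV (x : Rn) (P : set Rn) : nbhs x P ->
  exists2 r : R, 0 < r & forall y : Rn, (forall i, `|y i 0 - x i 0| < r) -> P y.
Proof.
move=> /nbhs_ballP[r /= r0 rP]; exists r => // y yr; apply: rP; split=> // i j.
by rewrite ord1 /ball/= distrC.
Qed.

Lemma cV_nbhs (x : Rn) (r : R) : 0 < r -> nbhs x [set y : Rn | forall i, `|y i 0 - x i 0| < r].
Proof.
move=> r0; apply/nbhs_ballP; exists r => //= y [_ yr] i.
by have := yr i 0; rewrite /ball/= distrC.
Qed.

Lemma csmooth_continuous g : csmooth g -> continuous (fun x => sqn (g x)).
Proof.
move=> /(_ 0%N)[[cr _] [ci _]] x.
under [X in _ _ X]eq_fun do rewrite /sqn !expr2.
exact: cvgD (cvgM (cr x) (cr x)) (cvgM (ci x) (ci x)).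
Qed.

Lemma compactly_supported_cube g : compactly_supported g ->
  exists M, forall x, ~ cube M x -> g x = 0.
Proof.
move=> /compact_bounded[b [_ /(_ (b + 1))]].
rewrite ltrDl ltr01 => /(_ isT) H.
exists (Num.truncn (b + 1)).+1 => x xM; apply/eqP/negPn/negP => gx.
apply: xM => i; rewrite -ler_norml.
apply: le_trans (ltW (truncnS_gt _)).
have : `|x| <= b + 1 by apply: H; exact: subset_closure.
rewrite [`|x|]mx_normrE; apply: le_trans.
exact: (le_bigmax _ (fun ij : 'I_n.+1 * 'I_1 => `|x ij.1 ij.2|) (i, 0)).
Qed.

(** Uniform continuity in the form used later. The set where [sqn (g x)] is at least d is compact
    and each of its points has a neighbourhood free of zeros; compactness makes the radius
    uniform. *)
Lemma near_zeros_small g : compactly_supported g -> continuous (fun x => sqn (g x)) ->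
  forall d : R, 0 < d -> exists2 r : R, 0 < r &
    forall x y : Rn, g y = 0 -> (forall i, `|y i 0 - x i 0| <= r) -> sqn (g x) <= d.
Proof.
move=> cg ctg d d0.
pose K : set Rn := [set x | d <= sqn (g x)].
have cK : compact K.
  apply: subclosed_compact cg _.
    exact: (@preimage_closed _ _ (fun x => sqn (g x)) [set y : R | d <= y] (fun x _ => ctg x) (closed_ge (y := d))).
  move=> x Kx; apply: subset_closure => /=; apply/eqP => gx.
  by move: Kx; rewrite /K/= gx sqn0; lra.
move/compact_near_coveringP : cK => /(_ R (0^'+)
  (fun r x => forall y : Rn, g y = 0 -> (forall i, `|y i 0 - x i 0| <= r) -> False)).
case=> [x Kx|e /= e0 H].
  have /nbhs_cV[r r0 rP] : \forall y \near x, 0 < sqn (g y).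
    by apply: (cvgr_gt (sqn (g x)) (ctg x)); apply: lt_le_trans d0 Kx.
  exists ([set z : Rn | forall i, `|z i 0 - x i 0| < r / 2], [set e : R | e < r / 2]).
    split=> /=; first by apply: cV_nbhs; lra.
    by apply: nbhs_right_lt; lra.
  move=> [z e] /= [zx er] y gy yz.
  have : 0 < sqn (g y).
    apply: rP => i; have := zx i; have := yz i; rewrite !ltr_norml ler_norml; lra.
  by rewrite gy sqn0 ltxx.
exists (e / 2); first by lra.
move=> x y gy yx; rewrite leNgt; apply/negP => /ltW dx.
apply: (H (e / 2) _ _ x dx y gy yx); last by lra.
rewrite /= sub0r normrN ger0_norm; lra.
Qed.

End compact_support.

Section mass.
Variables (R : realType) (n : nat).
Local Notation Rn := 'cV[R]_n.

Lemma n2_gt0 (F : Rn -> R[i]) (x : Rn) (r a : R) : L2 F -> 0 < r -> 0 < a ->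
  (forall y : Rn, (forall i, `|y i 0 - x i 0| <= r) -> a <= sqn (F y)) -> 0 < n2 F.
Proof.
move=> LF r0 a0 Fa.
pose G (y : Rn) := (Num.sqrt a)%:C * cindic (cV_box (- r) r) y.
have mB : measurable (cV_box (- r) r : set Rn) by exact: measurable_cV_box.
have Br : lebesgue_cV R n (cV_box (- r) r) = ((r - - r) ^+ n)%:E by rewrite cV_boxE//; lra.
have LB : L2 (cindic (cV_box (- r) r) : Rn -> R[i]).
  by apply: L2_cindic => //; rewrite [X in (X < _)%E]Br ltry.
rewrite -(n2_shift x (proj1 LF)).
apply: (@lt_le_trans _ _ (n2 G)).
  rewrite /G n2Z//.
  rewrite sqnr sqr_sqrtr ?(ltW a0)// mulr_gt0// /n2 N2_cindic//.
  by rewrite [X in fine X]Br/= exprn_gt0//; lra.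
apply: le_n2.
- by apply: cmeasurableZ; case: LB.
- exact: L2_shift.
move=> y; rewrite /G sqnM sqnr sqr_sqrtr ?(ltW a0)// sqn_cindic indicE.
case: (boolP (y \in cV_box (- r) r)) => [/set_mem yB|_]; last first.
  by rewrite mulr0; exact: sqn_ge0.
rewrite mulr1; apply: Fa => i; rewrite mxE addrAC subrr add0r.
by have := yB i; rewrite /= in_itv/= ler_norml; lra.
Qed.

End mass.

(** * Concentration by powers of a weight *)

Section concentration.
Variables (R : realType) (n : nat).
Local Notation C := R[i].
Local Notation Rn := 'cV[R]_n.
Implicit Types (F G : Rn -> C).

Lemma cindicM_L2 (E : set Rn) F : measurable E -> L2 F -> L2 (fun x => cindic E x * F x).
Proof.
move=> mE LF; apply: (le_L2 _ LF) => [|x].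
  by apply: cmeasurableM; [exact: cmeasurable_cindic|case: LF].
by rewrite sqnM sqn_cindic ler_piMl ?sqn_ge0// indicE lern1; case: (x \in E).
Qed.

(** The mass on [E] is at most a^(2N) [n2 F], while the total mass is at least b^(2N) times the
    positive mass of F on [G]. Their ratio tends to 0 since a < b. *)
Lemma concentration F (w : Rn -> R) (E G : set Rn) (a b eta : R) :
  0 <= a < b -> 0 < eta -> measurable E -> measurable G ->
  (forall N, L2 (fun x => (w x ^+ N)%:C * F x)) ->
  (forall x, F x != 0 -> 0 <= w x) ->
  (forall x, E x -> F x != 0 -> w x <= a) ->
  (forall x, G x -> F x != 0 -> b <= w x) ->
  0 < n2 (fun x => cindic G x * F x) ->
  exists2 N, 0 < n2 (fun x => (w x ^+ N)%:C * F x) &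
    n2 (fun x => cindic E x * ((w x ^+ N)%:C * F x)) <= eta * n2 (fun x => (w x ^+ N)%:C * F x).
Proof.
move=> /andP[a0 ab] eta0 mE mG Lw w0 wE wG; set m := n2 _ => m0.
have b0 : 0 < b by exact: le_lt_trans ab.
have LF : L2 F.
  by have := Lw 0%N; under [X in L2 X -> _]eq_fun do rewrite expr0 mul1r.
have up N : n2 (fun x => cindic E x * ((w x ^+ N)%:C * F x)) <= (a ^+ N) ^+ 2 * n2 F.
  rewrite -sqnr -n2Z//; apply: le_n2.
  - by case: (cindicM_L2 mE (Lw N)).
  - exact: L2Z.
  move=> x; rewrite !sqnM sqn_cindic !sqnr indicE.
  have [->|Fx] := eqVneq (F x) 0; first by rewrite sqn0 !mulr0.
  case: (boolP (x \in E)) => [/set_mem Ex|_]; last first.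
    by rewrite mul0r mulr_ge0 ?sqr_ge0 ?sqn_ge0.
  rewrite mul1r ler_wpM2r ?sqn_ge0// -!exprM.
  by rewrite lerXn2r ?nnegrE ?w0 ?wE.
have lo N : (b ^+ N) ^+ 2 * m <= n2 (fun x => (w x ^+ N)%:C * F x).
  rewrite -sqnr -n2Z; last exact: cindicM_L2.
  apply: le_n2 => //.
    by apply: cmeasurableZ; case: (cindicM_L2 mG LF).
  move=> x; rewrite !sqnM sqn_cindic !sqnr indicE.
  have [->|Fx] := eqVneq (F x) 0; first by rewrite sqn0 !mulr0.
  case: (boolP (x \in G)) => [/set_mem Gx|_]; last first.
    by rewrite mul0r mulr0 mulr_ge0 ?sqr_ge0 ?sqn_ge0.
  rewrite mul1r ler_wpM2r ?sqn_ge0// -!exprM.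
  by rewrite lerXn2r ?nnegrE ?w0 ?wG// ltW.
have q1 : `|(a / b) ^+ 2| < 1.
  rewrite ger0_norm ?sqr_ge0// expr_lt1// ?ltr_pdivrMr ?mul1r//.
  by rewrite divr_ge0// ltW.
have d0 : 0 < eta * m / (n2 F + 1).
  by rewrite divr_gt0 ?mulr_gt0//; have := n2_ge0 F; lra.
have := cvg_expr q1 => /cvgrPdist_lt/(_ _ d0)[N _ /(_ N (leqnn N))].
rewrite /= sub0r normrN -exprM ger0_norm; last by rewrite exprn_ge0// divr_ge0// ltW.
move=> h.
exists N; first by apply: lt_le_trans (lo N); rewrite mulr_gt0// !exprn_gt0.
apply: (le_trans (up N)).
apply: (le_trans _ (ler_wpM2l (ltW eta0) (lo N))).
move: h; rewrite mulnC exprM expr_div_n expr_div_n ltr_pdivlMr; last first.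
  by have := n2_ge0 F; lra.
rewrite mulrAC ltr_pdivrMr ?exprn_gt0// => h.
have /ltW : (a ^+ N) ^+ 2 * (n2 F + 1) < eta * ((b ^+ N) ^+ 2 * m) by rewrite [_ ^+ 2 * m]mulrC mulrA.
apply: le_trans; rewrite ler_wpM2l ?sqr_ge0//; lra.
Qed.

End concentration.

Section vanishing_sequences.
Variable R : realType.
Implicit Types u v : nat -> R.

Lemma vanishingD u v : vanishing u -> vanishing v -> vanishing (fun i => u i + v i).
Proof.
move=> hu hv e e0.
have [N1 H1] := hu (e / 2) ltac:(lra); have [N2 H2] := hv (e / 2) ltac:(lra).
exists (maxn N1 N2) => i; rewrite geq_max => /andP[/H1 h1 /H2 h2]; lra.
Qed.

Lemma vanishingZ (a : R) u : 0 <= a -> vanishing u -> vanishing (fun i => a * u i).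
Proof.
move=> a0 hu e e0; have a1 : 0 < a + 1 by lra.
have [N H] := hu (e / (a + 1)) (divr_gt0 e0 a1); exists N => i Ni.
apply: (le_trans (ler_wpM2l a0 (H i Ni))).
by rewrite mulrCA (ler_piMr (ltW e0))// ler_pdivrMr// mul1r; lra.
Qed.

Lemma vanishing_sum (I : Type) (s : seq I) (u : I -> nat -> R) :
  (forall j, vanishing (u j)) -> vanishing (fun i => \sum_(j <- s) u j i).
Proof.
move=> hu; elim: s => [|j s IH].
  by move=> e e0; exists 0%N => i _; rewrite big_nil ltW.
by under eq_fun do rewrite big_cons; exact: vanishingD.
Qed.

Lemma vanishing_shift u : vanishing u -> vanishing (fun i => u i.+1).
Proof. by move=> hu e /hu[N H]; exists N => i Ni; exact/H/(leq_trans Ni). Qed.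

Lemma vanishing_bounded u : vanishing u -> exists2 b : R, 0 < b & forall i, u i <= b.
Proof.
move=> /(_ 1 ltr01)[N H]; exists (1 + \sum_(j < N) `|u j|).
  by rewrite ltr_pwDl// sumr_ge0.
move=> i; have [iN|Ni] := ltnP i N; last first.
  by apply: (le_trans (H i Ni)); rewrite lerDl sumr_ge0.
rewrite (bigD1 (Ordinal iN))//= addrCA.
apply: le_trans (ler_norm _) _; rewrite lerDl addr_ge0//.
by apply: sumr_ge0.
Qed.

End vanishing_sequences.

(** * The wavelet system on the frequency side *)

Section wavelet_frequency.
Variables (R : realType) (n L : nat) (A : 'M[R]_n.+1).
Local Notation C := R[i].
Local Notation Rn := 'cV[R]_n.+1.
Variables (psi g : 'I_L -> Rn -> C).
Hypothesis uA : A \in unitmx.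
Hypothesis Fg : forall l, fourier_pair (psi l) (g l).

Definition freq_mx (j : int) : 'M[R]_n.+1 := (invmx (A ^ j))^T.

(** The Fourier transform of the generator of index t; [kap] collects the normalizing constant of
    each level. *)
Definition system_hat (kap : int -> R) (t : int * 'cV[int]_n.+1 * 'I_L) (xi : Rn) : C :=
  (kap t.1.1)%:C * (cis (- (2 * pi * dotp (int_cV R t.1.2) (freq_mx t.1.1 *m xi))) *
    g t.2 (freq_mx t.1.1 *m xi)).

Lemma freq_mx_unit j : freq_mx j \in unitmx.
Proof. by rewrite unitmx_tr unitmx_inv; exact: unit_exprz. Qed.

Lemma freq_mx_neg i : freq_mx (Negz i) = (A ^+ i.+1)^T.
Proof. by rewrite /freq_mx; congr trmx; exact: invrK. Qed.

Lemma fourier_pair_system : exists2 kap : int -> R, (forall j, 0 < kap j) &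
  forall t, fourier_pair (wavelet_system A psi t) (system_hat kap t).
Proof.
have /choice[kap kapP] : forall j, exists k : R, 0 < k /\ forall f F, fourier_pair f F ->
    fourier_pair (dilation (A ^ j) f) (fun xi => k%:C * F (freq_mx j *m xi)).
  by move=> j; have [k k0 kP] := fourier_pair_dilation (unit_exprz uA j); exists k.
exists kap => [j|[[j k] l]]; first by case: (kapP j).
have [_ H] := kapP j; exact: (H _ _ (fourier_pair_translation (map_mx intr k) (Fg l))).
Qed.

Lemma sqn_system_hat kap t xi : sqn (system_hat kap t xi) = kap t.1.1 ^+ 2 * sqn (g t.2 (freq_mx t.1.1 *m xi)).
Proof. by rewrite /system_hat !sqnM sqnr sqn_cis mul1r. Qed.

(** Negative levels are numbered by [Negz i] = -(i + 1). Those with i >= I have coefficient 0, as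
    their generators vanish where F lives; [level_bessel] bounds each of the finitely many remaining
    pairs of a level and a wavelet. *)
Lemma level_sum (M : nat) (kap : int -> R) (I : nat) : (0 < M)%N ->
  (forall l x, ~ cube M x -> g l x = 0) ->
  exists2 K : R, 0 <= K & forall F d, L2 F -> 0 <= d ->
    (forall xi, F xi != 0 -> forall (i : 'I_I) l, sqn (g l (freq_mx (Negz i) *m xi)) <= d) ->
    (forall xi, F xi != 0 -> forall i l, (I <= i)%N -> g l (freq_mx (Negz i) *m xi) = 0) ->
    forall s, uniq s -> (forall t, t \in s -> t.1.1 < 0) ->
    \sum_(t <- s) sqn (L2inner F (system_hat kap t)) <= K * (d * n2 F).
Proof.
move=> M0 gM.
have /choice[K KP] : forall il : 'I_I * 'I_L, exists K : R, 0 < K /\ forall F d, L2 F -> 0 <= d ->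
    (forall xi, F xi != 0 -> sqn (g il.2 (freq_mx (Negz il.1) *m xi)) <= d) ->
    forall s, uniq s ->
    \sum_(k <- s) sqn (L2inner F (system_hat kap (Negz il.1, k, il.2))) <= K * (d * n2 F).
  move=> il; have mg : cmeasurable (g il.2) by have [_ [] ] := Fg il.2.
  have [K K0 KP] := level_bessel M0 (kap (Negz il.1)) (freq_mx_unit (Negz il.1)) mg (gM il.2).
  by exists K.
exists (\sum_il K il) => [|F d LF d0 Fd F0 s us sneg].
  by apply: sumr_ge0 => il _; case: (KP il) => /ltW.
pose p (il : 'I_I * 'I_L) (t : int * 'cV[int]_n.+1 * 'I_L) :=
  (t.1.1 == Negz il.1) && (t.2 == il.2).
(* Each index is distributed over the pairs (level, wavelet), so that exchanging the sums groups
   them by pair. *)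
apply: (@le_trans _ _ (\sum_(t <- s) \sum_il
    (if p il t then sqn (L2inner F (system_hat kap t)) else 0))).
  rewrite big_seq [leRHS]big_seq; apply: ler_sum => -[[[i|i] k] l] /sneg//= _.
  have [iI|Ii] := ltnP i I.
    rewrite (bigD1 (Ordinal iI, l))//= /p/= !eqxx/= lerDl.
    by apply: sumr_ge0 => il _; case: ifP => // _; exact: sqn_ge0.
  rewrite (_ : L2inner _ _ = 0) ?sqn0; last first.
    rewrite /L2inner (_ : (fun x => _) = fun=> 0).
      by apply: complex_ext; rewrite /cintegral/= /Rintegral integral0.
    apply/funext => xi; have [->|Fx] := eqVneq (F xi) 0; first by rewrite mul0r.
    by rewrite /system_hat/= F0// !mulr0 conjC0 mulr0.
  by apply: sumr_ge0 => il _; case: ifP.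
rewrite exchange_big/= mulr_suml; apply: ler_sum => il _.
rewrite -big_mkcond/=.
have -> : \sum_(t <- s | p il t) sqn (L2inner F (system_hat kap t)) =
    \sum_(k <- [seq t.1.2 | t <- s & p il t]) sqn (L2inner F (system_hat kap (Negz il.1, k, il.2))).
  rewrite big_map big_filter; apply: eq_bigr => -[[i k] l] /andP[/= /eqP-> /eqP->//].
apply: (KP il).2 => //.
  by move=> xi Fx; exact: Fd.
rewrite map_inj_in_uniq ?filter_uniq// => -[[i k] l] [[i' k'] l'].
by rewrite !mem_filter => /andP[/andP[/= /eqP-> /eqP->] _] /andP[/andP[/= /eqP-> /eqP->] _] ->.
Qed.

End wavelet_frequency.

(** * A multiplier built from two opposite translations *)

Section boost.
Variables (R : realType) (n : nat) (v : 'cV[R]_n).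
Local Notation C := R[i].
Local Notation Rn := 'cV[R]_n.
Implicit Types (f F : Rn -> C).

(* The coefficient is 1 / (2 i), so that the Fourier transform of
   [boost f] is that of [f] times [weight]. *)
Definition boost f : Rn -> C :=
  fun x => f x + (0 +i* (- (1 / 2))) * (translation (- v) f x + (-1) * translation v f x).

Definition weight (xi : Rn) : R := 1 + sin (2 * pi * dotp v xi).

Lemma fourier_pair_boost f F : fourier_pair f F -> fourier_pair (boost f) (fun xi => (weight xi)%:C * F xi).
Proof.
move=> fF.
have := fourier_pairD fF (fourier_pairZ (0 +i* (- (1 / 2))) (fourier_pairD (fourier_pair_translation (- v) fF)
  (fourier_pairZ (-1) (fourier_pair_translation v fF)))).
congr fourier_pair; apply/funext => xi.
rewrite dotpNl mulrN opprK /weight.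
set t := 2 * pi * dotp v xi; rewrite mulrA -mulrDl mulrA -[X in X + _]mul1r -mulrDl.
congr (_ * _); apply: complex_ext; rewrite /cis cosN sinN/=; lra.
Qed.

Lemma fourier_pair_iter_boost N f F : fourier_pair f F ->
  fourier_pair (iter N boost f) (fun xi => (weight xi ^+ N)%:C * F xi).
Proof.
move=> fF; elim: N => [|N /fourier_pair_boost]/=.
  by under eq_fun do rewrite expr0 mul1r.
by congr fourier_pair; apply/funext => xi; rewrite exprS rmorphM mulrA.
Qed.

Lemma dotp_gt0 : v != 0 -> 0 < dotp v v.
Proof.
move=> v0; rewrite lt0r sumr_ge0 ?andbT => [|i _]; last by rewrite -expr2 sqr_ge0.
apply: contra v0; rewrite psumr_eq0 => [/allP h|i _]; last by rewrite -expr2 sqr_ge0.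
apply/eqP/colP => i; rewrite mxE; apply/eqP.
by have := h i (mem_index_enum _); rewrite /= mulf_eq0 orbb.
Qed.

Lemma cV_bounded (x : Rn) : exists2 b : R, 0 < b & forall i, `|x i 0| <= b.
Proof.
exists (1 + \sum_i `|x i 0|) => [|i]; first by rewrite ltr_pwDl// sumr_ge0.
rewrite (bigD1 i)//= addrCA lerDl addr_ge0//; exact: sumr_ge0.
Qed.

End boost.

Section slab.
Variables (R : realType) (n : nat) (v : 'cV[R]_n.+1).
Local Notation C := R[i].
Local Notation Rn := 'cV[R]_n.+1.

(* Moving xi by a small multiple of v leaves the set where g (T xi) lives, so
   g (T xi) is close to 0. *)
Lemma slab_small (g : Rn -> C) (T : 'M[R]_n.+1) (tau d : R) : v != 0 ->
  compactly_supported g -> continuous (fun x => sqn (g x)) ->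
  (forall xi, g (T *m xi) != 0 -> dotp v xi <= tau) -> 0 < d ->
  \forall e \near 0^'+, forall xi, tau - e < dotp v xi -> sqn (g (T *m xi)) <= d.
Proof.
move=> v0 kg cg gv d0.
have [r r0 H] := near_zeros_small kg cg d0.
have [K K0 KT] := cV_bounded_mulmx T.
have [b b0 bv] := cV_bounded v.
have vv := dotp_gt0 v0.
pose s := r / (K * b).
have s0 : 0 < s by rewrite divr_gt0// mulr_gt0.
near=> e.
move=> xi xe; apply: (H _ (T *m (xi + s *: v))) => [|i].
  apply/eqP/negPn/negP => /gv; apply/negP; rewrite -ltNge dotpDr dotpZr.
  have : e < s * dotp v v by near: e; apply: nbhs_right_lt; rewrite mulr_gt0.
  by lra.
rewrite mulmxDr mxE addrAC subrr add0r.
have -> : r = K * (s * b) by rewrite /s; field; rewrite !gt_eqF.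
apply: KT => [|j]; first by rewrite mulr_ge0 ?ltW.
by rewrite mxE normrM (gtr0_norm s0) ler_wpM2l// ltW.
Unshelve. all: by end_near. Qed.

Lemma nbhs_freq (g : Rn -> C) (T : 'M[R]_n.+1) (xi0 : Rn) (a : R) :
  continuous (fun x => sqn (g x)) -> a < sqn (g (T *m xi0)) ->
  exists2 r : R, 0 < r & forall xi : Rn, (forall i, `|xi i 0 - xi0 i 0| <= r) -> a < sqn (g (T *m xi)).
Proof.
move=> cg ga.
have near_xi0 := cvgr_gt (sqn (g (T *m xi0))) (cg (T *m xi0)) a ga.
have [r r0 rP] := nbhs_cV (near_xi0 _).
have [K K0 KT] := cV_bounded_mulmx T.
exists (r / (2 * K)) => [|xi h]; first by rewrite divr_gt0// mulr_gt0.
apply: rP => i.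
have -> : (T *m xi) i 0 - (T *m xi0) i 0 = (T *m (xi - xi0)) i 0 by rewrite mulmxBr !mxE.
apply: (@le_lt_trans _ _ (K * (r / (2 * K)))).
  apply: KT => [|j]; first by rewrite divr_ge0 ?ltW// mulr_gt0.
  by rewrite !mxE; exact: h.
have -> : K * (r / (2 * K)) = r / 2 by field; rewrite gt_eqF.
lra.
Qed.

Lemma nbhs_dotp (xi0 : Rn) (a : R) : a < dotp v xi0 ->
  exists2 r : R, 0 < r & forall xi : Rn, (forall i, `|xi i 0 - xi0 i 0| <= r) -> a < dotp v xi.
Proof.
move=> h; have [b b0 bv] := cV_bounded v.
(* The bound on the variation involves [n.+1]; [n.+2] leaves the margin b r for a strict
   inequality. *)
pose r := (dotp v xi0 - a) / (n.+2%:R * b).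
have n0 : 0 < n.+2%:R :> R by rewrite ltr0n.
have r0 : 0 < r by rewrite divr_gt0 ?subr_gt0// mulr_gt0.
exists r => // xi xr.
have : `|dotp v (xi - xi0)| <= n.+1%:R * (b * r).
  by apply: dotp_le => [||//|i]; [exact: ltW|exact: ltW|rewrite !mxE; exact: xr].
have -> : n.+1%:R * (b * r) = n.+2%:R * (b * r) - b * r.
  by rewrite -[n.+2]addn1 natrD; ring.
have -> : n.+2%:R * (b * r) = dotp v xi0 - a.
  by rewrite /r; field; rewrite !gt_eqF.
rewrite dotpDr dotpNr ler_norml => /andP[h1 _].
have : 0 < b * r by rewrite mulr_gt0.
lra.
Qed.

End slab.

Lemma ltr_sin2pi (R : realType) (s t : R) : - (1 / 4) <= s -> s < t -> t <= 1 / 4 ->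
  sin (2 * pi * s) < sin (2 * pi * t).
Proof. by have := pi_gt0 R => ? ? ? ?; rewrite ltr_sin ?in_itv/=; nra. Qed.

(** * The contradiction with invariance under a short vector *)

Section small_translations.
Variables (R : realType) (n L : nat) (A : 'M[R]_n.+1).
Local Notation C := R[i].
Local Notation Rn := 'cV[R]_n.+1.
Variables (psi g : 'I_L -> Rn -> C).
Hypothesis uA : A \in unitmx.
Hypothesis Fg : forall l, fourier_pair (psi l) (g l).
Hypothesis cg : forall l, continuous (fun x => sqn (g l x)).
Hypothesis kg : forall l, compactly_supported (g l).

Local Notation e := (wavelet_system A psi).
Local Notation V0 := (negative_dilates A psi).
Local Notation T i := (freq_mx A (Negz i)).

Lemma fourier_pair_L2 l : L2 (psi l). Proof. by have [] := Fg l. Qed.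

Lemma supports_cube : exists2 M, (0 < M)%N & forall l x, ~ cube M x -> g l x = 0.
Proof.
have /choice[M MP] := fun l => compactly_supported_cube (@kg l).
exists (\max_l M l).+1 => // l x xM; apply: MP => xMl; apply: xM => i.
have := xMl i; rewrite -!ler_norml => /le_trans; apply.
by rewrite ler_nat; apply: leqW; exact: leq_bigmax.
Qed.

(** The spectrum of level -(i + 1) is the image of a fixed cube, at most, under the transpose of
    A^-(i+1), whose entries tend to 0. *)
Lemma levels_vanish : expansive A -> exists2 b : nat -> R, vanishing b &
  forall i l xi, g l (T i *m xi) != 0 -> forall a, `|xi a 0| <= b i.
Proof.
move=> hA; have [M M0 gM] := supports_cube.
exists (fun i => M%:R * \sum_a \sum_c `|(invmx A ^+ i.+1) c a|).
  apply: vanishingZ => //; apply: vanishing_sum => a; apply: vanishing_sum => c.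
  exact: (vanishing_shift (expansive_powers hA c a)).
move=> i l xi gx a.
have xM : cube M (T i *m xi) by apply: contrapT => /gM h; rewrite h eqxx in gx.
have -> : xi = (invmx A ^+ i.+1)^T *m (T i *m xi).
  rewrite freq_mx_neg mulmxA -trmx_mul.
  have -> : A ^+ i.+1 *m invmx A ^+ i.+1 = 1%:M.
    rewrite -[invmx A ^+ _]/((A^-1) ^+ i.+1) exprVn.
    by apply: (mulrV (x := A ^+ i.+1)); exact: unitrX.
  by rewrite trmx1 mul1mx.
set y := T i *m xi in xM *; rewrite mxE (le_trans (ler_norm_sum _ _ _))//.
rewrite mulr_sumr [leRHS](bigD1 a)//= ler_wpDr//.
  by apply: sumr_ge0 => c _; rewrite mulr_ge0// sumr_ge0.
rewrite mulr_sumr; apply: ler_sum => c _; rewrite mxE normrM mulrC ler_wpM2r//.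
by rewrite ler_norml.
Qed.

Lemma negative_dilates_boost v f : (forall f, V0 f -> V0 (translation v f)) ->
  (forall f, V0 f -> V0 (translation (- v) f)) -> V0 f -> V0 (boost v f).
Proof.
move=> Vv VNv Vf; have LP := fourier_pair_L2.
apply: (negative_dilatesD uA LP Vf); apply: (negative_dilatesZ uA LP); apply: (negative_dilatesD uA LP (VNv _ Vf)).
by apply: (negative_dilatesZ uA LP); exact: Vv.
Qed.

Hypothesis oe : forall s t, L2inner (e s) (e t) = (s == t)%:R.

(** The last assumption makes the supremum [tau] positive. The function concentrated near [tau] is
    obtained by boosting a single generator [t0], which keeps it in V_0 and makes its Fourier
    transform explicit. *)
Lemma no_small_translation (v : Rn) : expansive A -> v != 0 ->
  (forall f, V0 f -> V0 (translation v f)) ->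
  (forall f, V0 f -> V0 (translation (- v) f)) ->
  (forall i l xi, g l (T i *m xi) != 0 -> `|dotp v xi| <= 1 / 4) ->
  (exists i l xi, g l (T i *m xi) != 0 /\ 0 < dotp v xi) -> False.
Proof.
move=> hA v0 Vv VNv small [i1 [l1 [xi1 [g1 xi1_gt0]]]].
have LP := fourier_pair_L2.
have [M M0 gM] := supports_cube.
have [b0 vb b0P] := levels_vanish hA.
have [kap kap0 FE] := fourier_pair_system uA Fg.
set c := plancherel_factor R n.+1; have c0 : 0 < c := plancherel_factor_gt0 _ _.
pose S := [set t : R | exists i l xi, g l (T i *m xi) != 0 /\ t = dotp v xi].
have S1 : S (dotp v xi1) by exists i1, l1, xi1.
have Sle t : S t -> t <= 1 / 4.
  by move=> [i [l [xi [/small h ->]]]]; rewrite (le_trans (ler_norm _)).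
have hS : has_sup S by split; [exists (dotp v xi1)|exists (1 / 4) => t /Sle].
pose tau := sup S.
have Stau i l xi : g l (T i *m xi) != 0 -> dotp v xi <= tau.
  by move=> gx; apply: ub_le_sup; [case: hS|exists i, l, xi].
have tau0 : 0 < tau by apply: lt_le_trans (Stau _ _ _ g1).
have tau4 : tau <= 1 / 4 by apply: ge_sup; [case: hS|move=> t /Sle].
(* Deep levels live close to 0, so they stay below tau / 2; here tau > 0 is essential. *)
have [I hI] : exists I, forall i l xi, (I <= i)%N -> g l (T i *m xi) != 0 ->
    dotp v xi <= tau / 2.
  have [w w0 wv] := cV_bounded v.
  have : vanishing (fun i => n.+1%:R * w * b0 i).
    by apply: vanishingZ => //; rewrite mulr_ge0// ltW.
  move=> /(_ (tau / 2) ltac:(lra))[I hI]; exists I => i l xi Ii gx.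
  apply: le_trans (hI i Ii); rewrite (le_trans (ler_norm _))// -mulrA.
  apply: dotp_le => //; first exact: ltW.
    by rewrite (le_trans _ (b0P _ _ _ gx ord0)).
  exact: b0P gx.
have [K K0 hK] := level_sum uA Fg kap I M0 gM.
(* Ensures K d <= c / 8; the 1 is added because K may be 0. *)
pose d := c / (8 * (K + 1)).
have d0 : 0 < d by rewrite divr_gt0// mulr_gt0// ltr_wpDl.
(* The slab above tau - eps lies above tau / 2, beyond all deep levels, and the finitely many other
   generators are small on it. *)
have [eps [eps0 eps_tau epsP]] : exists eps, [/\ 0 < eps, eps < tau / 4 &
    forall (il : 'I_I * 'I_L) xi, tau - eps < dotp v xi -> sqn (g il.2 (T il.1 *m xi)) <= d].
  apply: (@filter_ex _ (0^'+)); near=> eps; split.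
  - by near: eps; exact: nbhs_right_gt.
  - by near: eps; apply: nbhs_right_lt; lra.
  near: eps; apply: filter_forall => il.
  by apply: slab_small => // xi; exact: Stau.
(* A generator alive above tau - eps / 2: the gap from tau - eps to this level separates the two
   weights compared in [concentration]. *)
have [_ [i0 [l0 [xi0 [g0 ->]]]] xi0_gt] := sup_adherent (eps := eps / 2) ltac:(lra) hS.
rewrite -/tau in xi0_gt.
pose t0 : int * 'cV[int]_n.+1 * 'I_L := (Negz i0, 0, l0).
have LE t : L2 (system_hat A g kap t) by have [] := FE t.
pose E : set Rn := [set xi | dotp v xi <= tau - eps].
pose G : set Rn := [set xi | tau - eps / 2 < dotp v xi].
have mE : measurable E.
  have -> : E = setT `&` dotp v @^-1` `]-oo, tau - eps].
    by rewrite setTI; apply/seteqP; split => xi; rewrite /E/= in_itv.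
  by apply: (measurable_dotp v) => //; exact: measurable_itv.
have mG : measurable G.
  have -> : G = setT `&` dotp v @^-1` `]tau - eps / 2, +oo[.
    by rewrite setTI; apply/seteqP; split => xi; rewrite /G/= in_itv/= andbT.
  by apply: (measurable_dotp v) => //; exact: measurable_itv.
have LF N : L2 (fun xi => (weight v xi ^+ N)%:C * system_hat A g kap t0 xi).
  by have [] := fourier_pair_iter_boost v N (FE t0).
have supp xi : system_hat A g kap t0 xi != 0 -> `|dotp v xi| <= 1 / 4.
  by move=> h; apply: (@small i0 l0); apply: contra h => /eqP h; rewrite /system_hat/= h !mulr0.

have ler_weight (x y : R) : - (1 / 4) <= x -> x <= y -> y <= 1 / 4 ->
    1 + sin (2 * pi * x) <= 1 + sin (2 * pi * y).
  move=> x4 xy y4; rewrite lerD2l; have [->//|yx] := eqVneq x y.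
  by rewrite ltW// ltr_sin2pi// lt_neqAle yx.
have mass : 0 < n2 (fun xi => cindic G xi * system_hat A g kap t0 xi).
  pose a := sqn (g l0 (T i0 *m xi0)) / 2.
  have ga0 : 0 < sqn (g l0 (T i0 *m xi0)) 
    by rewrite lt0r sqn_ge0 andbT; apply: contra g0 => /eqP/sqn_eq0->.
  have a0 : 0 < a by rewrite /a; lra.
  have [r1 r10 r1P] := nbhs_freq (cg (l := l0)) (xi0 := xi0) (T := T i0) (a := a) ltac:(rewrite /a; lra).
  have [r2 r20 r2P] := nbhs_dotp xi0_gt.
  apply: (@n2_gt0 _ _ _ xi0 (Num.min r1 r2) (kap (Negz i0) ^+ 2 * a)).
  - exact: cindicM_L2.
  - by rewrite lt_min r10.
  - by rewrite mulr_gt0// exprn_gt0.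
  move=> y yr; rewrite sqnM sqn_cindic indicE mem_set; last first.
    by apply: r2P => i; rewrite (le_trans (yr i))// ge_min lexx orbT.
  rewrite mul1r sqn_system_hat ler_wpM2l ?sqr_ge0// ltW//; apply: r1P => i.
  by rewrite (le_trans (yr i))// ge_min lexx.
have [N FN0 hN] : exists2 N, 0 < n2 (fun xi => (weight v xi ^+ N)%:C * system_hat A g kap t0 xi) &
    n2 (fun xi => cindic E xi * ((weight v xi ^+ N)%:C * system_hat A g kap t0 xi)) <=
    1 / 8 * n2 (fun xi => (weight v xi ^+ N)%:C * system_hat A g kap t0 xi).
  apply: (@concentration _ _ _ _ E G (1 + sin (2 * pi * (tau - eps)))
    (1 + sin (2 * pi * (tau - eps / 2)))) => //.
  - by rewrite -lerBlDl sub0r sin_geN1/= ltrD2l ltr_sin2pi//; lra.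
  - by move=> xi _; rewrite -lerBlDl sub0r sin_geN1.
  - by move=> xi Exi /supp; rewrite ler_norml => /andP[? ?]; apply: ler_weight => //; lra.
  - by move=> xi Gxi /supp; rewrite ler_norml => /andP[? ?]; apply: ler_weight; [|exact: ltW|]; lra.
set F := (fun xi => (weight v xi ^+ N)%:C * system_hat A g kap t0 xi) in FN0 hN.
pose f := iter N (boost v) (e t0).
have fF : fourier_pair f F by exact: fourier_pair_iter_boost.
have Vf : V0 f.
  by rewrite /f; elim: N {FN0 hN F f fF} => [|N IH]/=;
    [exact: (negative_dilates_gen uA LP (t := t0))|exact: negative_dilates_boost].
have LFN : L2 F := LF N.
(* The remainder [Fr] lies below the slab and is small in norm; [Fs] lies in the slab, where the
   generators are small. *)
pose Fr xi := cindic E xi * F xi.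
pose Fs xi := F xi + (-1) * Fr xi.
have LFr : L2 Fr by exact: cindicM_L2.
have LFs : L2 Fs by exact: (L2D LFN (L2Z (-1) LFr)).
have FsE xi : Fs xi = if dotp v xi <= tau - eps then 0 else F xi.
  rewrite /Fs /Fr cindicE.
  have -> : (xi \in E) = (dotp v xi <= tau - eps) by apply/idP/idP; rewrite inE.
  by case: ifP => _; rewrite ?mul1r ?mul0r ?mulr0 ?addr0// mulN1r subrr.
have n2Fs : n2 Fs <= n2 F.
  apply: le_n2 LFN _; first by case: LFs.
  by move=> xi; rewrite FsE; case: ifP => // _; rewrite sqn0 sqn_ge0.
have oE s t : L2inner (system_hat A g kap s) (system_hat A g kap t) = (c * (s == t)%:R)%:C.
  by rewrite (L2inner_fourier_pair (FE s) (FE t)) oe rmorphM rmorph_nat.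
have : n2 f = 0.
  apply: (few_coefficients (P := [set t | t.1.1 < 0]) (L2_system uA LP) oe Vf (q := 1 / 2)).
    lra.
  move=> s us sneg.
  have hr : \sum_(t <- s) sqn (L2inner Fr (system_hat A g kap t)) <= c * n2 Fr.
    exact: bessel.
  have hs : \sum_(t <- s) sqn (L2inner Fs (system_hat A g kap t)) <= K * (d * n2 Fs).
    apply: hK => //; first exact: ltW.
      move=> xi; rewrite FsE; case: ifPn; first by rewrite eqxx.
      by rewrite -ltNge => h _ i l; exact: (epsP (i, l)).
    move=> xi; rewrite FsE; case: ifPn; first by rewrite eqxx.
    rewrite -ltNge => h _ i l Ii; apply/eqP/negPn/negP => /(hI _ _ _ Ii); lra.
  (* With c/8 for each part, doubled by this inequality, the sum is at most c/2 times [n2 F], that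
     is c^2/2 times [n2 f]: hence q = 1/2. *)
  have coef t : c ^+ 2 * sqn (L2inner f (e t)) <=
      2 * sqn (L2inner Fs (system_hat A g kap t)) + 2 * sqn (L2inner Fr (system_hat A g kap t)).
    rewrite -sqnr -sqnM -(L2inner_fourier_pair fF (FE t)); apply: le_trans (sqnD_le _ _).
    rewrite -L2innerDl//; under [X in _ <= sqn (L2inner X _)]eq_fun do rewrite /Fs mulN1r subrK.
    exact: lexx.
  have h1 : c ^+ 2 * \sum_(t <- s) sqn (L2inner f (e t)) <= 2 * (K * (d * n2 Fs)) + 2 * (c * n2 Fr).
    rewrite mulr_sumr; apply: (le_trans (ler_sum _ (fun t _ => coef t))).
    by rewrite big_split/= -!mulr_sumr; apply: lerD; rewrite ler_wpM2l.
  have Kd : K * d <= c / 8.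
    have K1 : 0 < K + 1 by rewrite ltr_wpDl.
    have -> : K * d = c / 8 * (K / (K + 1)) by rewrite /d; field; rewrite gt_eqF.
    rewrite ler_piMr//; first by rewrite divr_ge0// ltW.
    by rewrite ler_pdivrMr// mul1r lerDl.
  have h2 : K * (d * n2 Fs) <= c / 8 * n2 F.
    rewrite mulrA; apply: (@le_trans _ _ (c / 8 * n2 Fs)); first by rewrite ler_wpM2r ?n2_ge0.
    by rewrite ler_wpM2l// divr_ge0// ltW.
  have h3 : c * n2 Fr <= c / 8 * n2 F.
    by rewrite -mulrA; apply: ler_wpM2l (ltW c0) _ _ _; rewrite -[8^-1]mul1r.
  rewrite -(ler_pM2l (exprn_gt0 2 c0)); apply: (le_trans h1).
  have -> : c ^+ 2 * (1 / 2 * n2 f) = c / 2 * n2 F by rewrite (n2_fourier_pair fF) -/c; field.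
  by move: h2 h3; set u := n2 F; set u1 := K * _; set u2 := c * n2 Fr; clear; lra.
by move=> f0; move: FN0; rewrite (n2_fourier_pair fF) f0 mulr0 ltxx.
Unshelve. all: by end_near. Qed.

End small_translations.

(** * Lattice translations and the conclusion *)

Section lattice.
Variables (R : realType) (n L : nat) (A : 'M[R]_n.+1) (psi : 'I_L -> 'cV[R]_n.+1 -> R[i]).
Local Notation V0 := (negative_dilates A psi).

Lemma negative_dilates_lattice (j : 'I_n.+1) (k : int) (m : 'cV[int]_n.+1) f :
  A \in unitmx -> (forall l, L2 (psi l)) -> shift_invariant V0 ->
  V0 f -> V0 (translation (k%:~R *: col j A - map_mx intr m) f).
Proof.
move=> uA Lpsi SI Vf.
have -> : translation (k%:~R *: col j A - map_mx intr m) f =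
    translation (A *m map_mx intr (k *: delta_mx j 0)) (translation (map_mx intr (- m)) f).
  apply/funext => x; rewrite /translation; congr f.
  by rewrite map_mxZ map_delta_mx -scalemxAr -colE map_mxN opprD addrA.
by apply: negative_dilates_translationA => //; exact: SI.
Qed.

End lattice.

Theorem theorem1p4 (R : realType) (n : nat) (A : 'M[R]_n.+1) :
  expansive A ->
  (exists (L : nat) (psi : 'I_L -> 'cV[R]_n.+1 -> R[i]),
     [/\ orthonormal_wavelet A psi,
         forall l, exists g : 'cV[R]_n.+1 -> R[i],
           [/\ is_fourier_L2 (psi l) g, csmooth g & compactly_supported g] &
         shift_invariant (negative_dilates A psi)]) ->
  rational_mx A.
Proof.
move=> hA [L [psi [[_ [Lp oe span]] /choice[g gP] SI]]].
have uA := expansive_unitmx hA.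
have Fg l : fourier_pair (psi l) (g l) by have [/is_fourier_pair] := gP l.
have cg l : continuous (fun x => sqn (g l x)) by have [_ /csmooth_continuous] := gP l.
have kg l : compactly_supported (g l) by have [] := gP l.
have Lpsi := fourier_pair_L2 Fg.
(* A basis indexed by an empty set would force the indicator of the unit box to have norm 0:
   [few_coefficients] with q = 0. *)
have l0 : 'I_L.
  have [L0|L0] := posnP L; last exact: Ordinal L0.
  exfalso; pose B : set 'cV[R]_n.+1 := cV_box 0 1.
  have mB : measurable B by exact: measurable_cV_box.
  have B1 : lebesgue_cV R n.+1 B = 1%E by exact: cV_box01.
  have LB : L2 (cindic B) by apply: L2_cindic => //; rewrite B1 ltry.
  have : n2 (cindic B) = 0.
    apply: (few_coefficients (P := setT) (L2_system uA Lpsi) oe _ (ltr01 (R := R))).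
      by apply: span; rewrite cLp2E.
    by move=> [|[? l] ?]; [rewrite big_nil mul0r|have := ltn_ord l; rewrite {2}L0].
  by rewrite /n2 N2_cindic// B1/= => /eqP; rewrite oner_eq0.
apply: contrapT => /irrational_col[j [i0 irr]].
have [b vb bP] := levels_vanish uA kg hA.
have [b1 b10 bb1] := vanishing_bounded vb.
(* All negative levels live where coordinates are at most b1, so entries of v of size at most 1 / K
   give |dotp v xi| <= (n + 1) b1 / K < 1/4. *)
pose K := (Num.truncn (4 * (n.+1%:R * b1))).+1.
have hK : 4 * (n.+1%:R * b1) < K%:R by exact: truncnS_gt.
have [k [m]] := @dirichlet R n.+1 (col j A) i0 K isT (fun q => ltac:(rewrite mxE; exact: irr)).
set v := _ - _ => -[v0 vK].
have Vv f : negative_dilates A psi f -> negative_dilates A psi (translation v f).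
  exact: negative_dilates_lattice.
have VNv f : negative_dilates A psi f -> negative_dilates A psi (translation (- v) f).
  have -> : - v = (- k)%:~R *: col j A - map_mx intr (- m).
    by rewrite map_mxN opprK /v opprB rmorphN scaleNr addrC.
  exact: negative_dilates_lattice.
clearbody v.
have small i l xi : g l (freq_mx A (Negz i) *m xi) != 0 -> `|dotp v xi| <= 1 / 4.
  move=> gx; have K0 : 0 < K%:R :> R by rewrite ltr0n.
  apply: (@le_trans _ _ (n.+1%:R * (K%:R^-1 * b1))).
    apply: dotp_le => [|||a]; [by rewrite invr_ge0|exact: ltW|exact: vK|].
    exact: le_trans (bP _ _ _ gx a) (bb1 i).
  rewrite mulrCA mulrC ler_pdivrMr//; move: hK; set u := _%:R * b1; lra.
(* Otherwise a generator of norm 1 would have a vanishing Fourier transform. *)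
have [xi0 g0] : exists xi, g l0 (freq_mx A (Negz 0) *m xi) != 0.
  apply: contrapT => h; have [kap _ FE] := fourier_pair_system uA Fg.
  have := n2_fourier_pair (FE (Negz 0, 0, l0)).
  have -> : system_hat A g kap (Negz 0, 0, l0) = fun=> 0.
    apply/funext => xi; rewrite /system_hat/=.
    have -> : g l0 (freq_mx A (Negz 0) *m xi) = 0.
      by apply/eqP/negPn/negP => gx; apply: h; exists xi.
    by rewrite !mulr0.
  rewrite n2_0 => /esym/eqP; rewrite mulf_eq0 gt_eqF ?plancherel_factor_gt0//=.
  have := oe (Negz 0, 0, l0) (Negz 0, 0, l0).
  by rewrite L2inner_self; [rewrite eqxx => -[->]; rewrite oner_eq0|exact: L2_system].
(* Non-vanishing of g is an open condition, so xi0 can be moved slightly along v off the hyperplane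
   orthogonal to v. *)
have [xi [gxi dxi]] : exists xi, g l0 (freq_mx A (Negz 0) *m xi) != 0 /\ dotp v xi != 0.
  have [d0|d0] := eqVneq (dotp v xi0) 0; last by exists xi0.
  have s0 : 0 < sqn (g l0 (freq_mx A (Negz 0) *m xi0)).
    by rewrite lt0r sqn_ge0 andbT; apply: contra g0 => /eqP/sqn_eq0->.
  have [r r0 rP] := nbhs_freq (@cg l0) s0.
  have [w w0 vw] := cV_bounded v.
  exists (xi0 + (r / w) *: v); split.
    have : 0 < sqn (g l0 (freq_mx A (Negz 0) *m (xi0 + (r / w) *: v))).
      apply: rP => i; rewrite !mxE addrAC subrr add0r normrM gtr0_norm ?divr_gt0//.
      by rewrite mulrAC ler_pdivrMr// ler_wpM2l ?(ltW r0).
    by apply: contraTneq => ->; rewrite sqn0 ltxx.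
  by rewrite dotpDr d0 add0r dotpZr mulf_neq0// gt_eqF ?divr_gt0 ?dotp_gt0.
(* The sign decides between v and -v; the assumptions made on v are symmetric. *)
have [dpos|dneg|dz] := ltgtP 0 (dotp v xi); last by rewrite -dz eqxx in dxi.
- apply: (no_small_translation uA Fg cg kg oe hA v0 Vv VNv small).
  by exists 0%N, l0, xi.
- apply: (no_small_translation uA Fg cg kg oe hA (v := - v)).
  + by rewrite oppr_eq0.
  + exact: VNv.
  + by rewrite opprK.
  + by move=> i l y /small; rewrite dotpNl normrN.
  + by exists 0%N, l0, xi; rewrite dotpNl oppr_gt0.
Qed.
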